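(* Let $\mathcal S$ be the even part of the special Lie superalgebra $S(m,n;\underline t)$ over a field of characteristic $p>3$, with $m,n\ge3$. Then $$\mathrm{Der}(\mathcal S)=\mathrm{ad}(\overline{\mathcal S}+\mathcal T)\oplus\mathrm{span}_{\mathbb F}\{(\mathrm{ad}\,D_i)^{p^{r_i}}\mid i\in Y_0,\ 1\le r_i<t_i\},$$ where for $E\in\overline{\mathcal S}+\mathcal T$, $\mathrm{ad}\,E$ denotes the derivation $X\mapsto[E,X]$ of $\mathcal S$, and $(\mathrm{ad}\,D_i)^{p^{r_i}}$ is restricted to $\mathcal S$.
   Context: $\mathbb F$ is a field of characteristic $p>3$; $m,n\ge 3$; $\underline t=(t_1,\dots,t_m)$ positive integers, $\pi_i=p^{t_i}-1$. $Y_0=\{1,\dots,m\}$, $Y_1=\{m+1,\dots,m+n\}$, $Y=Y_0\cup Y_1$, $\tau(r)=\bar0$ on $Y_0$, $\bar1$ on $Y_1$. $\mathfrak A=\mathfrak A(m,n;\underline t)$ is the supercommutative superalgebra with basis $x^{(\alpha)}x^u$ ($\alpha\in\mathbb N_0^m$, $\alpha_i\le\pi_i$; $u$ an increasing sequence in $Y_1$, $x^u$ the product of the odd generators $x_k$, $k\in u$), with divided-power multiplication $x^{(\alpha)}x^{(\beta)}=\prod_i\binom{\alpha_i+\beta_i}{\alpha_i}x^{(\alpha+\beta)}$ (zero if some index exceeds $\pi_i$), anticommuting $x_k$, parity $|u|\bmod2$; $x_i=x^{(\varepsilon_i)}$ for $i\in Y_0$. $D_i$ ($i\in Y_0$) sends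 $x^{(\alpha)}x^u\mapsto x^{(\alpha-\varepsilon_i)}x^u$; $D_k$ ($k\in Y_1$) is the odd partial derivative $\partial/\partial x_k$; $D_r$ has parity $\tau(r)$. $W=W(m,n;\underline t)=\{\sum f_rD_r:f_r\in\mathfrak A\}$ with bracket $[fD_r,gD_s]=fD_r(g)D_s-(-1)^{\mathrm p(fD_r)\mathrm p(gD_s)}gD_s(f)D_r$. $D_{rs}(f)=(-1)^{\tau(r)\tau(s)}D_r(f)D_s-(-1)^{(\tau(r)+\tau(s))\mathrm p(f)}D_s(f)D_r$ and $S=\mathrm{span}\{D_{rs}(f): r,s\in Y, f\in\mathfrak A\}$. The divergence is $\mathrm{div}(\sum_r f_rD_r)=\sum_r(-1)^{\tau(r)\mathrm p(f_r)}D_r(f_r)$ and $\overline S=\{D\in W:\mathrm{div}(D)=0\}$. $\mathcal W,\mathcal S,\overline{\mathcal S}$ denote the even parts of $W,S,\overline S$. $\Gamma_r=x_rD_r$ and $\mathcal T=\mathrm{span}_{\mathbb F}\{\Gamma_r:r\in Y\}\subset\mathcal W$. (Elements of $\overline{\mathcal S}+\mathcal T$ normalize $\mathcal S$ inside $\mathcal W$.) *)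

(* Defs.v *)
From HB Require Import structures.
From mathcomp Require Import all_boot all_order all_algebra.
Import Order.TTheory GRing.Theory.
Local Open Scope ring_scope.

(* The even part of the special Lie superalgebra S(m,n;t) over a field F.
   All objects depend explicitly on (F p m n t). Indices: Y = 'I_(m+n),
   r : 'I_(m+n) is in Y_0 iff [split r] is [inl i] (i : 'I_m) and in Y_1 iff
   [split r] is [inr k] (k : 'I_n, standing for the odd index m+1+k). *)

Section SpecialSuper.
Variables (F : fieldType) (p m n : nat) (t : 'I_m -> nat).

Definition piD (i : 'I_m) : nat := (p ^ t i).-1.
Definition Nb : nat := (\max_(i < m) piD i).+1.

(* basis monomials x^(alpha) x^u, with alpha_i <= pi_i and u a subset of Y_1 *)
Definition Mon : finType :=
  {x : {ffun 'I_m -> 'I_Nb} * {set 'I_n} | [forall i, (x.1 i <= piD i)%N]}.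
Definition alpha (b : Mon) (i : 'I_m) : nat := (val b).1 i.
Definition uset (b : Mon) : {set 'I_n} := (val b).2.

(* the divided power superalgebra A(m,n;t), as coordinate vectors *)
Definition Alg := {ffun Mon -> F^o}.

(* the monomial x^(a) x^u; it is 0 when some a_i exceeds pi_i *)
Definition monoA (a : 'I_m -> nat) (u : {set 'I_n}) : Alg :=
  [ffun b : Mon => if [forall i, alpha b i == a i] && (uset b == u) then 1 else 0].

Definition sgn (b : bool) : F := (-1) ^+ b.

Definition mulB (b1 b2 : Mon) : Alg :=
  if [disjoint uset b1 & uset b2] then
    (((\prod_(i < m) 'C(alpha b1 i + alpha b2 i, alpha b1 i))%N%:R : F) *
      (-1) ^+ #|[set ab : 'I_n * 'I_n |
                  (ab.1 \in uset b1) && (ab.2 \in uset b2) && (ab.2 < ab.1)%N]|)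
    *: monoA (fun i => alpha b1 i + alpha b2 i)%N (uset b1 :|: uset b2)
  else 0.

Definition mulA (f g : Alg) : Alg :=
  \sum_(b1 : Mon) \sum_(b2 : Mon) (f b1 * g b2) *: mulB b1 b2.

Definition DevB (i : 'I_m) (b : Mon) : Alg :=
  if alpha b i == 0%N then 0
  else monoA (fun j => (alpha b j - (j == i))%N) (uset b).

(* D_k = d/dx_k, k in Y_1, on basis monomials (x^u = product in increasing order) *)
Definition DodB (k : 'I_n) (b : Mon) : Alg :=
  if k \in uset b then
    (-1) ^+ #|[set a in uset b | (a < k)%N]| *: monoA (alpha b) (uset b :\ k)
  else 0.

Definition tau (r : 'I_(m + n)) : bool := if split r is inr _ then true else false.

Definition DA (r : 'I_(m + n)) (f : Alg) : Alg :=
  \sum_(b : Mon) f b *: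
     (match split r with inl i => DevB i b | inr k => DodB k b end).

Definition projA (a : bool) (f : Alg) : Alg :=
  [ffun b : Mon => if odd #|uset b| == a then f b else 0].
Definition homog (a : bool) (f : Alg) : bool := projA a f == f.

(* W(m,n;t) = { sum_r f_r D_r } as functions Y -> A *)
Definition Wsp := {ffun 'I_(m + n) -> Alg}.
Definition single (r : 'I_(m + n)) (f : Alg) : Wsp :=
  [ffun s => if s == r then f else 0].

(* [f D_r, g D_s] for homogeneous f (parity a) and g (parity b) *)
Definition brH (a : bool) (f : Alg) (r : 'I_(m + n))
               (b : bool) (g : Alg) (s : 'I_(m + n)) : Wsp :=
  single s (mulA f (DA r g))
  - sgn ((a (+) tau r) && (b (+) tau s)) *: single r (mulA g (DA s f)).

Definition brW (E G : Wsp) : Wsp :=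
  \sum_(r < m + n) \sum_(s < m + n) \sum_(a : bool) \sum_(b : bool)
     brH a (projA a (E r)) r b (projA b (G s)) s.

Definition divW (E : Wsp) : Alg :=
  \sum_(r < m + n) \sum_(a : bool) sgn (tau r && a) *: DA r (projA a (E r)).

(* D_rs(f) for f homogeneous of parity b *)
Definition Drs (r s : 'I_(m + n)) (b : bool) (f : Alg) : Wsp :=
  sgn (tau r && tau s) *: single s (DA r f)
  - sgn ((tau r (+) tau s) && b) *: single r (DA s f).

(* S = span of the D_rs(f), f homogeneous (D_rs is linear in f, so the span
   is the set of finite sums) *)
Definition inS (E : Wsp) : Prop :=
  exists l : seq ('I_(m + n) * 'I_(m + n) * bool * Alg),
    (forall x, x \in l -> homog x.1.2 x.2) /\
    E = \sum_(x <- l) Drs x.1.1.1 x.1.1.2 x.1.2 x.2.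

Definition Weven (E : Wsp) : Prop := forall r, homog (tau r) (E r).

Definition inSS (E : Wsp) : Prop := inS E /\ Weven E.

Definition inSbarE (E : Wsp) : Prop := divW E = 0 /\ Weven E.

Definition xgen (r : 'I_(m + n)) : Alg :=
  match split r with
  | inl i => monoA (fun j => (j == i : nat)) set0
  | inr k => monoA (fun _ => 0%N) [set k]
  end.
Definition Gamma (r : 'I_(m + n)) : Wsp := single r (xgen r).

Definition inT (E : Wsp) : Prop :=
  exists c : 'I_(m + n) -> F, E = \sum_(r < m + n) c r *: Gamma r.

Definition inSbarT (E : Wsp) : Prop :=
  exists E1 E2, inSbarE E1 /\ inT E2 /\ E = E1 + E2.

Definition Dw (i : 'I_m) : Wsp := single (lshift n i) (monoA (fun _ => 0%N) set0).

(* phi (a map on W) restricts to a derivation of the Lie algebra calS;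
   two such derivations are equal iff they agree on calS *)
Definition isDerS (phi : Wsp -> Wsp) : Prop :=
  [/\ forall X, inSS X -> inSS (phi X),
      forall (c : F) X Y, inSS X -> inSS Y -> phi (c *: X + Y) = c *: phi X + phi Y
    & forall X Y, inSS X -> inSS Y -> phi (brW X Y) = brW (phi X) Y + brW X (phi Y)].

Definition padSum (c : 'I_m -> nat -> F) (X : Wsp) : Wsp :=
  \sum_(i < m) \sum_(1 <= r < t i) c i r *: iter (p ^ r) (brW (Dw i)) X.

End SpecialSuper.

(* Main.v *)
Require Import Defs.
From HB Require Import structures.
From mathcomp Require Import all_boot all_order all_algebra ring zify.
Import Order.TTheory GRing.Theory.
Set Implicit Arguments.
Unset Strict Implicit.
Unset Printing Implicit Defensive.
Local Open Scope ring_scope.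
Local Notation ev i := (lshift _ i).
Local Notation od k := (rshift _ k).
Local Notation z0 := (fun=> 0%N : nat).

(* For even fields the bracket is [E, G]_s = E(G_s) - G(E_s), and
   [E, G] + div(E) G - div(G) E is a sum of fields +-D_rs(E_r G_s). Hence an
   even E with constant divergence normalizes S; conversely [E, S] in S forces
   X(div E) = 0 for all X in S, so that div E is constant.

   Let psi be a derivation of S into the even fields. Because the fields
   psi(D_i) can be integrated, subtracting an inner derivation makes psi vanish
   on the D_i; then psi commutes with the ad D_i, so psi(X) is determined by the
   constant coefficients of psi on the fields D^a X. Further inner derivations
   make psi vanish on the torus elements x_i D_i + x_k D_k, so that psi preserves
   weights, and then on x_k D_l and x_k x_l D_i (k, l odd). On the x_i^(p^r) D_j
   weights leave one scalar for each (i, r), which is removed by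
   (ad D_i)^(p^r). Now psi = 0: the remaining fields D_rs(x^(a) x^u) either
   cannot have constant terms by weight, or are brackets [Z, Y] with psi(Z) = 0
   and Z of order at least 2, so that [Z, psi(Y)] has no constant terms. *)

(** Three obstacles shape the proof. Divided powers are truncated, so $x_i^{(\pi_i)}$ has no
    antiderivative in $x_i$: the fields [psi (Dw i)] can be integrated only if $D_i^{\pi_i}$ kills
    the $i$-th of them, which compatibility of mixed derivatives does not give. The torus of
    $\mathcal S$ consists of combinations of the $\Gamma_i+\Gamma_k$ ($i$ even, $k$ odd), and
    weights lie in $\mathbb F$. Weight identities among a few numbers of size 0 or 1 are lifted to
    the integers, because $|z|\le4<p$; the third index supplied by $m,n\ge3$ then separates even
    from odd weights. Weights do not see $p$-th powers: $x_i^{(p^r)}D_j$ has the weight of $D_j$,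
    and this is where the outer derivations come from. Values are taken in all even fields rather
    than in $\mathcal S$, since the fields subtracted on the way are not known to normalize
    $\mathcal S$; this is recovered at the end for their sum, because the given derivation and the
    powers preserve $\mathcal S$. *)

Section Coefficients.
Variables (F : fieldType) (p m n : nat) (t : 'I_m -> nat).
Local Notation A := (Alg F p m n t).
Local Notation Mn := (Mon p m n t).
Local Notation al := (alpha p m n t).
Local Notation us := (uset p m n t).
Local Notation mono := (monoA F p m n t).
Local Notation D := (DA F p m n t).

(** * Coefficients in the divided power superalgebra *)

Definition incr (i : 'I_m) (a : 'I_m -> nat) : 'I_m -> nat := fun j => (a j + (j == i))%N.
Definition decr (i : 'I_m) (a : 'I_m -> nat) : 'I_m -> nat := fun j => (a j - (j == i))%N.
Definition admissible (a : 'I_m -> nat) : bool := [forall i, a i <= piD p m t i]%N.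
Definition nbelow (u : {set 'I_n}) (k : 'I_n) : nat := #|[set a in u | (a < k)%N]|.

(* This is 0 when an exponent is out of range, as [mono a u] is. *)
Definition cf (f : A) (a : 'I_m -> nat) (u : {set 'I_n}) : F :=
  \sum_(b : Mn) mono a u b * f b.

Lemma admissible_alpha (b : Mn) : admissible (al b).
Proof. exact: (valP b). Qed.

Lemma Mon_ex (a : 'I_m -> nat) (u : {set 'I_n}) :
  admissible a -> {b : Mn | al b =1 a /\ us b = u}.
Proof.
move=> ha.
have hN i : (a i < Nb p m t)%N.
  rewrite ltnS; apply: leq_trans (forallP ha i) _.
  exact: (leq_bigmax i).
have hP : [forall i, (([ffun i => Ordinal (hN i)], u).1 i <= piD p m t i)%N].
  by apply/forallP => i; rewrite /= ffunE /=; exact: (forallP ha i).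
exists (Sub ([ffun i => Ordinal (hN i)], u) hP : Mn); split=> [i|].
  by rewrite /alpha /= ffunE.
by rewrite /uset.
Qed.

Lemma Mon_inj (b c : Mn) : al b =1 al c -> us b = us c -> b = c.
Proof.
move=> h1 h2; apply: val_inj; move: h1 h2; rewrite /alpha /uset.
case: (val b) (val c) => [x1 x2] [y1 y2] /= h1 h2; congr pair => //.
by apply/ffunP => i; apply: val_inj; exact: h1.
Qed.

Lemma monoE a u (b : Mn) :
  mono a u b = ([forall i, al b i == a i] && (us b == u))%:R.
Proof. by rewrite ffunE; case: ifP. Qed.

Lemma eq_mono a a' u : a =1 a' -> mono a u = mono a' u.
Proof.
move=> h; apply/ffunP => b; rewrite !monoE; congr (nat_of_bool (_ && _))%:R.
by apply: eq_forallb => i; rewrite h.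
Qed.

Lemma mono_alpha (b c : Mn) : mono (al b) (us b) c = (c == b)%:R.
Proof.
rewrite monoE; congr (nat_of_bool _)%:R; apply/andP/eqP => [[/forallP h /eqP h2]|->].
  by apply: Mon_inj => // i; exact/eqP.
by split=> //; apply/forallP.
Qed.

Lemma mono_out a u : ~~ admissible a -> mono a u = 0.
Proof.
move=> ha; apply/ffunP => b; rewrite monoE [RHS]ffunE.
case: forallP => //= h; case/negP: ha; apply/forallP => i.
by rewrite -(eqP (h i)); exact: (forallP (admissible_alpha b)).
Qed.

Lemma eq_cf f a a' u : a =1 a' -> cf f a u = cf f a' u.
Proof. by move=> h; apply: eq_bigr => b _; rewrite (eq_mono _ h). Qed.

Lemma cf_alpha f b : cf f (al b) (us b) = f b.
Proof.
rewrite /cf (bigD1 b) //= mono_alpha eqxx mul1r big1 ?addr0 // => c hc.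
by rewrite mono_alpha (negbTE hc) mul0r.
Qed.

Lemma cf_out f a u : ~~ admissible a -> cf f a u = 0.
Proof.
by move=> h; rewrite /cf mono_out //; apply: big1 => b _; rewrite ffunE mul0r.
Qed.

Lemma cfP (f g : A) : (forall a u, cf f a u = cf g a u) -> f = g.
Proof. by move=> h; apply/ffunP => b; rewrite -!cf_alpha. Qed.

Lemma cf_is_linear a u : linear (fun f => cf f a u : F^o).
Proof.
move=> c f g; rewrite /cf scaler_sumr -big_split /=; apply: eq_bigr => b _.
by rewrite [(c *: f + g) b]ffunE [(c *: f) b]ffunE mulrDr /GRing.scale /= mulrCA.
Qed.

Lemma cfD f g a u : cf (f + g) a u = cf f a u + cf g a u.
Proof. by have := cf_is_linear a u 1 f g; rewrite !scale1r. Qed.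
Lemma cf0 a u : cf 0 a u = 0.
Proof. by rewrite /cf big1 // => b _; rewrite [X in _ * X]ffunE mulr0. Qed.
Lemma cfZ c f a u : cf (c *: f) a u = c * cf f a u.
Proof. by have := cf_is_linear a u c f 0; rewrite !addr0 cf0 addr0. Qed.
Lemma cfN f a u : cf (- f) a u = - cf f a u.
Proof. by rewrite -scaleN1r cfZ mulN1r. Qed.
Lemma cfB f g a u : cf (f - g) a u = cf f a u - cf g a u.
Proof. by rewrite cfD cfN. Qed.
Lemma cf_sum (I : Type) (r : seq I) (P : pred I) (E : I -> A) a u :
  cf (\sum_(i <- r | P i) E i) a u = \sum_(i <- r | P i) cf (E i) a u.
Proof. by apply: (big_morph (fun f => cf f a u)); [move=> f g; exact: cfD|exact: cf0]. Qed.

Lemma cf_mono a u a' u' :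
  cf (mono a u) a' u' = (admissible a && [forall i, a' i == a i] && (u' == u))%:R.
Proof.
case: (boolP (admissible a)) => ha /=; last by rewrite mono_out // cf0.
case: (boolP (admissible a')) => ha'; last first.
  rewrite cf_out //; case: forallP => //= h; case/negP: ha'.
  by apply/forallP => i; rewrite (eqP (h i)); exact: (forallP ha).
have [b [h1 h2]] := Mon_ex u' ha'.
rewrite -(eq_cf _ _ h1) -h2 cf_alpha monoE; congr (nat_of_bool (_ && _))%:R.
by apply: eq_forallb => i; rewrite h1.
Qed.

Lemma cf_mono_id a u : admissible a -> cf (mono a u) a u = 1.
Proof. by move=> ha; rewrite cf_mono ha eqxx andbT; case: forallP => // []. Qed.

Lemma alg_basis (f : A) : f = \sum_(b : Mn) f b *: mono (al b) (us b).
Proof.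
apply/ffunP => c; rewrite sum_ffunE (bigD1 c) //= [X in X + _]ffunE mono_alpha eqxx.
rewrite big1 ?addr0 => [|b hb]; first by rewrite /GRing.scale /= mulr1.
by rewrite ffunE mono_alpha eq_sym (negbTE hb) scaler0.
Qed.

(** Reduces every identity that is linear in each argument to monomials with admissible
    exponents. *)
Lemma alg_ind (P : A -> Prop) :
  P 0 -> (forall c f g, P f -> P g -> P (c *: f + g)) ->
  (forall a u, admissible a -> P (mono a u)) -> forall f, P f.
Proof.
move=> h0 hl hm f; rewrite (alg_basis f); elim/big_rec: _ => // b x _ hx.
by apply: hl => //; apply: hm; exact: admissible_alpha.
Qed.

Lemma DA_is_linear r : linear (D r).
Proof.
move=> c f g; rewrite /DA scaler_sumr -big_split /=; apply: eq_bigr => b _.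
by rewrite !ffunE scalerDl scalerA.
Qed.
HB.instance Definition _ r := GRing.isLinear.Build F A A *:%R (D r) (DA_is_linear r).

Lemma DA0 r : D r 0 = 0. Proof. exact: linear0. Qed.
Lemma DAD r f g : D r (f + g) = D r f + D r g. Proof. exact: linearD. Qed.
Lemma DAN r f : D r (- f) = - D r f. Proof. exact: linearN. Qed.
Lemma DAZ r c f : D r (c *: f) = c *: D r f. Proof. exact: linearZ. Qed.
Lemma admissible_decr i a : admissible a -> admissible (decr i a).
Proof.
move/forallP => h; apply/forallP => j; apply: leq_trans (h j); exact: leq_subr.
Qed.

Lemma DA_mono_alpha r (b : Mn) : D r (mono (al b) (us b)) =
  match split r with inl i => DevB F p m n t i b | inr k => DodB F p m n t k b end.
Proof.
rewrite /DA (bigD1 b) //= mono_alpha eqxx scale1r big1 ?addr0 // => c hc.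
by rewrite mono_alpha (negbTE hc) scale0r.
Qed.

Lemma split_ev (i : 'I_m) : split (lshift n i) = inl i.
Proof. exact: (unsplitK (inl i)). Qed.
Lemma split_od (k : 'I_n) : split (rshift m k) = inr k.
Proof. exact: (unsplitK (inr k)). Qed.

Lemma Dev_mono i a u : admissible a ->
  D (ev i) (mono a u) = if a i == 0%N then 0 else mono (decr i a) u.
Proof.
move=> ha; have [b [h1 h2]] := Mon_ex u ha.
rewrite -(eq_mono _ h1) -h2 DA_mono_alpha split_ev /DevB h1.
case: ifP => // _; apply: eq_mono => j; rewrite /decr h1 //.
Qed.

Lemma Dod_mono k a u : admissible a ->
  D (od k) (mono a u) = if k \in u then (-1) ^+ nbelow u k *: mono a (u :\ k) else 0.
Proof.
move=> ha; have [b [h1 h2]] := Mon_ex u ha.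
by rewrite -(eq_mono _ h1) -h2 DA_mono_alpha split_od /DodB (eq_mono _ h1).
Qed.

Lemma cf_Dev i f a u : cf (D (ev i) f) a u = cf f (incr i a) u.
Proof.
elim/alg_ind: f => [|c f g hf hg|b v hb]; first by rewrite linear0 !cf0.
  by rewrite linearP !cfD !cfZ hf hg.
rewrite Dev_mono // cf_mono hb /=; case: ifPn => [/eqP h0|h0].
  rewrite cf0; case: forallP => //= h; move: (h i).
  by rewrite /incr eqxx h0 addn1.
rewrite cf_mono admissible_decr //=; congr (nat_of_bool (_ && _))%:R.
apply: eq_forallb => j; rewrite /incr /decr; case: (eqVneq j i) => [->|_].
  by case: (b i) h0 => // k _; rewrite subn1 addn1.
by rewrite subn0 addn0.
Qed.

Lemma cf_Dod k f a u : cf (D (od k) f) a u =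
  if k \in u then 0 else (-1) ^+ nbelow u k * cf f a (k |: u).
Proof.
elim/alg_ind: f => [|c f g hf hg|b v hb].
- by rewrite linear0 !cf0 mulr0; case: ifP.
- rewrite linearP !cfD !cfZ hf hg; case: ifP => // _; first by rewrite mulr0 addr0.
  by rewrite mulrDr mulrCA.
rewrite Dod_mono // [in RHS]cf_mono hb /=; case: ifPn => hk; last first.
  rewrite cf0; case: ifP => // _; case: (eqVneq (k |: u) v) => [e|]; last by rewrite andbF mulr0.
  by move: hk; rewrite -e !inE eqxx.
rewrite cfZ cf_mono hb /=; case: ifPn => hku.
  case: (eqVneq u (v :\ k)) => [e|]; last by rewrite andbF mulr0.
  by move: hku; rewrite e !inE eqxx.
have -> : (u == v :\ k) = (k |: u == v).
  apply/eqP/eqP => [->|<-]; first by rewrite setD1K.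
  by rewrite setU1K.
case: (eqVneq (k |: u) v) => [e|]; last by rewrite !andbF !mulr0.
congr (_ ^+ _ * _); rewrite /nbelow -e; apply: eq_card => j; rewrite !inE.
by case: (eqVneq j k) => //= ->; rewrite ltnn !andbF.
Qed.

Lemma alg_Dev_const f : (forall i, D (ev i) f = 0) ->
  forall a u, (exists i, a i != 0%N) -> cf f a u = 0.
Proof.
move=> h a u [i hi]; rewrite (@eq_cf _ _ (incr i (decr i a))) -?cf_Dev ?h ?cf0 //.
move=> j; rewrite /incr /decr subnK //; case: (eqVneq j i) => // ->.
by rewrite lt0n.
Qed.

End Coefficients.

(** * Signs of products of odd variables *)

Section Inversions.
Variable n : nat.
Implicit Types u v w : {set 'I_n}.

(** For disjoint sets, the number of transpositions that sort $u$ followed by $v$; it is the sign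
    exponent in [mulB]. *)
Definition inversions u v : nat :=
  #|[set ab : 'I_n * 'I_n | (ab.1 \in u) && (ab.2 \in v) && (ab.2 < ab.1)%N]|.

Lemma inversionsE u v :
  inversions u v = (\sum_(a in u) \sum_(b in v) (b < a)%N)%N.
Proof.
rewrite pair_big /inversions -sum1_card big_mkcond [RHS]big_mkcond /=.
by apply: eq_bigr => -[a b] _; rewrite inE /=; case: (_ \in u); case: (_ \in v); case: (_ < _)%N.
Qed.

Lemma disjointP u v : reflect (forall x, x \in u -> x \in v -> False) [disjoint u & v].
Proof.
apply: (iffP idP) => [h x hu hv|h]; first by rewrite (disjointFr h hu) in hv.
by apply/pred0P => x /=; apply/negP => /andP[h1 h2]; exact: h h1 h2.
Qed.

Lemma sum_setU_disjoint u v (f : 'I_n -> nat) : [disjoint u & v] ->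
  (\sum_(a in u :|: v) f a = \sum_(a in u) f a + \sum_(a in v) f a)%N.
Proof. by move=> h; rewrite -bigU //; apply: eq_bigl => a; rewrite !inE. Qed.

Lemma inversionsUl u v w : [disjoint u & v] ->
  inversions (u :|: v) w = (inversions u w + inversions v w)%N.
Proof. by move=> h; rewrite !inversionsE sum_setU_disjoint. Qed.

Lemma inversionsUr u v w : [disjoint v & w] ->
  inversions u (v :|: w) = (inversions u v + inversions u w)%N.
Proof.
by move=> h; rewrite !inversionsE -big_split; apply: eq_bigr => a _; rewrite sum_setU_disjoint.
Qed.

(** Each pair of distinct elements is out of order in exactly one of the two concatenations. This is
    the source of the sign $(-1)^{|u||v|}$ in supercommutativity. *)
Lemma inversions_sym u v : [disjoint u & v] ->
  (inversions u v + inversions v u = #|u| * #|v|)%N.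
Proof.
move=> h; rewrite !inversionsE [X in (_ + X)%N]exchange_big /= -big_split /=.
rewrite -sum_nat_const; apply: eq_bigr => a ha.
rewrite -big_split /= -[RHS]muln1 -sum_nat_const; apply: eq_bigr => b hb.
case: (ltngtP a b) => // /val_inj e; move/disjointP: h => /(_ a ha).
by rewrite e => /(_ hb).
Qed.

Lemma inversions_set1l u k : inversions [set k] u = nbelow u k.
Proof.
rewrite inversionsE big_set1 /nbelow -sum1_card big_mkcond [RHS]big_mkcond /=.
by apply: eq_bigr => b _; rewrite inE; case: (b \in u); case: (b < k)%N.
Qed.

Lemma nbelowD1 u k : nbelow (u :\ k) k = nbelow u k.
Proof.
apply: eq_card => j; rewrite !inE; case: (eqVneq j k) => //= ->.
by rewrite ltnn !andbF.
Qed.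

Lemma inversions0l v : inversions set0 v = 0%N.
Proof. by rewrite inversionsE big_set0. Qed.

End Inversions.

(** Both sides are $(a+b+c)!/(a!\,b!\,c!)$; this is associativity of the divided power product. *)
Lemma bin_trinomial a b c :
  ('C(a + b, a) * 'C(a + b + c, a + b) = 'C(b + c, b) * 'C(a + (b + c), a))%N.
Proof.
have h x y : ('C(x + y, x) * (x`! * y`!) = (x + y)`!)%N.
  by rewrite -[y in (_ * y`!)%N](addKn x) bin_fact ?leq_addr.
apply/eqP; rewrite -(eqn_pmul2r (fact_gt0 a)) -(eqn_pmul2r (fact_gt0 b)).
rewrite -(eqn_pmul2r (fact_gt0 c)); apply/eqP.
transitivity ((a + b + c)`!); first by rewrite -(h (a + b)%N c) -(h a b); ring.
by rewrite -addnA -(h a (b + c)%N) -(h b c); ring.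
Qed.

(** * The algebra: associativity, parity, supercommutativity *)

Section Product.
Variables (F : fieldType) (p m n : nat) (t : 'I_m -> nat).
Local Notation A := (Alg F p m n t).
Local Notation Mn := (Mon p m n t).
Local Notation al := (alpha p m n t).
Local Notation us := (uset p m n t).
Local Notation mono := (@monoA F p m n t).
Local Notation D := (@DA F p m n t).
Local Notation "f ** g" := (@Defs.mulA F p m n t f g) (at level 40, left associativity).

Local Notation homog := (@homog F p m n t).

Implicit Types (f g h : A) (a b : 'I_m -> nat) (u v w : {set 'I_n}).

Lemma mulA_is_linear f : linear (@Defs.mulA F p m n t f : A -> A).
Proof.
move=> c g h; rewrite /Defs.mulA scaler_sumr -big_split /=; apply: eq_bigr => b1 _.
rewrite scaler_sumr -big_split /=; apply: eq_bigr => b2 _.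
by rewrite [(c *: g + h) b2]ffunE [(c *: g) b2]ffunE mulrDr scalerDl scalerA mulrCA.
Qed.
HB.instance Definition _ f := GRing.isLinear.Build F A A *:%R (Defs.mulA F p m n t f) (mulA_is_linear f).

Lemma mulA_linearl g c f h : (c *: f + h) ** g = c *: (f ** g) + h ** g.
Proof.
rewrite /Defs.mulA scaler_sumr -big_split /=; apply: eq_bigr => b1 _.
rewrite scaler_sumr -big_split /=; apply: eq_bigr => b2 _.
by rewrite [(c *: f + h) b1]ffunE [(c *: f) b1]ffunE mulrDl scalerDl scalerA mulrA.
Qed.

Lemma mulADl f g h : (f + g) ** h = f ** h + g ** h.
Proof. by have := mulA_linearl h 1 f g; rewrite !scale1r. Qed.
Lemma mulA0l g : 0 ** g = 0.
Proof. by apply: (addIr (0 ** g)); rewrite -mulADl !add0r. Qed.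
Lemma mulAZl c f g : (c *: f) ** g = c *: (f ** g).
Proof. by have := mulA_linearl g c f 0; rewrite mulA0l !addr0. Qed.
Lemma mulANl f g : (- f) ** g = - (f ** g).
Proof. by rewrite -scaleN1r mulAZl scaleN1r. Qed.
Lemma mulABl f g h : (f - g) ** h = f ** h - g ** h.
Proof. by rewrite mulADl mulANl. Qed.
Lemma mulA_suml (I : Type) (r : seq I) (P : pred I) (E : I -> A) g :
  (\sum_(i <- r | P i) E i) ** g = \sum_(i <- r | P i) E i ** g.
Proof. by apply: (big_morph (fun f => f ** g)); [move=> x y; exact: mulADl|exact: mulA0l]. Qed.
Lemma mulA0r f : f ** 0 = 0. Proof. exact: linear0. Qed.
Lemma mulADr f g h : f ** (g + h) = f ** g + f ** h. Proof. exact: linearD. Qed.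
Lemma mulAZr c f g : f ** (c *: g) = c *: (f ** g). Proof. exact: linearZ. Qed.
Lemma mulA_sumr (I : Type) (r : seq I) (P : pred I) (E : I -> A) f :
  f ** (\sum_(i <- r | P i) E i) = \sum_(i <- r | P i) f ** E i.
Proof. exact: linear_sum. Qed.

Definition addx (a b : 'I_m -> nat) : 'I_m -> nat := fun i => (a i + b i)%N.

Lemma admissible_addl a b : admissible p t (addx a b) -> admissible p t a.
Proof. by move/forallP => h; apply/forallP => i; apply: leq_trans (h i); exact: leq_addr. Qed.
Lemma admissible_addr a b : admissible p t (addx a b) -> admissible p t b.
Proof. by move/forallP => h; apply/forallP => i; apply: leq_trans (h i); exact: leq_addl. Qed.

Lemma mono_mul a u b v : mono a u ** mono b v =
  if [disjoint u & v] then
    (((\prod_(i < m) 'C(a i + b i, a i))%N)%:R * (-1) ^+ inversions u v) *: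
      mono (addx a b) (u :|: v)
  else 0.
Proof.
have z (P : bool) (c : F) : ~~ admissible p t (addx a b) ->
   (if P then c *: mono (addx a b) (u :|: v) else 0) = 0.
  by move=> h; rewrite mono_out // scaler0; case: P.
case: (boolP (admissible p t a)) => ha; last first.
  by rewrite mono_out // mulA0l z //; apply: contra ha; exact: admissible_addl.
case: (boolP (admissible p t b)) => hb; last first.
  by rewrite [mono b v]mono_out // mulA0r z //; apply: contra hb; exact: admissible_addr.
have [x [hx1 hx2]] := Mon_ex u ha; have [y [hy1 hy2]] := Mon_ex v hb.
rewrite -(eq_mono _ _ _ _ hx1) -(eq_mono _ _ _ _ hy1) -hx2 -hy2 /Defs.mulA (bigD1 x) //= (bigD1 y) //=.
rewrite !mono_alpha !eqxx mulr1 scale1r big1 ?addr0 => [|c hc]; last first.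
  by rewrite mono_alpha (negbTE hc) mulr0 scale0r.
rewrite big1 ?addr0 => [|c hc]; last first.
  by rewrite big1 // => d _; rewrite mono_alpha (negbTE hc) mul0r scale0r.
rewrite /mulB; case: ifP => // _; congr (_%:R * _ *: _).
  by apply: eq_bigr => i _; rewrite hx1 hy1.
by apply: eq_mono => i; rewrite /addx hx1 hy1.
Qed.

Lemma mulAA f g h : f ** (g ** h) = f ** g ** h.
Proof.
elim/alg_ind: f => [|c f f' hf hf'|a u _]; first by rewrite !mulA0l.
  by rewrite !mulA_linearl hf hf'.
elim/alg_ind: g => [|c g g' hg hg'|b v _]; first by rewrite mulA0l !mulA0r mulA0l.
  by rewrite mulA_linearl !linearP /= mulA_linearl hg hg'.
elim/alg_ind: h => [|c h h' hh hh'|d w _]; first by rewrite !mulA0r.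
  by rewrite !linearP /= hh hh'.
rewrite [mono b v ** _]mono_mul [mono a u ** mono b v]mono_mul.
have dUl : [disjoint u :|: v & w] = [disjoint u & w] && [disjoint v & w].
  by rewrite -!setI_eq0 setIUl setU_eq0.
have dUr : [disjoint u & v :|: w] = [disjoint u & v] && [disjoint u & w].
  by rewrite -!setI_eq0 setIUr setU_eq0.
case: (boolP [disjoint v & w]) => hvw; last first.
  rewrite mulA0r; case: ifP => _; last by rewrite mulA0l.
  by rewrite mulAZl mono_mul dUl (negbTE hvw) andbF scaler0.
case: (boolP [disjoint u & v]) => huv; last first.
  by rewrite mulA0l mulAZr mono_mul dUr (negbTE huv) /= scaler0.
rewrite mulAZl mulAZr !mono_mul dUl dUr huv hvw andbT /=.
case: ifP => huw; last by rewrite !scaler0.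
rewrite !scalerA setUA; congr (_ *: _); last first.
  by apply: eq_mono => i; rewrite /addx addnA.
rewrite inversionsUl // inversionsUr // !exprD.
rewrite mulrACA [RHS]mulrACA -!natrM -!big_split /=; congr (_%:R * _); last first.
  by rewrite mulrC -mulrA.
by apply: eq_bigr => i _; rewrite /addx [RHS]bin_trinomial.
Qed.

(** The parity automorphism, which multiplies the part of parity $c$ by $(-1)^c$. With it the
    Leibniz rule for odd derivatives needs no homogeneity. *)
Definition par (f : A) : A := [ffun b : Mn => (-1) ^+ #|us b| * f b].
Lemma par_is_linear : linear par.
Proof.
by move=> c f g; apply/ffunP => b; rewrite !ffunE mulrDr /GRing.scale /= mulrCA.
Qed.
HB.instance Definition _ := GRing.isLinear.Build F A A *:%R par par_is_linear.

Lemma par_mono a u : par (mono a u) = (-1) ^+ #|u| *: mono a u.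
Proof.
apply/ffunP => b; rewrite !ffunE /GRing.scale /=; case: ifP => [/andP[_ /eqP ->] //|_].
by rewrite !mulr0.
Qed.

Lemma homogP (c : bool) f : reflect (forall b : Mn, odd #|us b| != c -> f b = 0) (homog c f).
Proof.
apply: (iffP eqP) => [<- b /negbTE h|h]; first by rewrite ffunE h.
by apply/ffunP => b; rewrite ffunE; case: eqP => [//|/eqP /h].
Qed.

Lemma homog0 c : homog c (0 : A).
Proof. by apply/homogP => b _; rewrite ffunE. Qed.
Lemma homogP_lin c k f g : homog c f -> homog c g -> homog c (k *: f + g).
Proof.
move=> /homogP hf /homogP hg; apply/homogP => b hb; rewrite ffunE [(k *: f) b]ffunE.
by rewrite hf // hg // scaler0 addr0.
Qed.
Lemma homogZ c k f : homog c f -> homog c (k *: f).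
Proof. by move=> h; rewrite -[_ *: _]addr0; apply: homogP_lin => //; exact: homog0. Qed.
Lemma homogD c f g : homog c f -> homog c g -> homog c (f + g).
Proof. by move=> h h'; rewrite -[f]scale1r; exact: homogP_lin. Qed.
Lemma homogN c f : homog c f -> homog c (- f).
Proof. by rewrite -scaleN1r; exact: homogZ. Qed.
Lemma homogB c f g : homog c f -> homog c g -> homog c (f - g).
Proof. by move=> h h'; apply: homogD => //; exact: homogN. Qed.
Lemma homog_sum c (I : Type) (r : seq I) (P : pred I) (E : I -> A) :
  (forall i, P i -> homog c (E i)) -> homog c (\sum_(i <- r | P i) E i).
Proof. by move=> h; elim/big_ind: _ => //; [exact: homog0|move=> x y; exact: homogD]. Qed.
Lemma homog_mono a u : homog (odd #|u|) (mono a u).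
Proof.
by apply/homogP => b h; rewrite monoE; case: (eqVneq (us b) u) h => [->|_ _]; rewrite ?eqxx ?andbF.
Qed.

Lemma homog_ind c (P : A -> Prop) :
  P 0 -> (forall k f g, P f -> P g -> P (k *: f + g)) ->
  (forall a u, admissible p t a -> odd #|u| = c -> P (mono a u)) ->
  forall f, homog c f -> P f.
Proof.
move=> h0 hl hm f /homogP hf; rewrite (alg_basis f); elim/big_rec: _ => // b x _ hx.
case: (eqVneq (odd #|us b|) c) => hb; last by rewrite hf // scale0r add0r.
by apply: hl => //; apply: hm => //; exact: admissible_alpha.
Qed.

Lemma par_homog c f : homog c f -> par f = (-1) ^+ c *: f.
Proof.
move: f; apply: homog_ind => [|k f g hf hg|a u _ <-].
- by rewrite linear0 scaler0.
- by rewrite par_is_linear hf hg scalerDr !scalerA mulrC.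
- by rewrite par_mono signr_odd.
Qed.

Lemma homog_mul c d f g : homog c f -> homog d g -> homog (c (+) d) (f ** g).
Proof.
move=> hf hg; move: f hf; apply: homog_ind => [|k f f' hf hf'|a u _ hu].
- by rewrite mulA0l homog0.
- by rewrite mulA_linearl homogP_lin.
move: g hg; apply: homog_ind => [|k f f' hf hf'|b v _ hv].
- by rewrite mulA0r homog0.
- by rewrite linearP homogP_lin.
rewrite mono_mul; case: ifP => h; last exact: homog0.
apply: homogZ; rewrite -hu -hv -oddD.
suff -> : (#|u| + #|v|)%N = #|u :|: v| by exact: homog_mono.
by rewrite cardsU disjoint_setI0 // cards0 subn0.
Qed.

Lemma homog_D c r f : homog c f -> homog (c (+) (tau m n r)) (D r f).
Proof.
move=> hf; move: f hf; apply: homog_ind => [|k f f' hf hf'|a u ha hu].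
- by rewrite linear0 homog0.
- by rewrite linearP homogP_lin.
rewrite /tau; case: (split_ordP r) => i ->.
  rewrite addbF -hu Dev_mono //; case: ifP => _; first exact: homog0.
  exact: homog_mono.
rewrite addbT Dod_mono //; case: ifP => hk; last exact: homog0.
by apply: homogZ; rewrite -hu (cardsD1 i u) hk /= negbK; exact: homog_mono.
Qed.

Lemma mulA_comm c d f g : homog c f -> homog d g ->
  f ** g = (-1) ^+ (c && d) *: (g ** f).
Proof.
move=> hf hg; move: f hf; apply: homog_ind => [|k f f' hf hf'|a u _ hu].
- by rewrite mulA0l mulA0r scaler0.
- by rewrite mulA_linearl hf hf' mulA_is_linear scalerDr !scalerA mulrC.
move: g hg; apply: homog_ind => [|k f f' hf hf'|b v _ hv].
- by rewrite mulA0l mulA0r scaler0.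
- by rewrite mulA_linearl mulA_is_linear hf hf' scalerDr !scalerA mulrC.
rewrite !mono_mul disjoint_sym; case: ifP => h; last by rewrite scaler0.
rewrite scalerA setUC mulrCA; congr (_ *: _); last first.
  by apply: eq_mono => i; rewrite /addx addnC.
congr (_%:R * _).
  by apply: eq_bigr => i _; rewrite -bin_sub ?leq_addr // addKn addnC.
rewrite -hu -hv -oddM signr_odd -inversions_sym; last by rewrite disjoint_sym.
by rewrite exprD -mulrA -expr2 sqrr_sign mulr1.
Qed.

(** $x_k\,\partial/\partial x_k$ is the projection onto the span of the monomials containing $x_k$.
    It serves to pull $x_k$ out on the left without tracking the sign. *)
Lemma mul_xodD k f : (forall v, k \notin v -> forall a, cf f a v = 0) ->
  mono (fun=> 0%N) [set k] ** D (od k) f = f.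
Proof.
move=> hf.
have -> : D (od k) f = \sum_b f b *: D (od k) (mono (al b) (us b)).
  by rewrite {1}(alg_basis f) linear_sum; apply: eq_bigr => b _; rewrite linearZ.
rewrite mulA_sumr [RHS](alg_basis f); apply: eq_bigr => b _; rewrite mulAZr.
case: (boolP (k \in us b)) => hk; last first.
  by rewrite -(cf_alpha f b) hf // !scale0r.
rewrite Dod_mono ?admissible_alpha // hk mulAZr mono_mul; congr (_ *: _).
case: ifP => [_|/disjointP[] x]; last by rewrite !inE => /eqP ->; rewrite eqxx.
rewrite scalerA big1 => [|i _]; last by rewrite bin0.
rewrite mul1r inversions_set1l nbelowD1 -expr2 sqrr_sign scale1r.
by rewrite setD1K //; apply: eq_mono.
Qed.

End Product.

(** * Binomial coefficients modulo $p$ *)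

Section BinomialsModP.
Variables (F : fieldType) (p : nat).
Hypothesis pF : p \in [pchar F].

(** Binomials in $\mathbb F$ are read off from powers of $1+X$, where Frobenius turns $(1+X)^{p^r}$
    into $1+X^{p^r}$. *)
Lemma coef_exp1X N k : ((1 + 'X) ^+ N : {poly F})`_k = ('C(N, k))%:R.
Proof.
elim: N k => [|N IH] k; first by rewrite expr0 coef1 bin0n.
rewrite exprSr mulrDr mulr1 coefD coefMX !IH; case: k => [|k] /=; first by rewrite !bin0 addr0.
by rewrite binS natrD.
Qed.

Lemma exp1X_pchar r : ((1 + 'X) ^+ (p ^ r) : {poly F}) = 1 + 'X ^+ (p ^ r).
Proof.
rewrite exprDn_pchar ?expr1n // pnatX pnatE ?(pcharf_prime pF) //.
by rewrite pchar_poly pF.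
Qed.

Lemma bin_pX0 r k : (0 < k < p ^ r)%N -> ('C(p ^ r, k))%:R = 0 :> F.
Proof.
case/andP => h1 h2; rewrite -coef_exp1X exp1X_pchar coefD coef1 coefXn.
by rewrite (gtn_eqF h1) (ltn_eqF h2) addr0.
Qed.

(** It is the coefficient of $X^q$ in $(1+X^q)^c$ with $q=p^r$. *)
Lemma bin_mul_pX r c : ('C(p ^ r * c, p ^ r))%:R = c%:R :> F.
Proof.
rewrite -coef_exp1X exprM exp1X_pchar; have q0 : (0 < p ^ r)%N.
  by rewrite expn_gt0 prime_gt0 ?(pcharf_prime pF).
move: (p ^ r)%N q0 => q q0.
have h0 d : ((1 + 'X ^+ q) ^+ d : {poly F})`_0 = 1.
  by rewrite -horner_coef0 horner_exp !hornerE expr0n (gtn_eqF q0) addr0 expr1n.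
elim: c => [|c IH]; first by rewrite expr0 coef1 (gtn_eqF q0).
by rewrite exprSr mulrDr mulr1 coefD coefMXn ltnn subnn h0 IH -natr1.
Qed.

End BinomialsModP.

(** * The partial derivatives: Leibniz rules and commutation *)

Section Derivations.
Variables (F : fieldType) (p m n : nat) (t : 'I_m -> nat).
Hypothesis pF : p \in [pchar F].
Local Notation A := (Alg F p m n t).
Local Notation mono := (@monoA F p m n t).
Local Notation D := (@DA F p m n t).
Local Notation "f ** g" := (@Defs.mulA F p m n t f g) (at level 40, left associativity).
Local Notation homog := (@homog F p m n t).
Implicit Types (f g h : A) (a b : 'I_m -> nat) (u v w : {set 'I_n}).

Lemma piD_succ i : (piD p m t i).+1 = (p ^ t i)%N.
Proof. by rewrite prednK // expn_gt0 prime_gt0 ?(pcharf_prime pF). Qed.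

(** On monomials this is Pascal's rule in the exponent of $x_i$; at the truncation it survives only
    because the characteristic is $p$. *)
Lemma Dev_mul i f g : D (ev i) (f ** g) = D (ev i) f ** g + f ** D (ev i) g.
Proof.
elim/alg_ind: f => [|c f f' hf hf'|a u ha].
- by rewrite mulA0l !linear0 ?mulA0l addr0.
- by rewrite mulA_linearl !DA_is_linear hf hf' !mulA_linearl scalerDr addrACA.
elim/alg_ind: g => [|c f f' hf hf'|b v hb].
- by rewrite mulA0r !linear0 ?mulA0r addr0.
- rewrite mulA_is_linear !DA_is_linear hf hf' !mulA_is_linear scalerDr.
  by rewrite addrACA.
set P := (\prod_(j < m | j != i) 'C(a j + b j, a j))%N.
set s := addx a b.
have hP : (\prod_(j < m) 'C(a j + b j, a j) = 'C(s i, a i) * P)%N.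
  by rewrite (bigD1 i).
have hl : a i != 0%N ->
    (\prod_(j < m) 'C(decr i a j + b j, decr i a j) = 'C((s i).-1, (a i).-1) * P)%N.
  move=> h; rewrite (bigD1 i) //=; congr (_ * _)%N.
    rewrite /decr /s /addx eqxx subn1; congr binomial.
    by case: (a i) h.
  by apply: eq_bigr => j /negbTE hj; rewrite /decr hj subn0.
have hr : b i != 0%N ->
    (\prod_(j < m) 'C(a j + decr i b j, a j) = 'C((s i).-1, a i) * P)%N.
  move=> h; rewrite (bigD1 i) //=; congr (_ * _)%N.
    rewrite /decr /s /addx eqxx subn1; congr binomial.
    by case: (b i) h => // x _; rewrite addnS.
  by apply: eq_bigr => j /negbTE hj; rewrite /decr hj subn0.
have el w : a i != 0%N -> mono (addx (decr i a) b) w = mono (decr i s) w.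
  move=> h; apply: eq_mono => j; rewrite /s /addx /decr.
  by case: (eqVneq j i) => [->|]; rewrite ?subn0 // subn1; case: (a i) h => // x _; rewrite subn1.
have er w : b i != 0%N -> mono (addx a (decr i b)) w = mono (decr i s) w.
  move=> h; apply: eq_mono => j; rewrite /s /addx /decr.
  by case: (eqVneq j i) => [->|]; rewrite ?subn0 // subn1; case: (b i) h => // x _; rewrite addnS subn1.
rewrite !Dev_mono // mono_mul.
have -> : (if a i == 0%N then 0 else mono (decr i a) u) ** mono b v =
   if [disjoint u & v] then
     (((a i != 0%N) * 'C((s i).-1, (a i).-1) * P)%:R * (-1) ^+ inversions u v) *:
        mono (decr i s) (u :|: v) else 0.
  case: (eqVneq (a i) 0%N) => h0 /=; first by rewrite mul0n mul0r scale0r mulA0l; case: ifP.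
  by rewrite mono_mul hl // el // mul1n.
have -> : mono a u ** (if b i == 0%N then 0 else mono (decr i b) v) =
   if [disjoint u & v] then
     (((b i != 0%N) * 'C((s i).-1, a i) * P)%:R * (-1) ^+ inversions u v) *:
        mono (decr i s) (u :|: v) else 0.
  case: (eqVneq (b i) 0%N) => h0 /=; first by rewrite mul0n mul0r scale0r mulA0r; case: ifP.
  by rewrite mono_mul hr // er // mul1n.
case: ifP => _; last by rewrite linear0 addr0.
rewrite DAZ -scalerDl -mulrDl -natrD -mulnDl hP -/s.
case: (eqVneq (s i) 0%N) => hs.
  have /andP[/eqP ha0 /eqP hb0] : (a i == 0%N) && (b i == 0%N) by rewrite -addn_eq0; exact/eqP.
  rewrite ha0 hb0 !eqxx !mul0n mul0r scale0r; case: (boolP (admissible p t s)) => h.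
    by rewrite Dev_mono // hs eqxx /= scaler0.
  by rewrite mono_out // DA0 scaler0.
have -> : ((a i != 0) * 'C((s i).-1, (a i).-1) + (b i != 0) * 'C((s i).-1, a i) = 'C(s i, a i))%N.
  rewrite /s /addx in hs *; case: (a i) hs => [|x] hs; first by rewrite !bin0 -[b i]/(b i) hs.
  case: (b i) => [|y]; first by rewrite addn0 !binn.
  by rewrite !mul1n /= binS addnC.
case: (boolP (admissible p t s)) => h; first by rewrite Dev_mono // (negbTE hs).
rewrite [mono s _]mono_out // DA0 scaler0.
case: (boolP (admissible p t (decr i s))) => h'; last by rewrite [mono _ _]mono_out // scaler0.
(* The product is out of range but its formal derivative is not, so $a_i+b_i=p^{t_i}$. The left side
   is 0, and the two Leibniz terms add up to a multiple of $\binom{p^{t_i}}{a_i}$ with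
   $0<a_i<p^{t_i}$. *)
suff -> : ('C(s i, a i) * P)%:R = 0 :> F by rewrite mul0r scale0r.
have e : s i = (p ^ t i)%N.
  rewrite -piD_succ; apply/eqP; rewrite eqn_leq; apply/andP; split.
    by move/forallP: h' => /(_ i); rewrite /decr eqxx subn1; case: (s i).
  rewrite ltnNge; apply: contra h => h; apply/forallP => j.
  case: (eqVneq j i) => [->//|hj].
  by move/forallP: h' => /(_ j); rewrite /decr (negbTE hj) subn0.
rewrite natrM e bin_pX0 ?mul0r //; apply/andP; split.
  rewrite lt0n; apply/eqP => h0; move: e; rewrite /s /addx h0 add0n => e.
  by move/forallP: hb => /(_ i); rewrite e -piD_succ ltnn.
by rewrite -piD_succ ltnS; exact: (forallP ha).
Qed.

Lemma Dod_mul k f g : D (od k) (f ** g) = D (od k) f ** g + par f ** D (od k) g.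
Proof.
elim/alg_ind: f => [|c f f' hf hf'|a u ha].
- by rewrite mulA0l !linear0 ?mulA0l addr0.
- by rewrite mulA_linearl !DA_is_linear hf hf' par_is_linear !mulA_linearl scalerDr addrACA.
elim/alg_ind: g => [|c f f' hf hf'|b v hb].
- by rewrite mulA0r !linear0 ?mulA0r addr0.
- rewrite mulA_is_linear !DA_is_linear hf hf' !mulA_is_linear scalerDr.
  by rewrite addrACA.
rewrite par_mono mulAZl !Dod_mono // mono_mul.
have dk u' : k \in u' -> u' = k |: (u' :\ k) by move=> h'; rewrite setD1K.
have dk' (u' : {set 'I_n}) : [disjoint [set k] & u' :\ k].
  by apply/disjointP => x; rewrite !inE => ->.
have dk2 (u' : {set 'I_n}) : [disjoint u' :\ k & [set k]] by rewrite disjoint_sym.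
have sA (x : F) : x * (-1) ^+ (nbelow u k) = (-1) ^+ (nbelow u k) * x by rewrite mulrC.
case: (boolP (k \in u)) => hu; case: (boolP (k \in v)) => hv.
- have -> : [disjoint u & v] = false by apply/negP => /disjointP/(_ k hu hv).
  rewrite linear0 mulAZl mulAZr !mono_mul.
  have e1 : [disjoint u :\ k & v] = [disjoint u & v :\ k].
    rewrite -!setI_eq0; congr (_ == set0); apply/setP => x; rewrite !inE.
    by case: (x == k); rewrite ?andbF ?andbT.
  rewrite e1; case: ifP => hd; last by rewrite !scaler0 addr0.
  have -> : u :\ k :|: v = u :|: v.
    by apply/setP => x; rewrite !inE; case: (eqVneq x k) => [->|//]; rewrite /= hv orbT.
  have -> : u :|: v :\ k = u :|: v.
    by apply/setP => x; rewrite !inE; case: (eqVneq x k) => [->|//]; rewrite /= hu.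
  rewrite !scalerA -scalerDl; apply/esym/eqP; rewrite scaler_eq0; apply/orP; left; apply/eqP.
  (* Here $x_k$ occurs in both factors, so the product is 0 and the two Leibniz terms must cancel.
     [E1] and [E2] bring their sign exponents to a form where they differ by an odd number. *)
  have E1 : (nbelow u k + inversions (u :\ k) v = #|u :\ k| + inversions (u :\ k) (v :\ k))%N.
    rewrite [in LHS](dk v hv) inversionsUr // -{1}nbelowD1 -inversions_set1l addnA.
    by rewrite inversions_sym // cards1 mul1n.
  have E2 : (inversions u (v :\ k) = nbelow v k + inversions (u :\ k) (v :\ k))%N.
    by rewrite {1}(dk u hu) inversionsUl // inversions_set1l nbelowD1.
  rewrite mulrCA -exprD E1 [X in _ + X]mulrCA -!exprD E2 (cardsD1 k u) hu.
  set c := (\prod_(i < m) _)%N; rewrite -mulrDr.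
  set x := #|_|; set y := inversions _ _; set z := nbelow _ _.
  have -> : (true + x + z + (z + y) = (x + y).+1 + (z + z))%N by rewrite add1n; lia.
  by rewrite [in X in _ + X]exprD exprS [(-1) ^+ (z + z)]exprD -expr2 sqrr_sign mulr1 mulN1r subrr mulr0.
- have -> : [disjoint u & v] = [disjoint u :\ k & v].
    rewrite -!setI_eq0; congr (_ == set0); apply/setP => x; rewrite !inE.
    by case: (eqVneq x k) => [->|//]; rewrite (negbTE hv) !andbF.
  rewrite mulA0r scaler0 addr0 mulAZl mono_mul; case: ifP => hd; last by rewrite linear0 scaler0.
  rewrite DAZ; case: (boolP (admissible p t (addx a b))) => hab; last first.
    by rewrite !mono_out // linear0 !scaler0.
  rewrite Dod_mono // inE hu /= !scalerA; congr (_ *: mono _ _); last first.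
    by apply/setP => x; rewrite !inE; case: (eqVneq x k) => [->|//]; rewrite /= (negbTE hv).
  rewrite -mulrA [RHS]mulrCA; congr (_ * _); rewrite -!exprD.
  have d1 : [disjoint u & v].
    apply/disjointP => x hx hx'; move/disjointP: hd => /(_ x); rewrite !inE hx.
    by case: (eqVneq x k) hx' => [->|_ hx' h]; [rewrite (negbTE hv)|exact: h].
  rewrite -[nbelow (u :|: v) k]inversions_set1l inversionsUr // !inversions_set1l.
  rewrite {1}(dk u hu) inversionsUl // inversions_set1l.
  set x := inversions _ v; set y := nbelow u k; set z := nbelow v k.
  have -> : (z + x + (y + z) = (y + x) + (z + z))%N by lia.
  by rewrite exprD [(-1) ^+ (z + z)]exprD -expr2 sqrr_sign mulr1.
- have -> : [disjoint u & v] = [disjoint u & v :\ k].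
    rewrite -!setI_eq0; congr (_ == set0); apply/setP => x; rewrite !inE.
    by case: (eqVneq x k) => [->|//]; rewrite (negbTE hu) !andFb.
  rewrite mulA0l add0r mulAZr mono_mul; case: ifP => hd; last by rewrite linear0 !scaler0.
  rewrite DAZ; case: (boolP (admissible p t (addx a b))) => hab; last first.
    by rewrite !mono_out // linear0 !scaler0.
  rewrite Dod_mono // inE hv orbT !scalerA; congr (_ *: mono _ _); last first.
    by apply/setP => x; rewrite !inE; case: (eqVneq x k) => [->|//]; rewrite /= (negbTE hu).
  rewrite -[LHS]mulrA [RHS]mulrCA; congr (_ * _); rewrite -!exprD.
  have d1 : [disjoint u & v].
    apply/disjointP => x hx hx'; move/disjointP: hd => /(_ x hx); rewrite !inE hx'.
    by case: (eqVneq x k) hx => [->|_ hx h]; [rewrite (negbTE hu)|exact: h].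
  rewrite -[nbelow (u :|: v) k]inversions_set1l inversionsUr // !inversions_set1l.
  rewrite {1}(dk v hv) inversionsUr //.
  have duk : [disjoint u & [set k]].
    by apply/disjointP => x hx; rewrite inE => /eqP e; move: hu; rewrite -e hx.
  have := inversions_sym duk; rewrite inversions_set1l cards1 muln1 => e.
  by congr (_ ^+ _); lia.
- rewrite mulA0l mulA0r scaler0 addr0; case: ifP => _; last by rewrite linear0.
  rewrite DAZ; case: (boolP (admissible p t (addx a b))) => hab; last first.
    by rewrite !mono_out // linear0 !scaler0.
  by rewrite Dod_mono // inE (negbTE hu) (negbTE hv) scaler0.
Qed.

Lemma tau_ev i : tau m n (ev i) = false.
Proof. by rewrite /tau split_ev. Qed.
Lemma tau_od k : tau m n (od k) = true.
Proof. by rewrite /tau split_od. Qed.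

Lemma DA_mul c r f g : homog c f ->
  D r (f ** g) = D r f ** g + (-1) ^+ (tau m n r && c) *: (f ** D r g).
Proof.
move=> hf; case: (split_ordP r) => i ->; first by rewrite Dev_mul tau_ev scale1r.
by rewrite Dod_mul tau_od (par_homog hf) mulAZl.
Qed.

Lemma DA_comm r s f : D r (D s f) = (-1) ^+ (tau m n r && tau m n s) *: D s (D r f).
Proof.
clear pF; apply: cfP => a u; rewrite cfZ.
case: (split_ordP r) => i ->; case: (split_ordP s) => j ->;
  rewrite ?tau_ev ?tau_od /= ?expr0 ?expr1 ?mul1r.
- rewrite !cf_Dev; apply: eq_cf => k; rewrite /incr; lia.
- by rewrite cf_Dev !cf_Dod cf_Dev.
- by rewrite cf_Dev !cf_Dod cf_Dev.
rewrite !cf_Dod !inE; case: (eqVneq i j) => [->|hij].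
  by case: (j \in u) => /=; rewrite ?mulr0.
rewrite /=; case: (boolP (i \in u)) => hi.
  by case: ifP => _; rewrite ?mulr0.
case: (boolP (j \in u)) => hj; first by rewrite ?mulr0.
rewrite !mulrA setUCA; congr (_ * _); rewrite -exprS -!exprD.
have nb (x y : 'I_n) : x \notin u -> nbelow (x |: u) y = ((x < y) + nbelow u y)%N.
  move=> hx; rewrite -!inversions_set1l inversionsUr; last first.
    by apply/disjointP => z; rewrite inE => /eqP ->; rewrite (negbTE hx).
  by congr (_ + _)%N; rewrite inversionsE !big_set1.
(* Exactly one of $i<j$ and $j<i$ holds, so the two orders of inserting $i$ and $j$ differ by one
   sign. *)
rewrite !nb // -signr_odd -[in RHS]signr_odd; congr (_ ^+ (nat_of_bool _)).
rewrite /= !oddD; case: (ltngtP i j) => h /=; last by rewrite (val_inj h) eqxx in hij.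
  by case: (odd (nbelow u i)); case: (odd (nbelow u j)).
by case: (odd (nbelow u i)); case: (odd (nbelow u j)).
Qed.

End Derivations.

(** * Even vector fields, divergence and the algebra $\mathcal S$ *)

Section VectorFields.
Variables (F : fieldType) (p m n : nat) (t : 'I_m -> nat).
Hypothesis pF : p \in [pchar F].
Local Notation A := (Alg F p m n t).
Local Notation W := (Wsp F p m n t).
Local Notation mono := (@monoA F p m n t).
Local Notation D := (@DA F p m n t).
Local Notation "f ** g" := (@Defs.mulA F p m n t f g) (at level 40, left associativity).
Local Notation homog := (@homog F p m n t).
Local Notation tau := (tau m n).
Local Notation Weven := (@Weven F p m n t).
Local Notation brW := (@brW F p m n t).
Local Notation single := (@single F p m n t).
Local Notation divW := (@divW F p m n t).
Local Notation inSS := (@inSS F p m n t).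
Local Notation Drs := (@Drs F p m n t).
Implicit Types (f g h : A) (a b : 'I_m -> nat) (u v w : {set 'I_n}) (E G X Y Z : W).

Definition act E f : A := \sum_r E r ** D r f.
(** The commutator without signs. It is bilinear on all of $W$, but it represents the superbracket
    only on even fields. *)
Definition br E G : W := [ffun s => act E (G s) - act G (E s)].

Lemma act_is_linear E : linear (act E).
Proof.
move=> c f g; rewrite /act scaler_sumr -big_split /=; apply: eq_bigr => r _.
by rewrite DA_is_linear mulA_is_linear.
Qed.
HB.instance Definition _ E := GRing.isLinear.Build F A A *:%R (act E) (act_is_linear E).

Lemma act0 E : act E 0 = 0. Proof. exact: linear0. Qed.
Lemma actB E f g : act E (f - g) = act E f - act E g. Proof. exact: linearB. Qed.
Lemma act_sum E (I : Type) (s : seq I) (P : pred I) (B : I -> A) :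
  act E (\sum_(i <- s | P i) B i) = \sum_(i <- s | P i) act E (B i).
Proof. exact: linear_sum. Qed.

Lemma actE E f : act E f = \sum_r E r ** D r f. Proof. by []. Qed.
Opaque act Defs.mulA DA.

(** Linear identities in the algebra are checked coefficient by coefficient, where they become
    identities in the field. *)
Ltac coef_ring :=
  repeat match goal with |- context [act ?E ?f] => move: (act E f) => ? end;
  let a := fresh in let u := fresh in
  apply: cfP => a u; rewrite ?(cfD, cfN, cfZ, cf0);
  repeat match goal with |- context [cf ?f a u] => move: (cf f a u) => ? end;
  ring.

Lemma addWE E G s : (E + G) s = E s + G s. Proof. by rewrite ffunE. Qed.
Lemma oppWE E s : (- E) s = - E s. Proof. by rewrite ffunE. Qed.
Lemma scaleWE c E s : (c *: E) s = c *: E s. Proof. by rewrite ffunE. Qed.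
Definition WE := (addWE, oppWE, scaleWE).

Lemma act_linearl f c E G : act (c *: E + G) f = c *: act E f + act G f.
Proof.
rewrite actE scaler_sumr -big_split /=; apply: eq_bigr => r _.
by rewrite !ffunE mulA_linearl.
Qed.
Lemma actDl E G f : act (E + G) f = act E f + act G f.
Proof. by rewrite -[E]scale1r act_linearl !scale1r. Qed.
Lemma act0l f : act 0 f = 0.
Proof. by rewrite actE big1 // => r _; rewrite ffunE mulA0l. Qed.
Lemma singleE r f s : single r f s = if s == r then f else 0.
Proof. by rewrite ffunE. Qed.
Lemma single_id r f : single r f r = f.
Proof. by rewrite singleE eqxx. Qed.
Lemma single_linear r c f g : single r (c *: f + g) = c *: single r f + single r g.
Proof.
by apply/ffunP => s; rewrite !ffunE; case: ifP; rewrite ?scaler0 ?addr0.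
Qed.
Lemma single0 r : single r 0 = 0.
Proof. by apply/ffunP => s; rewrite !ffunE if_same. Qed.
Lemma singleZ r c f : single r (c *: f) = c *: single r f.
Proof. by rewrite -[_ *: f]addr0 single_linear single0 addr0. Qed.
Lemma act_single r f g : act (single r f) g = f ** D r g.
Proof.
rewrite actE (bigD1 r) //= single_id big1 ?addr0 // => s /negbTE hs.
by rewrite singleE hs mulA0l.
Qed.

Lemma br_linear E c X Y : br E (c *: X + Y) = c *: br E X + br E Y.
Proof.
apply/ffunP => s; rewrite !ffunE act_is_linear act_linearl.
coef_ring.
Qed.
Lemma br_antisym E G : br G E = - br E G.
Proof. by apply/ffunP => s; rewrite !ffunE opprB. Qed.
Lemma br_linearl X c E G : br (c *: E + G) X = c *: br E X + br G X.
Proof. by rewrite br_antisym br_linear !(br_antisym X) opprD scalerN. Qed.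
Lemma br0 E : br E 0 = 0.
Proof. by apply/ffunP => s; rewrite !ffunE act0 act0l subr0. Qed.
Lemma br0l E : br 0 E = 0.
Proof. by rewrite br_antisym br0 oppr0. Qed.
Lemma brD E X Y : br E (X + Y) = br E X + br E Y.
Proof. by rewrite -[X]scale1r br_linear !scale1r. Qed.
Lemma brDl E G X : br (E + G) X = br E X + br G X.
Proof. by rewrite -[E]scale1r br_linearl !scale1r. Qed.
Lemma brZ E c X : br E (c *: X) = c *: br E X.
Proof. by rewrite -[_ *: X]addr0 br_linear br0 addr0. Qed.
Lemma brZl E c X : br (c *: E) X = c *: br E X.
Proof. by rewrite -[_ *: E]addr0 br_linearl br0l addr0. Qed.
Lemma brB E X Y : br E (X - Y) = br E X - br E Y.
Proof. by rewrite brD -scaleN1r brZ scaleN1r. Qed.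
Lemma brBl E G X : br (E - G) X = br E X - br G X.
Proof. by rewrite brDl -scaleN1r brZl scaleN1r. Qed.
Lemma br_sum E (I : Type) (s : seq I) (P : pred I) (B : I -> W) :
  br E (\sum_(i <- s | P i) B i) = \sum_(i <- s | P i) br E (B i).
Proof. by apply: (big_morph (br E)); [exact: brD|exact: br0]. Qed.
Lemma br_suml E (I : Type) (s : seq I) (P : pred I) (B : I -> W) :
  br (\sum_(i <- s | P i) B i) E = \sum_(i <- s | P i) br (B i) E.
Proof. by apply: (big_morph (br^~ E)); [move=> x y; exact: brDl|exact: br0l]. Qed.

Lemma br_single r f s g :
  br (single r f) (single s g) = single s (f ** D r g) - single r (g ** D s f).
Proof.
apply/ffunP => q; rewrite !ffunE !act_single.
by case: eqP => _; case: eqP => _; rewrite ?DA0 ?mulA0r ?subr0.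
Qed.

Lemma Weven_lin c E G : Weven E -> Weven G -> Weven (c *: E + G).
Proof. by move=> hE hG r; rewrite !ffunE; exact: homogP_lin (hE r) (hG r). Qed.
Lemma Weven0 : Weven 0.
Proof. by move=> r; rewrite ffunE; exact: homog0. Qed.
Lemma WevenD E G : Weven E -> Weven G -> Weven (E + G).
Proof. by move=> hE hG; rewrite -[E]scale1r; exact: Weven_lin. Qed.
Lemma WevenZ c E : Weven E -> Weven (c *: E).
Proof. by move=> h; rewrite -[_ *: _]addr0; apply: Weven_lin => //; exact: Weven0. Qed.
Lemma WevenN E : Weven E -> Weven (- E).
Proof. by rewrite -scaleN1r; exact: WevenZ. Qed.
Lemma WevenB E G : Weven E -> Weven G -> Weven (E - G).
Proof. by move=> h h'; apply: WevenD => //; exact: WevenN. Qed.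
Lemma Weven_sum (I : Type) (s : seq I) (P : pred I) (B : I -> W) :
  (forall i, P i -> Weven (B i)) -> Weven (\sum_(i <- s | P i) B i).
Proof. by move=> h; elim/big_ind: _ => //; [exact: Weven0|move=> x y; exact: WevenD]. Qed.
Lemma Weven_single r f : homog (tau r) f -> Weven (single r f).
Proof. by move=> h s; rewrite singleE; case: eqP => [->//|_]; exact: homog0. Qed.

Lemma homog_act c E f : Weven E -> homog c f -> homog c (act E f).
Proof.
move=> hE hf; rewrite actE; apply: homog_sum => r _.
have := homog_mul (hE r) (homog_D r hf); by rewrite [c (+) _]addbC addbA addbb.
Qed.

Lemma br_even E G : Weven E -> Weven G -> Weven (br E G).
Proof. by move=> hE hG s; rewrite ffunE; apply: homogB; exact: homog_act. Qed.

Lemma projA_homog c d f : homog c f -> projA F p m n t d f = if d == c then f else 0.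
Proof.
move=> /homogP h; apply/ffunP => b; rewrite ffunE.
case: (eqVneq d c) => [->|hdc]; first by case: eqP => // /eqP /h.
by rewrite [RHS]ffunE; case: eqP => // e; rewrite h // e.
Qed.

Lemma brW_even E G : Weven E -> Weven G -> brW E G = br E G.
Proof.
move=> hE hG; rewrite /Defs.brW.
have h0 r s : \sum_(c : bool) \sum_(d : bool)
    brH F p m n t c (projA F p m n t c (E r)) r d (projA F p m n t d (G s)) s =
    single s (E r ** D r (G s)) - single r (G s ** D s (E r)).
  (* The $D_r$-coefficient of an even field has parity $\tau(r)$, so a single pair of parities
     survives, and for it the sign exponent is 0. *)
  have h c d : brH F p m n t c (projA F p m n t c (E r)) r d (projA F p m n t d (G s)) s =
      if (c == tau r) && (d == tau s) then
        single s (E r ** D r (G s)) - single r (G s ** D s (E r)) else 0.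
    rewrite (projA_homog _ (hE r)) (projA_homog _ (hG s)) /brH.
    case: eqP => [->|_]; case: eqP => [->|_] /=.
    - by rewrite !addbb /= /sgn expr0 scale1r.
    - by rewrite DA0 mulA0r mulA0l !single0 scaler0 subr0.
    - by rewrite DA0 mulA0r mulA0l !single0 scaler0 subr0.
    - by rewrite !mulA0l !single0 scaler0 subr0.
  under eq_bigr => c _ do under eq_bigr => d _ do rewrite h.
  move: (_ - _) => V; rewrite !big_bool; case: (tau r); case: (tau s) => /=;
    by rewrite ?addr0 ?add0r ?addr0.
under eq_bigr => r _ do under eq_bigr => s _ do rewrite h0.
apply/ffunP => q; rewrite sum_ffunE [RHS]ffunE.
under eq_bigr => r _ do rewrite sum_ffunE.
have e r : \sum_s (single s (E r ** D r (G s)) - single r (G s ** D s (E r))) q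
   = E r ** D r (G q) - (if q == r then act G (E q) else 0).
  transitivity (\sum_s (single s (E r ** D r (G s)) q - single r (G s ** D s (E r)) q)).
    by apply: eq_bigr => s _; rewrite !ffunE.
  rewrite sumrB (bigD1 q) //= single_id big1 ?addr0 => [|s hs]; last first.
    by rewrite singleE eq_sym (negbTE hs).
  congr (_ - _); case: eqP => [<-|hq]; first by apply: eq_bigr => s _; rewrite single_id.
  by rewrite big1 // => s _; rewrite singleE; case: eqP.
under eq_bigr => r _ do rewrite e.
rewrite sumrB; congr (_ - _); rewrite (bigD1 q) //= eqxx big1 ?addr0 // => r hr.
by rewrite eq_sym (negbTE hr).
Qed.

Lemma signAA (b : bool) f : (-1 : F) ^+ b *: ((-1 : F) ^+ b *: f) = f.
Proof. by rewrite scalerA -expr2 sqrr_sign scale1r. Qed.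

Lemma act_br E G h : Weven E -> Weven G ->
  act (br E G) h = act E (act G h) - act G (act E h).
Proof.
move=> hE hG.
have e X Y : Weven X -> Weven Y -> act X (act Y h) =
    \sum_s act X (Y s) ** D s h + \sum_s \sum_r X r ** ((-1 : F) ^+ (tau r && tau s) *: (Y s ** D r (D s h))).
  move=> hX hY; rewrite [act Y h]actE act_sum -big_split /=; apply: eq_bigr => s _.
  rewrite !actE mulA_suml -big_split /=; apply: eq_bigr => r _.
  by rewrite (DA_mul pF r _ (hY s)) mulADr mulAA.
rewrite !e //.
(* The second-order parts of $EG$ and $GE$ agree: the sign from exchanging the coefficients cancels
   the sign from exchanging $D_r$ and $D_s$. *)
have -> : \sum_s \sum_r G r ** ((-1 : F) ^+ (tau r && tau s) *: (E s ** D r (D s h))) =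
    \sum_s \sum_r E r ** ((-1 : F) ^+ (tau r && tau s) *: (G s ** D r (D s h))).
  rewrite exchange_big /=; apply: eq_bigr => s _; apply: eq_bigr => r _.
  rewrite !mulAZr !mulAA (mulA_comm (hG s) (hE r)) mulAZl (DA_comm s r) mulAZr andbC.
  by rewrite signAA.
rewrite opprD addrACA subrr addr0 -sumrB; apply: eq_bigr => s _.
by rewrite ffunE mulABl.
Qed.

Lemma jacobi E X Y : Weven E -> Weven X -> Weven Y ->
  br E (br X Y) = br (br E X) Y + br X (br E Y).
Proof.
move=> hE hX hY; apply/ffunP => s; rewrite !ffunE !act_br // !actB.
by coef_ring.
Qed.

Definition smul h E : W := [ffun s => h ** E s].
Local Notation one := (mono (fun=> 0%N) set0).

Lemma mul1A f : one ** f = f.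
Proof.
rewrite {1}(alg_basis f) mulA_sumr [RHS]alg_basis; apply: eq_bigr => b _.
rewrite mulAZr mono_mul; case: ifP => [_|/disjointP[] x]; last by rewrite inE.
rewrite big1 => [|i _]; last by rewrite bin0.
by rewrite inversions0l set0U mul1r scale1r; congr (_ *: _); apply: eq_mono.
Qed.

Lemma divW_even E : Weven E -> divW E = \sum_r (-1 : F) ^+ tau r *: D r (E r).
Proof.
move=> hE; rewrite /Defs.divW; apply: eq_bigr => r _.
rewrite (bigD1 (tau r)) //= (projA_homog _ (hE r)) eqxx big1 ?addr0 => [|c hc].
  by rewrite /sgn andbb.
by rewrite (projA_homog _ (hE r)) (negbTE hc) DA0 scaler0.
Qed.

Lemma divW_even_linear c E G : Weven E -> Weven G ->
  divW (c *: E + G) = c *: divW E + divW G.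
Proof.
move=> hE hG; rewrite !divW_even //; last exact: Weven_lin.
rewrite scaler_sumr -big_split /=; apply: eq_bigr => r _.
by rewrite !ffunE DA_is_linear scalerDr !scalerA mulrC.
Qed.
Lemma divW0 : divW 0 = 0.
Proof. by rewrite divW_even; [apply: big1 => r _; rewrite ffunE DA0 scaler0|exact: Weven0]. Qed.
Lemma divWD E G : Weven E -> Weven G -> divW (E + G) = divW E + divW G.
Proof. by move=> hE hG; rewrite -[E in LHS]scale1r divW_even_linear // scale1r. Qed.
Lemma divWZ c E : Weven E -> divW (c *: E) = c *: divW E.
Proof. by move=> hE; rewrite -[_ *: E]addr0 divW_even_linear // ?divW0 ?addr0 //; exact: Weven0. Qed.
Lemma divWB E G : Weven E -> Weven G -> divW (E - G) = divW E - divW G.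
Proof. by move=> hE hG; rewrite -[- G]scaleN1r addrC divW_even_linear // scaleN1r addrC. Qed.

Lemma homog_divW E : Weven E -> homog false (divW E).
Proof.
move=> hE; rewrite divW_even //; apply: homog_sum => r _; apply: homogZ.
by have := homog_D r (hE r); rewrite addbb.
Qed.

Lemma Weven_smul h E : homog false h -> Weven E -> Weven (smul h E).
Proof. by move=> hh hE r; rewrite ffunE; exact: homog_mul hh (hE r). Qed.

Lemma divW_smul h E : homog false h -> Weven E ->
  divW (smul h E) = act E h + h ** divW E.
Proof.
move=> hh hE; rewrite !divW_even //; last exact: Weven_smul.
rewrite mulA_sumr -big_split /=; apply: eq_bigr => r _.
rewrite ffunE (DA_mul pF r _ hh) andbF scale1r scalerDr mulAZr; congr (_ + _).
have := homog_D r hh; rewrite /= => hD.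
by rewrite (mulA_comm hD (hE r)) andbb signAA.
Qed.

(** Parity $\tau(r)+\tau(s)$ of the argument is the one for which $D_{rs}(h)$ is even. *)
Definition drs r s h : W := Drs r s (tau r (+) tau s) h.

Lemma drsE r s h : drs r s h =
  (-1 : F) ^+ (tau r && tau s) *: single s (D r h)
  - (-1 : F) ^+ (tau r (+) tau s) *: single r (D s h).
Proof. by rewrite /drs /Defs.Drs /sgn andbb. Qed.

Lemma drs_linear r s c f g : drs r s (c *: f + g) = c *: drs r s f + drs r s g.
Proof.
rewrite !drsE (DA_is_linear r) (DA_is_linear s).
rewrite (single_linear s c (D r f)) (single_linear r c (D s f)).
move: (single s _) (single s _) (single r _) (single r _) => Y1 Y2 Y3 Y4.
apply/ffunP => q; rewrite !WE; move: (Y1 q) (Y2 q) (Y3 q) (Y4 q) => ? ? ? ?; coef_ring.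
Qed.

Lemma drs_even r s h : homog (tau r (+) tau s) h -> Weven (drs r s h).
Proof.
move=> hh; rewrite drsE; apply: WevenB; apply: WevenZ; apply: Weven_single.
  by have := homog_D r hh; rewrite -addbA [tau s (+) _]addbC addbA addbb.
by have := homog_D s hh; rewrite -addbA addbb addbF.
Qed.

Lemma divW_single r f : homog (tau r) f -> divW (single r f) = (-1 : F) ^+ tau r *: D r f.
Proof.
move=> hf; rewrite divW_even; last exact: Weven_single.
rewrite (bigD1 r) //= single_id big1 ?addr0 // => s hs.
by rewrite singleE (negbTE hs) DA0 scaler0.
Qed.

Lemma divW_drs r s h : homog (tau r (+) tau s) h -> divW (drs r s h) = 0.
Proof.
move=> hh.
have h1 : homog (tau s) (D r h).
  by have := homog_D r hh; rewrite -addbA [tau s (+) _]addbC addbA addbb.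
have h2 : homog (tau r) (D s h) by have := homog_D s hh; rewrite -addbA addbb addbF.
rewrite drsE divWB; try by apply: WevenZ; exact: Weven_single.
rewrite !divWZ; try exact: Weven_single.
rewrite !divW_single // (DA_comm r s h) !scalerA -scalerBl -!signr_addb.
rewrite (_ : _ - _ = 0) ?scale0r //.
by case: (tau r); case: (tau s); rewrite /= subrr.
Qed.

Lemma inSS_drs r s h : homog (tau r (+) tau s) h -> inSS (drs r s h).
Proof.
move=> hh; split; last exact: drs_even.
exists [:: (r, s, tau r (+) tau s, h)]; split; last by rewrite big_seq1.
by move=> x; rewrite inE => /eqP ->.
Qed.

Lemma inSS_lin c X Y : inSS X -> inSS Y -> inSS (c *: X + Y).
Proof.
case=> -[l [hl ->]] hX [[l' [hl' ->]] hY]; split; last exact: Weven_lin.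
exists ([seq (x.1, c *: x.2) | x <- l] ++ l'); split.
  move=> x; rewrite mem_cat => /orP[/mapP[y hy ->]|]; last exact: hl'.
  by apply: homogZ; exact: hl.
rewrite big_cat big_map scaler_sumr /=; congr (_ + _); apply: eq_bigr => x _.
rewrite /Defs.Drs !DAZ !singleZ; move: (single _ _) (single _ _) => Y1 Y2.
apply/ffunP => q; rewrite !WE; move: (Y1 q) (Y2 q) => ? ?; coef_ring.
Qed.

Lemma inSS0 : inSS 0.
Proof.
split; last exact: Weven0.
by exists [::]; split=> //; rewrite big_nil.
Qed.
Lemma inSSD X Y : inSS X -> inSS Y -> inSS (X + Y).
Proof. by move=> hX hY; rewrite -[X]scale1r; exact: inSS_lin. Qed.
Lemma inSSZ c X : inSS X -> inSS (c *: X).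
Proof. by move=> h; rewrite -[_ *: _]addr0; apply: inSS_lin => //; exact: inSS0. Qed.
Lemma inSSN X : inSS X -> inSS (- X).
Proof. by rewrite -scaleN1r; exact: inSSZ. Qed.
Lemma inSSB X Y : inSS X -> inSS Y -> inSS (X - Y).
Proof. by move=> h h'; apply: inSSD => //; exact: inSSN. Qed.
Lemma inSS_sum (I : Type) (s : seq I) (P : pred I) (B : I -> W) :
  (forall i, P i -> inSS (B i)) -> inSS (\sum_(i <- s | P i) B i).
Proof. by move=> h; elim/big_ind: _ => //; [exact: inSS0|move=> x y; exact: inSSD]. Qed.

(** For an argument of the other parity $D_{rs}(h)$ is odd. Projecting a sum in $S$ to its even part
    therefore leaves a sum of fields [drs], which is what [inSS_ind] rests on. *)
Lemma Drs_odd r s c h q : homog c h -> c != tau r (+) tau s ->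
  projA F p m n t (tau q) (Drs r s c h q) = 0.
Proof.
move=> hh hc.
have hN k : homog (~~ tau q) (Drs r s c h q) -> projA F p m n t k (Drs r s c h q) = if k == ~~ tau q then Drs r s c h q else 0.
  exact: projA_homog.
rewrite hN; first by case: (tau q).
rewrite /Defs.Drs !ffunE; apply: homogB; apply: homogZ.
  case: (eqVneq q s) => [e|_]; last exact: homog0.
  have := homog_D r hh; rewrite e; move: hc.
  by case: c {hh hN}; case: (tau r); case: (tau s).
case: (eqVneq q r) => [e|_]; last exact: homog0.
have := homog_D s hh; rewrite e; move: hc.
by case: c {hh hN}; case: (tau r); case: (tau s).
Qed.

Lemma projA_linear d c f g :
  projA F p m n t d (c *: f + g) = c *: projA F p m n t d f + projA F p m n t d g.
Proof.
by apply/ffunP => b; rewrite !ffunE; case: ifP => _; rewrite ?scaler0 ?addr0.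
Qed.

Lemma inSS_ind (P : W -> Prop) :
  P 0 -> (forall c X Y, P X -> P Y -> P (c *: X + Y)) ->
  (forall r s a u, admissible p t a -> odd #|u| = tau r (+) tau s -> P (drs r s (mono a u))) ->
  forall X, inSS X -> P X.
Proof.
move=> h0 hl hg X [[l [hl' e]] hX].
have hd r s h : homog (tau r (+) tau s) h -> P (drs r s h).
  move: h; apply: homog_ind => [|k f g hf hg'|a u ha hu]; last exact: hg.
    by rewrite drsE !DA0 !single0 !scaler0 subr0.
  by rewrite drs_linear; exact: hl.
have -> : X = \sum_(x <- l | x.1.2 == tau x.1.1.1 (+) tau x.1.1.2) drs x.1.1.1 x.1.1.2 x.2.
  apply/ffunP => q; transitivity (projA F p m n t (tau q) (X q)).
    by rewrite (projA_homog _ (hX q)) eqxx.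
  rewrite e [in LHS]sum_ffunE [RHS]sum_ffunE.
  have pm : {morph projA F p m n t (tau q) : f g / f + g}.
    by move=> f g; have := projA_linear (tau q) 1 f g; rewrite !scale1r.
  have p0 : projA F p m n t (tau q) 0 = 0 by apply/ffunP => b; rewrite !ffunE if_same.
  rewrite (big_morph _ pm p0) [RHS]big_mkcond big_seq [RHS]big_seq; apply: eq_bigr => x hx.
  case: (eqVneq x.1.2 (tau x.1.1.1 (+) tau x.1.1.2)) => hc; last by rewrite Drs_odd //; exact: hl'.
  rewrite /drs -hc; have := hl' _ hx; rewrite hc => hh.
  by have := drs_even hh q => h; rewrite /drs -hc in h *; rewrite (projA_homog _ h) eqxx.
rewrite big_seq_cond; elim/big_rec: _ => // x Y /andP[hx /eqP hc] hY.
rewrite -[drs _ _ _]scale1r; apply: hl => //; apply: hd; rewrite -hc; exact: hl'.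
Qed.

Lemma inSS_divW0 X : inSS X -> divW X = 0.
Proof.
move=> hX; suff [] : Weven X /\ divW X = 0 by [].
move: X hX; apply: inSS_ind => [|c X Y [hX eX] [hY eY]|r s a u _ hu].
- by split; [exact: Weven0|exact: divW0].
- split; first exact: Weven_lin.
  by rewrite divW_even_linear // eX eY scaler0 addr0.
have hh : homog (tau r (+) tau s) (mono a u) by rewrite -hu homog_mono.
by split; [exact: drs_even|exact: divW_drs].
Qed.

(** Expand each $D_{rs}(E_rG_s)$ by the Leibniz rule. The $D_s$-parts summed over $r$ give
    $E(G_s)+\mathrm{div}(E)G_s$, and the $D_r$-parts summed over $s$ give
    $G(E_r)+\mathrm{div}(G)E_r$. *)
Lemma br_drs E G : Weven E -> Weven G ->
  \sum_r \sum_s (-1 : F) ^+ (tau r && ~~ tau s) *: drs r s (E r ** G s) =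
  br E G + smul (divW E) G - smul (divW G) E.
Proof.
move=> hE hG; apply/ffunP => q; rewrite sum_ffunE.
under eq_bigr => r _ do rewrite sum_ffunE.
have e1 r s : ((-1 : F) ^+ (tau r && ~~ tau s) *: drs r s (E r ** G s)) q =
   (if q == s then ((-1) ^+ tau r *: D r (E r)) ** G q + E r ** D r (G q) else 0)
   - (if q == r then (-1) ^+ tau s *: (E q ** D s (G s)) + G s ** D s (E q) else 0).
  rewrite drsE scaleWE addWE oppWE !scaleWE !singleE scalerBr; congr (_ - _); case: eqP => [->|_]; rewrite ?scaler0 //.
    rewrite (DA_mul pF r _ (hE r)) mulAZl !scalerDr !scalerA -!signr_addb andbb.
    by congr (_ *: _ + _); case: (tau r); case: (tau s); rewrite /= ?expr0 ?scale1r.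
  rewrite (DA_mul pF s _ (hE r)) !scalerDr !scalerA -!signr_addb addrC.
  have hD := homog_D s (hE r); rewrite (mulA_comm hD (hG s)) scalerA -!signr_addb.
  by congr (_ *: _ + _); case: (tau r); case: (tau s); rewrite /= ?expr0 ?scale1r.
under eq_bigr => r _ do under eq_bigr => s _ do rewrite e1.
have -> : \sum_r \sum_s ((if q == s then ((-1) ^+ tau r *: D r (E r)) ** G q + E r ** D r (G q) else 0)
   - (if q == r then (-1) ^+ tau s *: (E q ** D s (G s)) + G s ** D s (E q) else 0)) =
   (divW E ** G q + act E (G q)) - (E q ** divW G + act G (E q)).
  under eq_bigr => r _ do rewrite sumrB.
  rewrite sumrB; congr (_ - _).
    rewrite divW_even // mulA_suml -big_split /=; apply: eq_bigr => r _.
    by rewrite (bigD1 q) //= eqxx big1 ?addr0 // => s hs; rewrite eq_sym (negbTE hs).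
  rewrite (bigD1 q) //= eqxx [X in _ + X]big1 ?addr0 => [|r hr]; last first.
    by rewrite big1 // => s _; rewrite eq_sym (negbTE hr).
  rewrite big_split /=; congr (_ + _); rewrite divW_even // mulA_sumr.
  by apply: eq_bigr => s _; rewrite mulAZr.
rewrite !ffunE (mulA_comm (hE q) (homog_divW hG)) andbF scale1r.
by coef_ring.
Qed.

Lemma inSS_sum_drs E G : Weven E -> Weven G ->
  inSS (\sum_r \sum_s (-1 : F) ^+ (tau r && ~~ tau s) *: drs r s (E r ** G s)).
Proof.
move=> hE hG; apply: inSS_sum => r _; apply: inSS_sum => s _; apply: inSSZ.
by apply: inSS_drs; exact: homog_mul.
Qed.

Lemma inSS_br E X c : Weven E -> divW E = c *: one -> inSS X -> inSS (br E X).
Proof.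
move=> hE hc hX; have hXe : Weven X by case: hX.
have := inSS_sum_drs hE hXe; rewrite br_drs // (inSS_divW0 hX) hc => h.
have -> : br E X = (br E X + smul (c *: one) X - smul 0 E) - c *: X.
  apply/ffunP => s; rewrite !ffunE mulA0l mulAZl mul1A.
  by coef_ring.
by apply: inSSB => //; exact: inSSZ.
Qed.

(** By [br_drs] the field $[E,X]+\mathrm{div}(E)X$ is divergence-free. If $[E,X]\in\mathcal S$, then
    so is $\mathrm{div}(E)X$, whose divergence is $X(\mathrm{div}\,E)$. *)
Lemma act_divW_eq0 E X : Weven E -> inSS X -> inSS (br E X) -> act X (divW E) = 0.
Proof.
move=> hE hX hbr; have hXe : Weven X by case: hX.
have h1 := inSS_divW0 (inSS_sum_drs hE hXe); have hd := homog_divW hE.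
rewrite br_drs // (inSS_divW0 hX) in h1.
have e0 : smul 0 E = 0 by apply/ffunP => s; rewrite !ffunE mulA0l.
rewrite e0 subr0 divWD in h1; [|by case: hbr|exact: Weven_smul].
by rewrite (inSS_divW0 hbr) add0r divW_smul // (inSS_divW0 hX) mulA0r addr0 in h1.
Qed.

End VectorFields.

(** * Explicit elements of $\mathcal S$ and their weights *)

Section Elements.
Variables (F : fieldType) (p m n : nat) (t : 'I_m -> nat).
Hypothesis pF : p \in [pchar F].
Hypothesis p3 : (3 < p)%N.
Hypothesis t_gt0 : forall i, (0 < t i)%N.
Local Notation A := (Alg F p m n t).
Local Notation W := (Wsp F p m n t).
Local Notation mono := (@monoA F p m n t).
Local Notation D := (@DA F p m n t).
Local Notation "f ** g" := (@Defs.mulA F p m n t f g) (at level 40, left associativity).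
Local Notation homog := (@homog F p m n t).
Local Notation tau := (tau m n).
Local Notation Weven := (@Weven F p m n t).
Local Notation single := (@single F p m n t).
Local Notation inSS := (@inSS F p m n t).
Local Notation Gamma := (@Gamma F p m n t).
Local Notation Dw := (@Dw F p m n t).
Local Notation one := (mono (fun=> 0%N) set0).
Local Notation drs := (@drs F p m n t).
Local Notation adm := (admissible p t).
Implicit Types (f g h : A) (a b : 'I_m -> nat) (u v w : {set 'I_n}) (E G X Y Z : W).

Definition eps (i : 'I_m) (c : nat) : 'I_m -> nat := fun j => ((j == i) * c)%N.

Lemma piD_ge3 i : (3 <= piD p m t i)%N.
Proof.
rewrite -ltnS (piD_succ _ pF); apply: leq_trans (_ : p ^ 1 <= _)%N; first by rewrite expn1; lia.
by rewrite leq_exp2l // ; lia.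
Qed.

Lemma admissible0 : adm (fun=> 0%N).
Proof. by apply/forallP. Qed.

Lemma admissible_eps i c : (c <= piD p m t i)%N -> adm (eps i c).
Proof.
move=> h; apply/forallP => j; rewrite /eps; case: (eqVneq j i) => [->|_]; first by rewrite mul1n.
by rewrite mul0n.
Qed.

Lemma admissible_incr i a : adm a -> (a i < piD p m t i)%N -> adm (incr i a).
Proof.
move=> /forallP h hi; apply/forallP => j; rewrite /incr.
by case: (eqVneq j i) => [->|_]; rewrite ?addn1 // addn0.
Qed.

Lemma ev_inj : injective (fun i : 'I_m => lshift n i). Proof. exact: lshift_inj. Qed.
Lemma od_inj : injective (fun k : 'I_n => rshift m k). Proof. exact: rshift_inj. Qed.
Lemma ev_od (i : 'I_m) (k : 'I_n) : (ev i == od k) = false. Proof. exact: eq_lrshift. Qed.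
Lemma od_ev (i : 'I_m) (k : 'I_n) : (od k == ev i) = false. Proof. exact: eq_rlshift. Qed.
Lemma ev_eq (i j : 'I_m) : (lshift n i == lshift n j) = (i == j). Proof. exact: eq_lshift. Qed.
Lemma od_eq (k l : 'I_n) : (rshift m k == rshift m l) = (k == l). Proof. exact: eq_rshift. Qed.

Lemma big_Y (R : Type) (idx : R) (op : Monoid.com_law idx) (B : 'I_(m + n) -> R) :
  \big[op/idx]_r B r = op (\big[op/idx]_(i < m) B (ev i)) (\big[op/idx]_(k < n) B (od k)).
Proof. exact: big_split_ord. Qed.

Lemma Dod_mono0 k a : D (od k) (mono a set0) = 0.
Proof.
case: (boolP (adm a)) => h; first by rewrite Dod_mono // inE.
by rewrite mono_out // DA0.
Qed.

Lemma Dev_one i : D (ev i) one = 0.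
Proof. by rewrite Dev_mono ?admissible0. Qed.

Lemma D_one r : D r one = 0.
Proof. by case: (split_ordP r) => i ->; [exact: Dev_one|exact: Dod_mono0]. Qed.

Lemma act_one E : act E one = 0.
Proof. by rewrite actE big1 // => r _; rewrite D_one mulA0r. Qed.

Lemma homog_one : homog false one.
Proof. by have := homog_mono F p t (fun=> 0%N) (set0 : {set 'I_n}); rewrite cards0. Qed.

Lemma mulA1 c f : homog c f -> f ** one = f.
Proof. by move=> h; rewrite (mulA_comm h homog_one) andbF scale1r mul1A. Qed.

Lemma mono1_mul a b v : mono a set0 ** mono b v =
  ((\prod_(i < m) 'C(a i + b i, a i))%N)%:R *: mono (addx a b) v.
Proof.
rewrite mono_mul inversions0l mulr1 set0U; case: ifP => // /disjointP [] x.
by rewrite inE.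
Qed.

(** The form of $\mathrm{ad}\,D_i$ used throughout: acting on coefficients, it is linear on all of
    $W$ and merely shifts exponents. *)
Definition dW (i : 'I_m) X : W := [ffun s => D (ev i) (X s)].

Lemma Dw_even i : Weven (Dw i).
Proof. by apply: Weven_single; rewrite tau_ev homog_one. Qed.

Lemma br_Dw i X : br (Dw i) X = dW i X.
Proof.
apply/ffunP => s; rewrite !ffunE act_single mul1A.
by case: ifP => _; rewrite ?act_one ?act0 subr0.
Qed.

Lemma dW_linear i c X Y : dW i (c *: X + Y) = c *: dW i X + dW i Y.
Proof. by apply/ffunP => s; rewrite !ffunE DA_is_linear. Qed.

Lemma dW0 i : dW i 0 = 0.
Proof. by apply/ffunP => s; rewrite !ffunE DA0. Qed.

Lemma dW_single i r f : dW i (single r f) = single r (D (ev i) f).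
Proof. by apply/ffunP => s; rewrite !ffunE; case: ifP; rewrite ?DA0. Qed.

Lemma dW_even i X : Weven X -> Weven (dW i X).
Proof. by rewrite -br_Dw; apply: br_even; exact: Dw_even. Qed.

Lemma dW_br i X Y : Weven X -> Weven Y -> dW i (br X Y) = br (dW i X) Y + br X (dW i Y).
Proof. by move=> hX hY; rewrite -!br_Dw (jacobi pF) //; exact: Dw_even. Qed.

Lemma cf_dW i X s a u : cf (dW i X s) a u = cf (X s) (incr i a) u.
Proof. by rewrite ffunE cf_Dev. Qed.

Lemma cf_iter_dW N i X s a u :
  cf (iter N (dW i) X s) a u = cf (X s) (addx a (eps i N)) u.
Proof.
elim: N a => [|N IH] a; first by apply: eq_cf => j; rewrite /addx /eps muln0 addn0.
rewrite iterS cf_dW IH; apply: eq_cf => j; rewrite /addx /incr /eps; lia.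
Qed.

Lemma dW_eq0P X : (forall i, dW i X = 0) ->
  forall s a u, (exists i, a i != 0%N) -> cf (X s) a u = 0.
Proof.
move=> h s; apply: alg_Dev_const => i; have := h i => /ffunP/(_ s); by rewrite !ffunE.
Qed.

Definition free_of (s : 'I_(m + n)) a u : bool :=
  match split s with inl i => a i == 0%N | inr k => k \notin u end.

Lemma free_of_ev i a u : free_of (ev i) a u = (a i == 0%N).
Proof. by rewrite /free_of split_ev. Qed.
Lemma free_of_od k a u : free_of (od k) a u = (k \notin u).
Proof. by rewrite /free_of split_od. Qed.

Lemma D_free s a u : free_of s a u -> D s (mono a u) = 0.
Proof.
case: (boolP (adm a)) => ha; last by rewrite mono_out // DA0.
case: (split_ordP s) => i ->; rewrite ?free_of_ev ?free_of_od => h.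
  by rewrite Dev_mono // h.
by rewrite Dod_mono // (negbTE h).
Qed.

Lemma inSS_single r s f : r != s -> homog (tau r (+) tau s) f -> D s f = 0 ->
  inSS (single s (D r f)).
Proof.
move=> hrs hf h0; have := inSS_drs hf; rewrite drsE h0 single0 scaler0 subr0 => h.
have := inSSZ ((-1) ^+ (tau r && tau s)) h.
by rewrite scalerA -expr2 sqrr_sign scale1r.
Qed.

Lemma Dev_mono_incr j a u : adm a -> (a j < piD p m t j)%N ->
  D (ev j) (mono (incr j a) u) = mono a u.
Proof.
move=> ha hj; rewrite Dev_mono ?admissible_incr // /incr eqxx addn1 /=.
by apply: eq_mono => i; rewrite /decr addnK.
Qed.

Lemma Dod_mono_add k a u : adm a -> k \notin u ->
  D (od k) (mono a (k |: u)) = (-1) ^+ nbelow u k *: mono a u.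
Proof.
move=> ha hk; rewrite Dod_mono // !inE eqxx /= setU1K //.
by rewrite -[nbelow (k |: u) k]nbelowD1 setU1K.
Qed.

(** The field is, up to a nonzero scalar, $D_{rs}(f)$ for an antiderivative $f$ in some $x_r$; the
    last hypothesis provides the room. For odd $s$ one may take $r=s$: there
    $D_{ss}(f)=-2D_s(f)D_s$, and 2 is invertible. *)
Lemma inSS_mono s a u : adm a -> odd #|u| = tau s -> free_of s a u ->
  [|| tau s, [exists j, (ev j != s) && (a j < piD p m t j)%N] | [exists k, k \notin u]] ->
  inSS (single s (mono a u)).
Proof.
move=> ha hu hs.
have hod k : k \notin u -> od k != s -> inSS (single s (mono a u)).
  move=> hk hks; have hf : homog (tau (od k) (+) tau s) (mono a (k |: u)).
    by rewrite tau_od -hu /=; have := homog_mono F p t a (k |: u); rewrite cardsU1 hk.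
  have hD : D s (mono a (k |: u)) = 0.
    apply: D_free; move: hs hks; case: (split_ordP s) => i ->.
      by rewrite !free_of_ev.
    by rewrite !free_of_od od_eq !inE eq_sym => /negbTE -> /negbTE ->.
  have := inSSZ ((-1) ^+ nbelow u k) (inSS_single hks hf hD).
  by rewrite Dod_mono_add // singleZ scalerA -expr2 sqrr_sign scale1r.
have hodd : tau s -> inSS (single s (mono a u)).
  move: hu hs hod; case: (split_ordP s) => k ->; rewrite ?tau_ev // tau_od free_of_od.
  move=> hu hk _ _; have hf : homog (tau (od k) (+) tau (od k)) (mono a (k |: u)).
    by rewrite addbb; have := homog_mono F p t a (k |: u); rewrite cardsU1 hk oddD hu.
  have := inSS_drs hf; rewrite drsE tau_od /= expr1 expr0 Dod_mono_add //.
  rewrite scale1r scaleN1r singleZ; move: (single _ _) => V.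
  move/(inSSZ (- (2%:R^-1 * (-1) ^+ nbelow u k))).
  rewrite -opprD -mulr2n scalerN scaleNr opprK -scaler_nat !scalerA.
  rewrite [_ * 2]mulrAC mulVf ?mul1r.
    by rewrite -expr2 sqrr_sign scale1r.
  rewrite -(dvdn_pcharf pF); apply/negP => /dvdn_leq h; lia.
case/or3P => [//|/existsP[j /andP[hj1 hj2]]|/existsP[k hk]].
- have hf : homog (tau (ev j) (+) tau s) (mono (incr j a) u).
    by rewrite tau_ev -hu; exact: homog_mono.
  have hD : D s (mono (incr j a) u) = 0.
    apply: D_free; move: hs hj1; case: (split_ordP s) => i ->.
      by rewrite !free_of_ev ev_eq /incr [i == j]eq_sym => /eqP -> /negbTE ->.
    by rewrite !free_of_od.
  by have := inSS_single hj1 hf hD; rewrite Dev_mono_incr.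
- case: (boolP (od k == s)) => [/eqP e|]; last exact: hod.
  by apply: hodd; rewrite -e tau_od.
Qed.

Lemma xgen_ev i : xgen F p m n t (ev i) = mono (eps i 1) set0.
Proof. by rewrite /xgen split_ev; apply: eq_mono => j; rewrite /eps muln1. Qed.
Lemma xgen_od k : xgen F p m n t (od k) = mono (fun=> 0%N) [set k].
Proof. by rewrite /xgen split_od. Qed.

Lemma homog_xgen r : homog (tau r) (xgen F p m n t r).
Proof.
case: (split_ordP r) => i ->; rewrite ?xgen_ev ?xgen_od ?tau_ev ?tau_od.
  by have := homog_mono F p t (eps i 1) (set0 : {set 'I_n}); rewrite cards0.
by have := homog_mono F p t (fun=> 0%N) [set i]; rewrite cards1.
Qed.

Lemma admissible_eps1 i : adm (eps i 1).
Proof. by apply: admissible_eps; apply: leq_trans (piD_ge3 i). Qed.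

Lemma decr_eps i : decr i (eps i 1) =1 (fun=> 0%N).
Proof. by move=> j; rewrite /decr /eps muln1 subnn. Qed.

Lemma D_xgen s r : D s (xgen F p m n t r) = if s == r then one else 0.
Proof.
case: (split_ordP r) => i ->; case: (split_ordP s) => j ->;
  rewrite ?xgen_ev ?xgen_od ?ev_eq ?od_eq ?ev_od ?od_ev.
- rewrite Dev_mono ?admissible_eps1 // {1}/eps muln1; case: (eqVneq j i) => [->|//] /=.
  exact: eq_mono (decr_eps i).
- by rewrite Dod_mono0.
- by rewrite Dev_mono ?admissible0.
rewrite Dod_mono ?admissible0 // !inE; case: (eqVneq j i) => [->|//].
rewrite setDv (_ : nbelow _ _ = 0%N) ?scale1r //.
apply/eqP; rewrite cards_eq0; apply/eqP/setP => x; rewrite !inE.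
by case: eqP => [->|//]; rewrite ltnn.
Qed.

(** The eigenvalue of $\mathrm{ad}\,\Gamma_r$ on $x^{(a)}x^uD_s$. *)
Definition wt (r : 'I_(m + n)) a u (s : 'I_(m + n)) : F :=
  (match split r with inl i => (a i)%:R | inr k => (k \in u)%:R end) - (r == s)%:R.

Lemma wt_ev i a u s : wt (ev i) a u s = (a i)%:R - (ev i == s)%:R.
Proof. by rewrite /wt split_ev. Qed.
Lemma wt_od k a u s : wt (od k) a u s = (k \in u)%:R - (od k == s)%:R.
Proof. by rewrite /wt split_od. Qed.

Lemma euler_mono r a u : adm a -> xgen F p m n t r ** D r (mono a u) =
  (match split r with inl i => (a i)%:R | inr k => (k \in u)%:R end : F) *: mono a u.
Proof.
move=> ha; case: (split_ordP r) => i ->.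
  rewrite xgen_ev Dev_mono //; case: eqP => [->|/eqP h0]; first by rewrite mulA0r scale0r.
  rewrite mono1_mul; congr (_%:R *: _); last first.
    apply: eq_mono => j; rewrite /addx /eps /decr muln1; case: (eqVneq j i) => [->|_].
      by rewrite subn1 add1n prednK // lt0n.
    by rewrite subn0.
  rewrite (bigD1 i) //= big1 ?muln1 => [|j /negbTE hj]; last by rewrite /eps hj mul0n bin0.
  by rewrite /eps /decr eqxx muln1 bin1 add1n subn1 prednK // lt0n.
rewrite xgen_od; case: (boolP (i \in u)) => hi; last first.
  by rewrite Dod_mono // (negbTE hi) mulA0r scale0r.
rewrite scale1r; apply: mul_xodD => v hv b; rewrite cf_mono.
by case: eqP => [e|]; [move: hv; rewrite e hi|rewrite andbF].
Qed.

Lemma cf_act_Gamma r f a u :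
  cf (act (Gamma r) f) a u =
  (match split r with inl i => (a i)%:R | inr k => (k \in u)%:R end : F) * cf f a u.
Proof.
rewrite act_single; elim/alg_ind: f => [|c f g hf hg|b v hb].
- by rewrite DA0 mulA0r !cf0 mulr0.
- by rewrite DA_is_linear mulA_is_linear !cfD !cfZ hf hg mulrDr mulrCA.
rewrite euler_mono // cfZ cf_mono hb /=; case: forallP => [/(_ _)/eqP h|_]; last first.
  by rewrite !mulr0.
case: (eqVneq u v) => [->|_]; last by rewrite !mulr0.
by case: (split r) => i; rewrite ?h.
Qed.

Lemma cf_Gamma r X s a u : Weven X ->
  cf (br (Gamma r) X s) a u = wt r a u s * cf (X s) a u.
Proof.
move=> hX; rewrite ffunE cfB cf_act_Gamma /wt mulrBl; congr (_ - _).
rewrite eq_sym singleE; case: eqP => [->|_]; last by rewrite act0 cf0 mul0r.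
rewrite actE (bigD1 r) //= D_xgen eqxx (mulA1 (hX r)) big1 ?addr0 ?mul1r // => q hq.
by rewrite D_xgen (negbTE hq) mulA0r.
Qed.

Lemma Gamma_even r : Weven (Gamma r).
Proof. by apply: Weven_single; exact: homog_xgen. Qed.

Definition wtv X (B : 'I_(m + n) -> F) : Prop :=
  forall s a u, cf (X s) a u != 0 -> forall r, wt r a u s = B r.

Lemma wtv_single s a u : wtv (single s (mono a u)) (fun r => wt r a u s).
Proof.
move=> q b v; rewrite singleE; case: (eqVneq q s) => [->|_]; last by rewrite cf0 eqxx.
rewrite cf_mono; case: andP => [[/andP[_ /forallP h] /eqP ->] _|_]; last by rewrite eqxx.
by move=> r; rewrite /wt; case: (split r) => // i; rewrite (eqP (h i)).
Qed.

Lemma wtv_add X Y B : wtv X B -> wtv Y B -> wtv (X + Y) B.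
Proof.
move=> hX hY s a u; rewrite addWE cfD => h r.
case: (eqVneq (cf (X s) a u) 0) h => [->|/hX/(_ r) ->//].
by rewrite add0r => /hY/(_ r) ->.
Qed.

Lemma wtv_eq X B B' : B =1 B' -> wtv X B -> wtv X B'.
Proof. by move=> e h s a u /h hr r; rewrite hr e. Qed.

Lemma br_Gamma_wtv r X B : Weven X -> wtv X B -> br (Gamma r) X = B r *: X.
Proof.
move=> he h; apply/ffunP => s; apply: cfP => a u; rewrite cf_Gamma // scaleWE cfZ.
by case: (eqVneq (cf (X s) a u) 0) => [->|/h ->//]; rewrite !mulr0.
Qed.

(** The field $D_{ik}(x^{(g+\varepsilon_i)}x_k)$: here both terms survive, and neither of them is
    divergence-free alone. For $g=0$ it is the torus element $\Gamma_i+\Gamma_k$. *)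
Definition Eg (i : 'I_m) (k : 'I_n) (g : 'I_m -> nat) : W :=
  single (od k) (mono g [set k]) + single (ev i) (mono (incr i g) set0).

Lemma drs_Eg i k (g : 'I_m -> nat) : adm g -> (g i < piD p m t i)%N ->
  drs (ev i) (od k) (mono (incr i g) [set k]) = Eg i k g.
Proof.
move=> hg hi; rewrite drsE tau_ev tau_od /= expr0 expr1 scale1r scaleN1r opprK.
rewrite Dev_mono_incr // Dod_mono ?admissible_incr // inE eqxx setDv.
by rewrite -inversions_set1l inversionsE !big_set1 ltnn expr0 scale1r.
Qed.

Lemma inSS_Eg i k (g : 'I_m -> nat) : adm g -> (g i < piD p m t i)%N -> inSS (Eg i k g).
Proof.
move=> hg hi; rewrite -drs_Eg //; apply: inSS_drs; rewrite tau_ev tau_od.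
by have := homog_mono F p t (incr i g) [set k]; rewrite cards1.
Qed.

Lemma wtv_Eg i k (g : 'I_m -> nat) : wtv (Eg i k g) (fun r => wt r g [set k] (od k)).
Proof.
apply: wtv_add; first exact: wtv_single.
apply: (wtv_eq _ (@wtv_single _ _ _)) => r; case: (split_ordP r) => j ->; rewrite ?wt_ev ?wt_od.
  rewrite ev_eq ev_od subr0 /incr natrD addrK //.
by rewrite od_ev od_eq !inE subr0 subrr.
Qed.

Definition hh i k : W := Gamma (ev i) + Gamma (od k).

Lemma hhE i k : hh i k = Eg i k (fun=> 0%N).
Proof.
rewrite /hh addrC /Defs.Gamma xgen_ev xgen_od; congr (_ + single _ _).
by apply: eq_mono => j; rewrite /eps /incr muln1.
Qed.

Lemma inSS_hh i k : inSS (hh i k).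
Proof. by rewrite hhE; apply: inSS_Eg; [exact: admissible0|apply: leq_trans (piD_ge3 i)]. Qed.

Lemma br_hh_wtv i k X B : Weven X -> wtv X B ->
  br (hh i k) X = (B (ev i) + B (od k)) *: X.
Proof. by move=> h hX; rewrite brDl !(br_Gamma_wtv _ h hX) scalerDl. Qed.

Lemma cf_hh i k X s a u : Weven X ->
  cf (br (hh i k) X s) a u = (wt (ev i) a u s + wt (od k) a u s) * cf (X s) a u.
Proof. by move=> h; rewrite brDl addWE cfD !cf_Gamma // [RHS]mulrDl. Qed.

End Elements.

Lemma ord_third N (i j : 'I_N) : (3 <= N)%N -> exists l : 'I_N, (l != i) && (l != j).
Proof.
move=> N3; have h : (0 < #|~: [set i; j]|)%N.
  have := cardsC [set i; j]; rewrite card_ord cards2 => e.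
  by case: (i != j) e; lia.
by case/card_gt0P: h => l; rewrite !inE negb_or; exists l.
Qed.

(** The inductive step of the higher Leibniz rule: [T i j] stands for the term with $i$ derivatives
    on the first factor and $j$ on the second. *)
Lemma sum_pascal (V : zmodType) (T : nat -> nat -> V) N :
  \sum_(j < N.+1) (T (N - j)%N.+1 j *+ 'C(N, j) + T (N - j)%N j.+1 *+ 'C(N, j)) =
  \sum_(j < N.+2) T (N.+1 - j)%N j *+ 'C(N.+1, j).
Proof.
rewrite big_split /=.
transitivity (T N.+1 0%N *+ 'C(N, 0) +
    \sum_(j < N.+1) (T (N - j)%N j.+1 *+ 'C(N, j.+1) + T (N - j)%N j.+1 *+ 'C(N, j))).
  rewrite [in RHS]big_split addrA; congr (_ + _).
  have := @big_ord_recl V 0 +%R N.+1 (fun j : 'I_N.+2 => T (N.+1 - j)%N j *+ 'C(N, j)).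
  rewrite big_ord_recr /= [X in _ *+ X]bin_small // mulr0n addr0 => e.
  transitivity (\sum_(i < N.+1) T (N.+1 - i)%N i *+ 'C(N, i)).
    by apply: eq_bigr => j _; rewrite subSn // -ltnS.
  by rewrite e.
rewrite [RHS]big_ord_recl /= !bin0; congr (_ + _).
by apply: eq_bigr => j _; rewrite /bump /= add1n subSS binS mulrnDr.
Qed.

(** * Inner derivations, $p$-th powers, and directness of the sum *)

Section InnerAndPowers.
Variables (F : fieldType) (p m n : nat) (t : 'I_m -> nat).
Hypothesis pF : p \in [pchar F].
Hypothesis p3 : (3 < p)%N.
Hypothesis m3 : (3 <= m)%N.
Hypothesis n3 : (3 <= n)%N.
Hypothesis t_gt0 : forall i, (0 < t i)%N.
Local Notation A := (Alg F p m n t).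
Local Notation W := (Wsp F p m n t).
Local Notation mono := (@monoA F p m n t).
Local Notation D := (@DA F p m n t).
Local Notation "f ** g" := (@Defs.mulA F p m n t f g) (at level 40, left associativity).
Local Notation tau := (tau m n).
Local Notation Weven := (@Weven F p m n t).
Local Notation brW := (@brW F p m n t).
Local Notation single := (@single F p m n t).
Local Notation divW := (@divW F p m n t).
Local Notation inSS := (@inSS F p m n t).
Local Notation inSbarT := (@inSbarT F p m n t).
Local Notation isDerS := (@isDerS F p m n t).
Local Notation Gamma := (@Gamma F p m n t).
Local Notation Dw := (@Dw F p m n t).
Local Notation one := (mono (fun=> 0%N) set0).
Implicit Types (f g h : A) (a b : 'I_m -> nat) (u v w : {set 'I_n}) (E G X Y Z : W).

Lemma divW_Gamma r : divW (Gamma r) = (-1) ^+ tau r *: one.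
Proof. by rewrite /Defs.Gamma divW_single ?(D_xgen pF p3 t_gt0) ?eqxx //; exact: homog_xgen. Qed.

(** With [even_inSbarT] this describes $\overline{\mathcal S}+\mathcal T$ as the even fields of
    constant divergence. *)
Lemma inSbarT_even E : inSbarT E -> Weven E /\ exists c, divW E = c *: one.
Proof.
case=> E1 [E2 [[hd he] [[c ->] ->]]].
have [hG [x hx]] : Weven (\sum_r c r *: Gamma r) /\ exists x, divW (\sum_r c r *: Gamma r) = x *: one.
  elim/big_rec: _ => [|r X _ [hX [x hx]]].
    by split; [exact: Weven0|exists 0; rewrite divW0 scale0r].
  have hG := Gamma_even F p t r; split; first exact: Weven_lin.
  by exists (c r * (-1) ^+ tau r + x); rewrite divW_even_linear // divW_Gamma hx scalerA scalerDl.
by split; [exact: WevenD|exists x; rewrite divWD // hd add0r].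
Qed.

Lemma even_inSbarT E c : Weven E -> divW E = c *: one -> inSbarT E.
Proof.
(* As $i_0$ is an even index, $\Gamma_{i_0}$ has divergence 1, and $c\,\Gamma_{i_0}$ absorbs the
   divergence of $E$. *)
move=> hE hc; set i0 : 'I_m := Ordinal (ltnW (ltnW m3)).
exists (E - c *: Gamma (ev i0)), (c *: Gamma (ev i0)); split; [|split; last by rewrite subrK].
  have hG := WevenZ c (Gamma_even F p t (ev i0)).
  split; last exact: WevenB.
  rewrite divWB // divWZ; last exact: Gamma_even.
  by rewrite divW_Gamma tau_ev expr0 scale1r hc subrr.
exists (fun r => if r == ev i0 then c else 0); rewrite (bigD1 (ev i0)) // eqxx.
by rewrite big1 /= ?addr0 // => r /negbTE ->; rewrite scale0r.
Qed.

Lemma inSS_even X : inSS X -> Weven X. Proof. by case. Qed.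

Lemma inSS_brL X Y : inSS X -> inSS Y -> inSS (br X Y).
Proof.
move=> hX hY; apply: (inSS_br pF (c := 0)) => //; first exact: inSS_even.
by rewrite inSS_divW0 // scale0r.
Qed.

(** Derivations of the whole Lie algebra of even fields. They can be iterated freely and subtracted
    from a derivation of $\mathcal S$ without asking whether they preserve $\mathcal S$. *)
Definition der_even (delta : W -> W) : Prop :=
  [/\ forall X, Weven X -> Weven (delta X),
      forall c X Y, delta (c *: X + Y) = c *: delta X + delta Y
    & forall X Y, Weven X -> Weven Y ->
        delta (br X Y) = br (delta X) Y + br X (delta Y)].

Lemma der_even_br E : Weven E -> der_even (br E).
Proof.
move=> hE; split; [by move=> X; exact: br_even|exact: br_linear|].
by move=> X Y hX hY; exact: (jacobi pF).
Qed.

Lemma der_even_iter delta N X : der_even delta -> Weven X -> Weven (iter N delta X).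
Proof. by case=> h _ _ hX; elim: N => //= N; exact: h. Qed.

Lemma der_even_iter_lin delta N c X Y : der_even delta ->
  iter N delta (c *: X + Y) = c *: iter N delta X + iter N delta Y.
Proof. by case=> _ h _; elim: N => //= N ->. Qed.

Lemma der_even_leibniz delta N X Y : der_even delta -> Weven X -> Weven Y ->
  iter N delta (br X Y) =
  \sum_(j < N.+1) br (iter (N - j) delta X) (iter j delta Y) *+ 'C(N, j).
Proof.
move=> hd hX hY; have [h1 h2 h3] := hd.
have dD B C : delta (B + C) = delta B + delta C.
  by rewrite -[B]scale1r h2 !scale1r.
have d0 : delta 0 = 0 by apply: (addIr (delta 0)); rewrite -dD !add0r.
have dM B k : delta (B *+ k) = delta B *+ k.
  by elim: k => [|k IH]; rewrite ?mulr0n // !mulrS dD IH.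
elim: N => [|N IH]; first by rewrite big_ord1 bin0 mulr1n.
pose T i j := br (iter i delta X) (iter j delta Y).
have hT i j : delta (T i j) = T i.+1 j + T i j.+1 by apply: h3; exact: der_even_iter.
rewrite iterS IH (big_morph delta dD d0) -(sum_pascal T).
by apply: eq_bigr => j _; rewrite dM hT mulrnDl.
Qed.

Lemma sum_bin_p (V : lmodType F) (B : nat -> V) :
  \sum_(j < p.+1) B j *+ 'C(p, j) = B 0%N + B p.
Proof.
have p0 := prime_gt0 (pcharf_prime pF).
rewrite (bigD1 ord0) //= (bigD1 ord_max) /=; last by rewrite -val_eqE /= -lt0n.
rewrite bin0 binn !mulr1n big1 ?addr0 // => j /andP[h1 h2].
rewrite -scaler_nat (bin_lt_pcharf_0 pF) ?scale0r // lt0n.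
move: h1 h2; rewrite -!val_eqE /= => -> h2.
by rewrite ltn_neqAle h2 -ltnS ltn_ord.
Qed.

(** All middle terms of the higher Leibniz rule carry a binomial divisible by $p$. *)
Lemma der_even_iter_p delta : der_even delta -> der_even (iter p delta).
Proof.
move=> hd; have [h1 h2 h3] := hd; split.
- by move=> X hX; exact: der_even_iter.
- by move=> c X Y; exact: der_even_iter_lin.
move=> X Y hX hY; rewrite (der_even_leibniz _ hd hX hY).
have := sum_bin_p (fun j => br (iter (p - j) delta X) (iter j delta Y)) => ->.
by rewrite subn0 subnn.
Qed.

Lemma der_even_iter_pX delta r : der_even delta -> der_even (iter (p ^ r) delta).
Proof.
move=> hd; elim: r => [|r IH]; first by rewrite expn0.
have := der_even_iter_p IH; case=> h1 h2 h3; split.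
- by move=> X /h1; rewrite expnS iterM.
- by move=> c X Y; rewrite expnS !iterM.
- by move=> X Y hX hY; rewrite expnS !iterM h3.
Qed.

Lemma der_even_dW i : der_even (dW i).
Proof.
split; [by move=> X; exact: dW_even|by move=> c X Y; exact: dW_linear|].
by move=> X Y; exact: dW_br.
Qed.

Lemma iter_brW_Dw N i X : Weven X -> iter N (brW (Dw i)) X = iter N (dW i) X.
Proof.
move=> hX; elim: N => //= N ->; rewrite brW_even ?br_Dw //; first exact: Dw_even.
exact: der_even_iter (der_even_dW i) hX.
Qed.

Lemma divW_Dw i : divW (Dw i) = 0.
Proof. by rewrite /Defs.Dw divW_single ?tau_ev ?homog_one // Dev_one scaler0. Qed.

Lemma inSS_iter_dW N i X : inSS X -> inSS (iter N (dW i) X).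
Proof.
move=> hX; elim: N => //= N IH; rewrite -br_Dw; apply: (inSS_br pF (c := 0)) => //.
  exact: Dw_even.
by rewrite divW_Dw scale0r.
Qed.

Lemma isDerS_ext (phi psi : W -> W) : (forall X, Weven X -> phi X = psi X) ->
  isDerS phi -> isDerS psi.
Proof.
move=> e [h1 h2 h3]; have hL X : inSS X -> psi X = phi X by move/inSS_even/e.
split=> [X hX|c X Y hX hY|X Y hX hY]; first by rewrite hL //; exact: h1.
  by rewrite !hL // ?h2 //; exact: inSS_lin.
by rewrite !hL // ?h3 // brW_even //; [exact: inSS_brL|exact: inSS_even|exact: inSS_even].
Qed.

Lemma isDerS_der_even (delta : W -> W) : der_even delta ->
  (forall X, inSS X -> inSS (delta X)) -> isDerS delta.
Proof.
move=> [h1 h2 h3] hL; split=> // X Y hX hY.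
have [hX' hY'] := (inSS_even hX, inSS_even hY).
by rewrite !brW_even ?h3 //; apply: h1.
Qed.

Lemma isDerS_inSbarT E : inSbarT E -> isDerS (brW E).
Proof.
move=> /inSbarT_even[hE [c hc]].
apply: (@isDerS_ext (br E)) => [X hX|]; first by rewrite brW_even.
by apply: isDerS_der_even; [exact: der_even_br|move=> X; exact: (inSS_br pF hE hc)].
Qed.

Lemma isDerS_pX i r : isDerS (iter (p ^ r) (brW (Dw i))).
Proof.
apply: (@isDerS_ext (iter (p ^ r) (dW i))) => [X hX|]; first by rewrite iter_brW_Dw.
apply: isDerS_der_even; first exact: der_even_iter_pX (der_even_dW i).
by move=> X; exact: inSS_iter_dW.
Qed.

(** [padSum] with $\mathrm{ad}\,D_i$ in its coefficientwise form, so that it is linear on all of $W$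
    and its coefficients can be computed. *)
Definition pd (c : 'I_m -> nat -> F) X : W :=
  \sum_(i < m) \sum_(1 <= r < t i) c i r *: iter (p ^ r) (dW i) X.

Lemma padSum_pd c X : Weven X -> padSum F p m n t c X = pd c X.
Proof.
move=> hX; apply: eq_bigr => i _; apply: eq_bigr => r _.
by rewrite iter_brW_Dw.
Qed.

Lemma der_even_pd c : der_even (pd c).
Proof.
split.
- move=> X hX; apply: Weven_sum => i _; apply: Weven_sum => r _; apply: WevenZ.
  exact: der_even_iter (der_even_dW i) hX.
- move=> k X Y; rewrite /pd scaler_sumr -big_split /=; apply: eq_bigr => i _.
  rewrite scaler_sumr -big_split /=; apply: eq_bigr => r _.
  have [_ -> _] := der_even_iter_pX r (der_even_dW i).
  by rewrite scalerDr !scalerA mulrC.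
- move=> X Y hX hY; rewrite /pd br_suml br_sum -big_split /=; apply: eq_bigr => i _.
  rewrite br_suml br_sum -big_split /=; apply: eq_bigr => r _.
  have [_ _ ->] := der_even_iter_pX r (der_even_dW i); rewrite // brZ brZl.
  by rewrite scalerDr.
Qed.

Lemma inSS_pd c X : inSS X -> inSS (pd c X).
Proof.
move=> hX; apply: inSS_sum => i _; apply: inSS_sum => r _; apply: inSSZ.
exact: inSS_iter_dW.
Qed.

Lemma cf_pd c X s a u : cf (pd c X s) a u =
  \sum_(i < m) \sum_(1 <= r < t i) c i r * cf (X s) (addx a (eps i (p ^ r))) u.
Proof.
rewrite /pd sum_ffunE cf_sum; apply: eq_bigr => i _.
rewrite sum_ffunE cf_sum; apply: eq_bigr => r _.
by rewrite scaleWE cfZ cf_iter_dW.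
Qed.

(** Every term reads off a coefficient at an exponent raised by $p^r\ge p$, so fields of small
    exponents are killed. *)
Lemma cf_pd_small c X s a u :
  (forall b, (exists i, (p <= b i)%N) -> cf (X s) b u = 0) -> cf (pd c X s) a u = 0.
Proof.
move=> h; rewrite cf_pd big1 // => i _; rewrite big_nat big1 // => r /andP[hr _].
rewrite h ?mulr0 //; exists i; rewrite /addx /eps eqxx mul1n.
apply: leq_trans (leq_addl _ _); rewrite -[X in (X <= _)%N]expn1 leq_exp2l //.
exact: prime_gt1 (pcharf_prime pF).
Qed.

Lemma leq_pX_piD i r : (r < t i)%N -> (p ^ r <= piD p m t i)%N.
Proof.
move=> h; rewrite -ltnS (piD_succ _ pF) ltn_exp2l //.
exact: prime_gt1 (pcharf_prime pF).
Qed.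

Lemma inSS_Dw i : inSS (Dw i).
Proof.
apply: inSS_mono => //; first exact: admissible0.
- by rewrite cards0 tau_ev.
- by rewrite free_of_ev.
apply/or3P; apply: Or33; apply/existsP; exists (Ordinal (ltnW (ltnW n3))); by rewrite inE.
Qed.

Lemma inSS_powD i j c : i != j -> (c <= piD p m t i)%N -> inSS (single (ev j) (mono (eps i c) set0)).
Proof.
move=> hij hc; apply: inSS_mono => //; first exact: admissible_eps.
- by rewrite cards0 tau_ev.
- by rewrite free_of_ev /eps [j == i]eq_sym (negbTE hij).
apply/or3P; apply: Or33; apply/existsP; exists (Ordinal (ltnW (ltnW n3))); by rewrite inE.
Qed.

Lemma cf_mul_mono_small f a v b u : (exists i, (b i < a i)%N) -> cf (f ** mono a v) b u = 0.
Proof.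
case=> i hi; elim/alg_ind: f => [|c f g hf hg|c w _]; first by rewrite mulA0l cf0.
  by rewrite mulA_linearl cfD cfZ hf hg mulr0 addr0.
rewrite mono_mul; case: ifP => _; last by rewrite cf0.
rewrite cfZ cf_mono; case: forallP => [/(_ i)|_]; last by rewrite andbF mulr0.
by rewrite /addx => /eqP e; move: hi; rewrite e ltnNge leq_addl.
Qed.

Lemma cf_pd_pow c i j r s u : (1 <= r < t i)%N ->
  cf (pd c (single (ev j) (mono (eps i (p ^ r)) set0)) s) (fun=> 0%N) u =
  if (s == ev j) && (u == set0) then c i r else 0.
Proof.
move=> hr; have /andP[hr1 hr2] := hr.
have hcf l q : cf (single (ev j) (mono (eps i (p ^ r)) set0) s) (addx (fun=> 0%N) (eps l (p ^ q))) u
    = ([&& s == ev j, u == set0, l == i & q == r])%:R.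
  rewrite singleE; case: eqP => _; last by rewrite cf0.
  rewrite cf_mono admissible_eps ?leq_pX_piD //= andbC; congr (nat_of_bool (_ && _))%:R.
  have hpp := prime_gt1 (pcharf_prime pF).
  have hp0 x : (0 < p ^ x)%N by rewrite expn_gt0 (ltnW hpp).
  apply/forallP/andP => [hh|[/eqP -> /eqP ->] x]; last by [].
  have := hh l; rewrite /addx /eps eqxx mul1n add0n; case: (eqVneq l i) => [_|_].
    by rewrite mul1n eqn_exp2l // => ->.
  by rewrite mul0n => /eqP h0; have := hp0 q; rewrite h0.
rewrite cf_pd (bigD1 i) //= (bigD1_seq r) ?mem_index_iota ?iota_uniq ?hr1 ?hr2 //=.
rewrite hcf !eqxx !andbT [X in _ + X + _]big1 ?addr0 => [|q /negbTE hq]; last first.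
  by rewrite hcf hq !andbF mulr0.
rewrite [X in _ + X]big1 ?addr0 => [|l /negbTE hl]; last first.
  by rewrite big1 // => q _; rewrite hcf hl !andbF mulr0.
by case: ifP => _; rewrite ?mulr1 ?mulr0.
Qed.

(** Two kinds of test fields suffice. On $D_i$ the powers vanish, so $E$ involves no even variable.
    On $x_i^{(p^r)}D_j$ the constant coefficient of $[E,\cdot]$ at $D_j$ is then 0, because
    $p^r\ge2$, while [pd] produces [c i r] there. *)
Lemma br_eq_pd_eq0 E c : Weven E ->
  (forall X, inSS X -> br E X = pd c X) -> forall X, inSS X -> br E X = 0.
Proof.
move=> hE h.
have hD i : dW i E = 0.
  have e : pd c (Dw i) = 0.
    apply/ffunP => s; apply: cfP => a u; rewrite [in RHS]ffunE cf0; apply: cf_pd_small.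
    move=> b [j hj]; rewrite singleE; case: eqP => _; last by rewrite cf0.
    rewrite cf_mono; case: forallP => [/(_ j)/eqP hb|_]; last by rewrite andbF.
    by move: hj; rewrite hb leqn0 => /eqP p0; move: p3; rewrite p0.
  by rewrite -br_Dw br_antisym h ?e ?oppr0 //; exact: inSS_Dw.
have hc i r : (1 <= r < t i)%N -> c i r = 0.
  case/andP => hr1 hr2; have [j /andP[hj _]] := ord_third i i m3.
  have hij : i != j by rewrite eq_sym.
  have hpi := leq_pX_piD hr2.
  have hX := inSS_powD hij hpi; have hXe := inSS_even hX.
  have /ffunP/(_ (ev j)) e := h _ hX.
  have : cf (br E (single (ev j) (mono (eps i (p ^ r)) set0)) (ev j)) (fun=> 0%N) set0 = 0.
    rewrite ffunE cfB single_id act_single.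
    have -> : D (ev j) (E (ev j)) = 0 by have /ffunP/(_ (ev j)) := hD j; rewrite !ffunE.
    rewrite mulA0r cf0 subr0 actE cf_sum big_Y /=.
    rewrite [X in _ + X]big1 ?addr0 => [|k _]; last by rewrite Dod_mono0 mulA0r cf0.
    rewrite big1 // => l _; rewrite Dev_mono ?admissible_eps //.
    case: eqP => [_|/eqP hl]; first by rewrite mulA0r cf0.
    apply: cf_mul_mono_small; exists i; rewrite /decr /eps eqxx mul1n subn_gt0.
    have hp : (1 < p ^ r)%N by rewrite -(exp1n r) ltn_exp2r //; exact: prime_gt1 (pcharf_prime pF).
    by apply: leq_trans hp; rewrite ltnS; case: (i == l).
  by rewrite e cf_pd_pow ?hr1 // !eqxx.
move=> X hX; rewrite h // /pd big1 // => i _; rewrite big_nat big1 // => r hr.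
by rewrite hc // scale0r.
Qed.

End InnerAndPowers.

(** * Derivations of $\mathcal S$ into the even fields *)

Section Cocycles.
Variables (F : fieldType) (p m n : nat) (t : 'I_m -> nat).
Hypothesis pF : p \in [pchar F].
Hypothesis p3 : (3 < p)%N.
Hypothesis m3 : (3 <= m)%N.
Hypothesis n3 : (3 <= n)%N.
Hypothesis t_gt0 : forall i, (0 < t i)%N.
Local Notation A := (Alg F p m n t).
Local Notation W := (Wsp F p m n t).
Local Notation mono := (@monoA F p m n t).
Local Notation "f ** g" := (@Defs.mulA F p m n t f g) (at level 40, left associativity).
Local Notation homog := (@homog F p m n t).
Local Notation tau := (tau m n).
Local Notation Weven := (@Weven F p m n t).
Local Notation single := (@single F p m n t).
Local Notation inSS := (@inSS F p m n t).
Local Notation Dw := (@Dw F p m n t).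
Local Notation one := (mono (fun=> 0%N) set0).
Local Notation adm := (admissible p t).
Local Notation hh := (@hh F p m n t).
Local Notation wt := (@wt F m n).
Implicit Types (f g h : A) (a b : 'I_m -> nat) (u v w : {set 'I_n}) (E G X Y Z : W).

(** Values are only required to be even fields, so this class is closed under subtracting
    $\mathrm{ad}\,E$ for an arbitrary even $E$. *)
Definition cocycle (psi : W -> W) : Prop :=
  [/\ forall X, inSS X -> Weven (psi X),
      forall c X Y, inSS X -> inSS Y -> psi (c *: X + Y) = c *: psi X + psi Y
    & forall X Y, inSS X -> inSS Y -> psi (br X Y) = br (psi X) Y + br X (psi Y)].

Lemma cocycle_sub psi delta : cocycle psi -> der_even delta ->
  cocycle (fun X => psi X - delta X).
Proof.
move=> [h1 h2 h3] [d1 d2 d3]; split.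
- by move=> X hX; exact: (WevenB (h1 _ hX) (d1 _ (inSS_even hX))).
- move=> c X Y hX hY; rewrite h2 // d2 scalerBr opprD.
  by rewrite [LHS]addrACA.
- move=> X Y hX hY; rewrite h3 // d3; try exact: inSS_even.
  by rewrite brBl brB opprD [LHS]addrACA.
Qed.

Lemma p_ge5 : (5 <= p)%N.
Proof.
have := pcharf_prime pF; case: (ltngtP p 4) => // [h|->//].
by move: p3 => h'; move: (leq_trans h h'); rewrite ltnn.
Qed.

(** A prime $p>3$ is at least 5, so it divides no nonzero integer of absolute value at most 4. This
    turns weight identities in $\mathbb F$ into identities of integers. *)
Lemma small_int_eq0 (z : int) : (z%:~R = 0 :> F) -> (`|z| <= 4)%N -> z = 0.
Proof.
clear m3 n3 t_gt0; move=> h hz; apply/eqP; rewrite -absz_eq0; apply/eqP.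
have : (`|z|%N)%:R = 0 :> F.
  case: z h {hz} => k /=; first by [].
  by rewrite NegzE mulrNz => /eqP; rewrite oppr_eq0 => /eqP.
move/eqP; rewrite -(dvdn_pcharf pF) => /dvdnP[q hq].
by case: q hq => [//|q] hq; have := p_ge5; move: hz; rewrite hq mulSn; lia.
Qed.

Section Basics.
Variable psi : W -> W.
Hypothesis cpsi : cocycle psi.

Lemma cocycle0 : psi 0 = 0.
Proof.
have [_ h _] := cpsi; have := h 1 0 0 (inSS0 _ _ _ _) (inSS0 _ _ _ _).
by rewrite scaler0 addr0 scale1r -[X in X = _]addr0 => /addrI.
Qed.
Lemma cocycleZ c X : inSS X -> psi (c *: X) = c *: psi X.
Proof.
have [_ h _] := cpsi => hX; have := h c X 0 hX (inSS0 _ _ _ _).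
by rewrite cocycle0 !addr0.
Qed.
Lemma cocycleD X Y : inSS X -> inSS Y -> psi (X + Y) = psi X + psi Y.
Proof. by have [_ h _] := cpsi => hX hY; have := h 1 X Y hX hY; rewrite !scale1r. Qed.
Lemma cocycleN X : inSS X -> psi (- X) = - psi X.
Proof. by move=> hX; rewrite -scaleN1r cocycleZ // scaleN1r. Qed.
Lemma cocycleB X Y : inSS X -> inSS Y -> psi (X - Y) = psi X - psi Y.
Proof. by move=> hX hY; rewrite cocycleD ?cocycleN //; exact: inSSN. Qed.
Lemma cocycle_even X : inSS X -> Weven (psi X).
Proof. by have [h _ _] := cpsi; exact: h. Qed.
Lemma cocycle_br X Y : inSS X -> inSS Y -> psi (br X Y) = br (psi X) Y + br X (psi Y).
Proof. by have [_ _ h] := cpsi; exact: h. Qed.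
Lemma cocycle_brK X Y : inSS X -> inSS Y -> psi X = 0 -> psi (br X Y) = br X (psi Y).
Proof. by move=> hX hY h; rewrite cocycle_br // h br0l add0r. Qed.
Lemma cocycle_br0 X Y : inSS X -> inSS Y -> psi X = 0 -> psi Y = 0 -> psi (br X Y) = 0.
Proof. by move=> hX hY h h'; rewrite cocycle_brK // h' br0. Qed.

End Basics.

Lemma cf_homog c f a u : homog c f -> cf f a u != 0 -> odd #|u| = c.
Proof.
move=> /homogP hf h; case: (boolP (adm a)) => ha; last by rewrite cf_out ?eqxx in h.
have [b [h1 h2]] := Mon_ex u ha.
move: h; rewrite -(eq_cf _ _ h1) -h2 cf_alpha => h.
by apply/eqP; apply: contraR h => /hf ->.
Qed.

Lemma cf_Weven E s a u : Weven E -> cf (E s) a u != 0 -> odd #|u| = tau s.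
Proof. by move=> h; exact: cf_homog. Qed.

(** Once [psi] kills the torus elements $h_{ik}$ it commutes with $\mathrm{ad}\,h_{ik}$, and so it
    respects their eigenspaces. *)
Lemma cocycle_weight psi X (B : 'I_(m + n) -> F) s a u :
  cocycle psi -> (forall i k, psi (hh i k) = 0) -> inSS X -> wtv X B ->
  cf (psi X s) a u != 0 ->
  forall i k, wt (ev i) a u s + wt (od k) a u s = B (ev i) + B (od k).
Proof.
move=> cpsi hpsi hX hB hne i k.
have hh' := inSS_hh pF p3 t_gt0 i k.
have := cocycle_brK cpsi hh' hX (hpsi i k).
rewrite (br_hh_wtv pF p3 t_gt0 _ _ (inSS_even hX) hB) (cocycleZ cpsi) // => /ffunP/(_ s) e.
have : cf ((B (ev i) + B (od k)) *: psi X s) a u = cf (br (hh i k) (psi X) s) a u.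
  by rewrite -e scaleWE.
rewrite cfZ (cf_hh pF p3 t_gt0); last exact: cocycle_even.
by move/(mulIf hne).
Qed.

(* Only weights summed over one even and one odd index are available, because
   the torus of S is spanned by such sums. *)
Lemma cocycle_weight0 psi X (B : 'I_(m + n) -> int) s u :
  cocycle psi -> (forall i k, psi (hh i k) = 0) -> inSS X ->
  wtv X (fun r => (B r)%:~R) -> cf (psi X s) z0 u != 0 ->
  forall i k,
  let z := (B (ev i) + B (od k) + (ev i == s)%:Z - (k \in u)%:Z + (od k == s)%:Z)%R in
  (`|z| <= 4)%N -> z = 0.
Proof.
move=> cpsi hpsi hX hB hne i k z hz; apply: small_int_eq0 => //.
have := cocycle_weight cpsi hpsi hX hB hne i k; rewrite wt_ev wt_od /z => h.
rewrite !rmorphD rmorphN /= -[(B (ev i))%:~R + _]h -!pmulrn.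
by rewrite sub0r; ring.
Qed.

Lemma dW_single_mono i s a u : adm a ->
  dW i (single s (mono a u)) = if a i == 0%N then 0 else single s (mono (decr i a) u).
Proof. by move=> ha; rewrite dW_single Dev_mono //; case: ifP; rewrite ?single0. Qed.

Section VanishingOnD.
Variable psi : W -> W.
Hypothesis cpsi : cocycle psi.
Hypothesis psiD : forall i, psi (Dw i) = 0.

Lemma cocycle_dW i X : inSS X -> psi (dW i X) = dW i (psi X).
Proof. by move=> hX; rewrite -!br_Dw cocycle_brK //; exact: inSS_Dw. Qed.

(** The induction on $|a|$ replaces $X$ by $D_iX$ and lowers $a_i$, which is why vanishing is proved
    for a whole family [P] closed under the $\mathrm{ad}\,D_i$. *)
Lemma cocycle_eq0 (P : W -> Prop) :
  (forall X, P X -> inSS X) -> (forall i X, P X -> P (dW i X)) ->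
  (forall X, P X -> forall s u, cf (psi X s) z0 u = 0) ->
  forall X, P X -> psi X = 0.
Proof.
move=> hL hD h0 X hX; apply/ffunP => s; apply: cfP => a u; rewrite [in RHS]ffunE cf0.
move: {2}(\sum_i a i)%N (leqnn (\sum_i a i)%N) => N.
elim: N a X hX => [|N IH] a X hX ha.
  rewrite (@eq_cf _ _ _ _ _ _ a z0); first exact: h0.
  by move=> i; apply/eqP; move: ha; rewrite leqn0 sum_nat_eq0 => /forall_inP/(_ i isT).
case: (boolP [exists i, a i != 0%N]) => [/existsP[i hi]|]; last first.
  rewrite negb_exists => /forallP h; rewrite (@eq_cf _ _ _ _ _ _ a z0); first exact: h0.
  by move=> i; apply/eqP; have := h i; rewrite negbK.
have e : a =1 incr i (decr i a).
  move=> j; rewrite /incr /decr subnK //; case: (eqVneq j i) => // ->.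
  by rewrite lt0n.
rewrite (eq_cf _ _ e) -cf_dW -cocycle_dW; last exact: hL.
apply: IH; first exact: hD.
rewrite -ltnS; apply: leq_trans ha; rewrite (bigD1 i) // [X in (_ < X)%N](bigD1 i) //=.
rewrite /decr eqxx subn1 -[X in (_ < X + _)%N](prednK (n := a i)) ?lt0n // addSn ltnS leq_add2l.
by apply: leq_sum => j _; exact: leq_subr.
Qed.

Lemma cocycle_const_coef X : inSS X -> (forall i, psi (dW i X) = 0) ->
  forall s a u, (exists i, a i != 0%N) -> cf (psi X s) a u = 0.
Proof. by move=> hX h; apply: dW_eq0P => i; rewrite -cocycle_dW. Qed.

Lemma cf_mono_mul_small f a b u v : (exists i, (b i < a i)%N) -> cf (mono a v ** f) b u = 0.
Proof.
case=> i hi; elim/alg_ind: f => [|c f g hf hg|c w _]; first by rewrite mulA0r cf0.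
  by rewrite mulA_is_linear cfD cfZ hf hg mulr0 addr0.
rewrite mono_mul; case: ifP => _; last by rewrite cf0.
rewrite cfZ cf_mono; case: forallP => [/(_ i)|_]; last by rewrite andbF mulr0.
by rewrite /addx => /eqP e; move: hi; rewrite e ltnNge leq_addr.
Qed.

(** The last hypothesis says that $x^{(a)}$ has degree at least 2: removing any one variable leaves
    another. Hence neither $x^{(a)}$ nor a first derivative of it contributes a constant term to the
    bracket. *)
Lemma cocycle_br_order2 j a Y s u : adm a -> inSS (single (ev j) (mono a set0)) -> inSS Y ->
  psi (single (ev j) (mono a set0)) = 0 -> (forall i, exists l, (0 < decr i a l)%N) ->
  cf (psi (br (single (ev j) (mono a set0)) Y) s) z0 u = 0.
Proof.
move=> ha hZ hY h0 h2; rewrite cocycle_brK // ffunE cfB act_single.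
have [l hl] := h2 j; rewrite cf_mono_mul_small; last first.
  by exists l; apply: leq_trans hl _; exact: leq_subr.
rewrite singleE; case: eqP => _; last by rewrite act0 cf0 subr0.
rewrite actE cf_sum big1 ?subr0 // => r _.
case: (split_ordP r) => i ->; last by rewrite Dod_mono0 mulA0r cf0.
rewrite Dev_mono //; case: ifP => _; first by rewrite mulA0r cf0.
by apply: cf_mul_mono_small; exact: h2.
Qed.

End VanishingOnD.

End Cocycles.

(** * Which constant terms the weights allow *)

Section WeightMatching.
Variables (F : fieldType) (p m n : nat) (t : 'I_m -> nat).
Hypothesis pF : p \in [pchar F].
Hypothesis p3 : (3 < p)%N.
Hypothesis m3 : (3 <= m)%N.
Hypothesis n3 : (3 <= n)%N.
Hypothesis t_gt0 : forall i, (0 < t i)%N.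
Local Notation W := (Wsp F p m n t).
Local Notation mono := (@monoA F p m n t).
Local Notation tau := (tau m n).
Local Notation single := (@single F p m n t).
Local Notation inSS := (@inSS F p m n t).
Local Notation hh := (@hh F p m n t).
Implicit Types (a b : 'I_m -> nat) (u v w : {set 'I_n}) (X Y Z : W).

(** An integer lift of [wt]; it is small when the exponents are, as [small_int_eq0] requires. *)
Definition zwt (r : 'I_(m + n)) a u (s : 'I_(m + n)) : int :=
  (match split r with inl i => (a i)%:Z | inr k => (k \in u)%:Z end) - (r == s)%:Z.

Lemma zwt_ev i a u s : zwt (ev i) a u s = (a i)%:Z - (ev i == s)%:Z.
Proof. by rewrite /zwt split_ev. Qed.
Lemma zwt_od k a u s : zwt (od k) a u s = (k \in u)%:Z - (od k == s)%:Z.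
Proof. by rewrite /zwt split_od. Qed.

Lemma wtv_zwt s a u : wtv (single s (mono a u)) (fun r => (zwt r a u s)%:~R).
Proof.
apply: (wtv_eq _ (@wtv_single _ _ _ _ _ _ _ _)) => r.
by case: (split_ordP r) => i ->; rewrite ?wt_ev ?wt_od ?zwt_ev ?zwt_od rmorphB /= -!pmulrn.
Qed.

Variable psi : W -> W.
Hypothesis cpsi : cocycle psi.
Hypothesis psih : forall i k, psi (hh i k) = 0.

(** Only the weight of $X$ enters, not its shape, so this also covers $x_i^{(p^r)}D_j$, which has
    the weight of $D_j$. *)
Lemma match_const X s u s' u' : inSS X -> free_of s z0 u ->
  wtv X (fun r => (zwt r z0 u s)%:~R) -> cf (psi X s') z0 u' != 0 -> s' = s /\ u' = u.
Proof.
move=> hX hf hB hne.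
have H i k : 0 - (ev i == s)%:Z + ((k \in u)%:Z - (od k == s)%:Z) + (ev i == s')%:Z
    - (k \in u')%:Z + (od k == s')%:Z = 0.
  have := @cocycle_weight0 _ _ _ _ _ pF p3 t_gt0 psi X _ s' u' cpsi psih hX hB hne i k.
  rewrite zwt_ev zwt_od; apply.
  by case: (ev i == s); case: (k \in u); case: (od k == s); case: (ev i == s');
     case: (k \in u'); case: (od k == s').
move: hf H; case: (split_ordP s) => j ->; case: (split_ordP s') => j' ->;
  rewrite ?free_of_ev ?free_of_od => hj H.
(* An even index different from both directions removes the even Kronecker terms and leaves
   $u'=u$. *)
- have [i /andP[i1 i2]] := ord_third j j' m3.
  have eu : u' = u.
    apply/setP => k; have := H i k; rewrite !ev_eq !od_ev (negbTE i1) (negbTE i2).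
    by case: (k \in u); case: (k \in u').
  split=> //; congr lshift; have := H j (Ordinal (ltnW (ltnW n3))).
  rewrite !ev_eq !od_ev eqxx eu; case: eqP => [->//|_].
  by case: (_ \in u).
- have [i /andP[i1 _]] := ord_third j j m3; have := H j j'; have := H i j'.
  rewrite !ev_eq !ev_od !od_ev od_eq !eqxx (negbTE i1).
  by case: (_ \in u); case: (_ \in u').
- have [i /andP[i1 _]] := ord_third j' j' m3; have := H j' j; have := H i j.
  rewrite !ev_eq !ev_od !od_ev od_eq !eqxx (negbTE i1).
  by case: (_ \in u); case: (_ \in u').
have i0 : 'I_m := Ordinal (ltnW (ltnW m3)).
have ej : j' = j.
  apply/eqP; have := H i0 j; rewrite !ev_od !od_eq eqxx (negbTE hj) [j == j']eq_sym.
  by case: (_ \in u'); case: (j' == j).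
subst j'; split=> //; apply/setP => k; have := H i0 k; rewrite !ev_od !od_eq.
by case: (k \in u); case: (k \in u'); case: (k == j).
Qed.

(** For even $s$ the weights of $X$ in the directions $i_0$ and $s$ differ by 2, whereas the even
    weights of a constant term $x^{u'}D_{s'}$ differ by at most 1. *)
Lemma match_small X s a u s' u' : inSS X -> free_of s a u -> odd #|u| = tau s ->
  (forall i, (a i <= 1)%N) -> (exists i, a i != 0%N) ->
  wtv X (fun r => (zwt r a u s)%:~R) -> cf (psi X s') z0 u' = 0.
Proof.
move=> hX hf hu ha [i0 hi0] hB; apply/eqP; apply: contraT => hne.
have H i k : (a i)%:Z - (ev i == s)%:Z + ((k \in u)%:Z - (od k == s)%:Z) + (ev i == s')%:Z
    - (k \in u')%:Z + (od k == s')%:Z = 0.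
  have := @cocycle_weight0 _ _ _ _ _ pF p3 t_gt0 psi X _ s' u' cpsi psih hX hB hne i k.
  rewrite zwt_ev zwt_od; apply; have := ha i; case: (a i) => [|[|//]] _;
  by case: (ev i == s); case: (k \in u); case: (od k == s); case: (ev i == s');
     case: (k \in u'); case: (od k == s').
have e0 : a i0 = 1%N by apply/eqP; rewrite eqn_leq ha lt0n.
have hs0 : (ev i0 == s) = false.
  apply/negP => /eqP es; move: hf; rewrite -es free_of_ev => /eqP h; by rewrite h in e0.
(* For odd $s$ the set $u$ is nonempty because $|u|$ is odd. With $k\in u$ the combined weight at
   $i_0$ and $k$ is 2, which no constant term reaches. *)
have odd_case l : s = od l -> False.
  move=> es; move: hf hu H; rewrite es free_of_od tau_od => hl hu H.
  suff u0 : u = set0 by rewrite u0 cards0 in hu.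
  apply/setP => k; rewrite inE; apply/negP => hk.
  have := H i0 k; have := H i0 l; rewrite e0 ev_od !od_eq hk eqxx (negbTE hl).
  have kl : (k == l) = false by apply/negP => /eqP e; move: hl; rewrite -e hk.
  rewrite kl; case: (split_ordP s') => j' ->; rewrite ?ev_eq ?od_ev ?ev_od ?od_eq.
    by case: (i0 == j'); case: (_ \in u'); case: (_ \in u').
  have [q /andP[q1 q2]] := ord_third k l n3; have := H i0 q.
  rewrite e0 !ev_od !od_eq (negbTE q2).
  case: (k == j'); case: (k \in u'); case: (q \in u); case: (l == j'); case: (l \in u');
  by case: (q == j'); case: (q \in u').
case: (split_ordP s) => j es; last by case: (odd_case j es).
have hj : a j = 0%N by move: hf; rewrite es free_of_ev => /eqP.
have [k /andP[k1 _]] := ord_third (Ordinal (ltnW (ltnW n3))) (Ordinal (ltnW (ltnW n3))) n3.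
have := H i0 k; have := H j k; rewrite hj e0 hs0 es eqxx !od_ev.
by case: (ev j == s'); case: (ev i0 == s'); case: (k \in u); case: (k \in u'); case: (od k == s').
Qed.

(** Comparing three even directions cancels the odd weight: $l$ and $j$ force $s'=j$, and then $i$
    forces $c=0$ in $\mathbb F$. *)
Lemma match_pow X (i j : 'I_m) (c : nat) s' u' : inSS X -> i != j -> c%:R != 0 :> F ->
  X = single (ev j) (mono (eps i c) set0) -> cf (psi X s') z0 u' = 0.
Proof.
move=> hX hij hc eX; apply/eqP; apply: contraT => hne.
have hB : wtv X (fun r => wt F r (eps i c) set0 (ev j)) by rewrite eX; exact: wtv_single.
have k0 : 'I_n := Ordinal (ltnW (ltnW n3)).
have H l := @cocycle_weight _ _ _ _ _ pF p3 t_gt0 psi X _ s' z0 u' cpsi psih hX hB hne l k0.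
have [l /andP[l1 l2]] := ord_third i j m3.
have := H j; have := H i; have := H l; move: {H}(wt F (od k0) z0 u' s') => d.
have el : eps i c l = 0%N by rewrite /eps (negbTE l1).
have ej : eps i c j = 0%N by rewrite /eps [j == i]eq_sym (negbTE hij).
have ei : eps i c i = c by rewrite /eps eqxx mul1n.
rewrite !wt_ev wt_od !ev_eq od_ev inE eqxx (negbTE l2) (negbTE hij) el ej ei.
rewrite !subr0 !addr0 !sub0r => hl hi hj.
have hz : (1 + (ev l == s')%:Z - (ev j == s')%:Z)%:~R = 0 :> F.
  rewrite rmorphB rmorphD /= -!pmulrn; move: hl => /eqP; rewrite addrC subr_eq0 => /eqP hd.
  by move: hj; rewrite hd => hj; rewrite -addrA [X in _ + X]addrC hj subrr.
have : (1 + (ev l == s')%:Z - (ev j == s')%:Z) = 0.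
  by apply: (small_int_eq0 pF p3) hz _; case: (ev l == s'); case: (ev j == s').
case: (eqVneq (ev j) s') => [es _|]; last by case: (ev l == s').
move: hl hi; rewrite -es !ev_eq (negbTE l2) (negbTE hij) oppr0 !add0r => ->.
by move/esym/eqP; rewrite (negbTE hc).
Qed.

(** All even weights of $X$ are $-1$, while for even $s'$ those of $x^{u'}D_{s'}$ are not all equal;
    so $s'$ is odd. For odd $s$ the weight in that direction would then have to be $-2$. For even
    $s$ an index missing from $u$ forces $u'$ to be empty, against the parity of $|u'|$. *)
Lemma match_top X s a u s' u' : inSS X -> free_of s a u -> odd #|u| = tau s ->
  (forall i, (a i)%:R - (ev i == s)%:R = -1 :> F) ->
  tau s || [exists k, k \notin u] ->
  X = single s (mono a u) -> cf (psi X s') z0 u' = 0.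
Proof.
move=> hX hf hu ha hr eX; apply/eqP; apply: contraT => hne.
pose B (r : 'I_(m + n)) : int := match split r with inl _ => -1 | inr k => (k \in u)%:Z - (od k == s)%:Z end.
have hB : wtv X (fun r => (B r)%:~R).
  rewrite eX; apply: (wtv_eq _ (@wtv_single _ _ _ _ _ _ _ _)) => r; rewrite /B.
  case: (split_ordP r) => i ->; first by rewrite wt_ev ha.
  by rewrite wt_od rmorphB /= -!pmulrn.
have H i k : -1 + ((k \in u)%:Z - (od k == s)%:Z) + (ev i == s')%:Z
    - (k \in u')%:Z + (od k == s')%:Z = 0.
  have := @cocycle_weight0 _ _ _ _ _ pF p3 t_gt0 psi X _ s' u' cpsi psih hX hB hne i k.
  rewrite /B split_ev split_od; apply.
  by case: (k \in u); case: (od k == s); case: (ev i == s'); case: (k \in u'); case: (od k == s').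
have hu' := cf_Weven (cocycle_even cpsi hX) hne.
have k0 : 'I_n := Ordinal (ltnW (ltnW n3)).
have i0 : 'I_m := Ordinal (ltnW (ltnW m3)).
move: H hu'; case: (split_ordP s') => l' -> H; rewrite ?tau_ev ?tau_od => hu'.
  have [i /andP[i1 _]] := ord_third l' l' m3; have := H i k0; have := H l' k0.
  rewrite !ev_eq eqxx (negbTE i1) od_ev.
  by case: (k0 \in u); case: (od k0 == s); case: (k0 \in u').
move: hf hu hr H; case: (split_ordP s) => l ->; rewrite ?free_of_ev ?free_of_od ?tau_ev ?tau_od.
  move=> _ _ /= /existsP[k hk] H; have := H i0 k; rewrite od_ev !od_eq ev_od (negbTE hk).
  case: (eqVneq k l') => [e|_]; last by case: (k \in u').
  case: (boolP (k \in u')) => // hk' _.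
  suff u0 : u' = set0 by rewrite u0 cards0 in hu'.
  apply/setP => q; rewrite inE; apply/negP => hq; have := H i0 q.
  rewrite od_ev ev_od od_eq hq -e; case: (eqVneq q k) => [qk|_]; last by case: (q \in u).
  by move: hk'; rewrite -qk hq.
move=> hl _ _ H; have := H i0 l; rewrite !od_eq ev_od eqxx (negbTE hl).
by case: (l \in u'); case: (l == l').
Qed.

(** The even weights are 1 at $l$ and 0 elsewhere, and the weight at $k$ is 0. Two even directions
    other than $l$ show that the constant term has weight 0 at $k$, which leaves $1=0$ or $1=-1$. *)
Lemma match_Eg_unit i k (g : 'I_m -> nat) l s' u' : inSS (Eg F p t i k g) ->
  g =1 eps l 1 -> cf (psi (Eg F p t i k g) s') z0 u' = 0.
Proof.
move=> hX hg; apply/eqP; apply: contraT => hne.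
have hB := @wtv_Eg F p m n t i k g.
have H j := @cocycle_weight _ _ _ _ _ pF p3 t_gt0 psi _ _ s' z0 u' cpsi psih hX hB hne j k.
have [j /andP[j1 _]] := ord_third l l m3; have [q /andP[q1 q2]] := ord_third l j m3.
have wk : wt F (od k) g [set k] (od k) = 0 by rewrite wt_od inE !eqxx subrr.
have gl : g l = 1%N by rewrite hg /eps eqxx.
have gj : g j = 0%N by rewrite hg /eps (negbTE j1).
have gq : g q = 0%N by rewrite hg /eps (negbTE q1).
have := H l; have := H j; have := H q; rewrite wk; move: (wt F (od k) _ _ s') => c.
rewrite !wt_ev !ev_od gl gj gq !subr0 !addr0 !sub0r => hq hj.
have e : ev j == s' = false.
  apply/negP => /eqP e; move: hj hq; rewrite -e !ev_eq eqxx (negbTE q2) oppr0 add0r => h h'.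
  by move/eqP: h; rewrite h' addr0 oppr_eq0 oner_eq0.
move: hj; rewrite e oppr0 add0r => ->; rewrite addr0.
have n2 : (2%:~R : F) != 0 by apply/eqP => /(small_int_eq0 pF p3) h'; have := h' isT.
case: (ev l == s') => /eqP; last by rewrite oppr0 eq_sym oner_eq0.
by rewrite eq_sym -addr_eq0 => h; move: n2; rewrite -pmulrn mulr2n h.
Qed.

(** Since $g_i=\pi_i-1$ is $-2$ in $\mathbb F$, the combined weight at $i$ and $k$ is $-2$; for a
    constant term it is at least $-1$. *)
Lemma match_Eg_top i k (g : 'I_m -> nat) s' u' : inSS (Eg F p t i k g) ->
  (g i).+1 = piD p m t i -> cf (psi (Eg F p t i k g) s') z0 u' = 0.
Proof.
move=> hX hg; apply/eqP; apply: contraT => hne.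
have hB := @wtv_Eg F p m n t i k g.
have := @cocycle_weight _ _ _ _ _ pF p3 t_gt0 psi _ _ s' z0 u' cpsi psih hX hB hne i k.
have e2 : (g i)%:R = - 2%:R :> F.
  apply/eqP; rewrite -addr_eq0 -natrD addn2 hg (piD_succ _ pF) natrX pcharf0 //.
  by rewrite expr0n (gtn_eqF (t_gt0 i)).
rewrite !wt_ev !wt_od e2 inE !eqxx ev_od subrr addr0 !subr0 sub0r => h.
have hz : (2 - (ev i == s')%:Z + (k \in u')%:Z - (od k == s')%:Z)%:~R = 0 :> F.
  rewrite !(rmorphB, rmorphD) /= -!pmulrn -!addrA h addrA.
  by rewrite -mulr2n subrr.
move/(small_int_eq0 pF p3): hz; case: (split_ordP s') => j ->; rewrite ?ev_eq ?od_ev ?ev_od ?od_eq.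
  by case: (i == j); case: (k \in u') => h'; have := h' isT.
by case: (k == j); case: (k \in u') => h'; have := h' isT.
Qed.

End WeightMatching.

Section ZeroWeight.
Variables (F : fieldType) (m n : nat).

(** If $s$ were $i$ or $j$, the weights $-1$ and 0 would have to cancel the same odd weight. So both
    even weights are 0, hence so are all odd weights, and these determine $u$ from $s$. *)
Lemma zero_weight (i j : 'I_m) s (u : {set 'I_n}) : i != j ->
  (forall k, wt F (ev i) z0 u s + wt F (od k) z0 u s = 0) ->
  (forall k, wt F (ev j) z0 u s + wt F (od k) z0 u s = 0) -> (0 < n)%N ->
  (exists q, [/\ q != i, q != j, s = ev q & u = set0]) \/ (exists l, s = od l /\ u = [set l]).
Proof.
move=> hij hi hj n0.
have e : (ev i == s) = false.
  apply/negP => /eqP e; have := hi (Ordinal n0); have := hj (Ordinal n0).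
  rewrite -e !wt_ev !ev_eq eqxx [j == i]eq_sym (negbTE hij) subrr add0r => ->.
  by rewrite addr0 sub0r => /eqP; rewrite oppr_eq0 oner_eq0.
have e' : (ev j == s) = false.
  apply/negP => /eqP e'; have := hj (Ordinal n0); have := hi (Ordinal n0).
  rewrite -e' !wt_ev !ev_eq eqxx (negbTE hij) subrr add0r => ->.
  by rewrite addr0 sub0r => /eqP; rewrite oppr_eq0 oner_eq0.
have hk k : (k \in u) = (od k == s).
  have := hi k; rewrite wt_ev wt_od e subrr add0r => /eqP; rewrite subr_eq0.
  by case: (k \in u); case: (od k == s); rewrite ?eqxx // ?oner_eq0 // eq_sym oner_eq0.
move: e e' hk; case: (split_ordP s) => q -> e e' hk; [left; exists q|right; exists q]; split=> //.
- by apply/negP => /eqP h; move: e; rewrite h eqxx.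
- by apply/negP => /eqP h; move: e'; rewrite h eqxx.
- by apply/setP => k; rewrite hk od_ev inE.
- by apply/setP => k; rewrite hk od_eq inE.
Qed.

End ZeroWeight.

(** * Normalizing by inner derivations and $p$-th powers *)

Section Normalization.
Variables (F : fieldType) (p m n : nat) (t : 'I_m -> nat).
Hypothesis pF : p \in [pchar F].
Hypothesis p3 : (3 < p)%N.
Hypothesis m3 : (3 <= m)%N.
Hypothesis n3 : (3 <= n)%N.
Hypothesis t_gt0 : forall i, (0 < t i)%N.
Local Notation A := (Alg F p m n t).
Local Notation W := (Wsp F p m n t).
Local Notation mono := (@monoA F p m n t).
Local Notation D := (@DA F p m n t).
Local Notation "f ** g" := (@Defs.mulA F p m n t f g) (at level 40, left associativity).
Local Notation tau := (tau m n).
Local Notation Weven := (@Weven F p m n t).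
Local Notation single := (@single F p m n t).
Local Notation inSS := (@inSS F p m n t).
Local Notation Gamma := (@Gamma F p m n t).
Local Notation Dw := (@Dw F p m n t).
Local Notation one := (mono (fun=> 0%N) set0).
Local Notation adm := (admissible p t).
Local Notation hh := (@hh F p m n t).
Local Notation wt := (@wt F m n).
Implicit Types (f g h : A) (a b : 'I_m -> nat) (u v w : {set 'I_n}) (E G X Y Z : W).

Let adm0 : adm z0 := admissible0 p t.
Let i0 : 'I_m := Ordinal (ltnW (ltnW m3)).
Let k0 : 'I_n := Ordinal (ltnW (ltnW n3)).

Let inDw i : inSS (Dw i). Proof. exact: inSS_Dw. Qed.

Lemma two_neq0 : 2%:R != 0 :> F.
Proof. by rewrite -(dvdn_pcharf pF); apply/negP => /dvdn_leq h; move: (h isT) p3; lia. Qed.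

Lemma dW_const i s u : dW i (single s (mono z0 u)) = 0.
Proof. by rewrite dW_single_mono. Qed.

Lemma inSS_xD k l : k != l -> inSS (single (od l) (mono z0 [set k])).
Proof.
move=> hkl; apply: inSS_mono => //; rewrite ?tau_od ?cards1 //.
by rewrite free_of_od inE eq_sym.
Qed.

Lemma inSS_xxD k l i : k != l -> inSS (single (ev i) (mono z0 [set k; l])).
Proof.
move=> hkl; have [q /andP[q1 q2]] := ord_third k l n3.
apply: inSS_mono => //; rewrite ?tau_ev ?cards2 ?hkl ?free_of_ev //=.
by apply/orP; right; apply/existsP; exists q; rewrite !inE negb_or q1.
Qed.

Lemma dW_hh i j k : i != j -> dW i (hh j k) = 0.
Proof.
move=> hij; apply/ffunP => s; rewrite !ffunE.
have h r : r != ev i -> D (ev i) (xgen F p m n t r) = 0.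
  by move=> h; rewrite (D_xgen pF p3 t_gt0) eq_sym (negbTE h).
have h1 : D (ev i) (xgen F p m n t (ev j)) = 0 by apply: h; rewrite ev_eq eq_sym.
have h2 : D (ev i) (xgen F p m n t (od k)) = 0 by apply: h; rewrite od_ev.
by rewrite DAD; do 2 case: ifP => _; rewrite ?h1 ?h2 ?DA0 ?addr0.
Qed.

Lemma dW_hh_id i k : dW i (hh i k) = Dw i.
Proof.
apply/ffunP => s; rewrite !ffunE DAD.
have h1 : D (ev i) (xgen F p m n t (ev i)) = one by rewrite (D_xgen pF p3 t_gt0) eqxx.
have h2 : D (ev i) (xgen F p m n t (od k)) = 0 by rewrite (D_xgen pF p3 t_gt0) ev_od.
by case: ifP => _; case: ifP => _; rewrite ?h1 ?h2 ?DA0 ?addr0.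
Qed.

Lemma torus_decomp i E :
  (forall s a u, cf (E s) a u != 0 -> (forall j, a j = 0%N) /\
     ((s = ev i /\ u = set0) \/ exists l, s = od l /\ u = [set l])) ->
  E = cf (E (ev i)) z0 set0 *: Dw i + \sum_l cf (E (od l)) z0 [set l] *: Gamma (od l).
Proof.
move=> h; apply/ffunP => s; apply: cfP => a u.
rewrite addWE scaleWE cfD cfZ sum_ffunE cf_sum singleE.
under eq_bigr => l _ do rewrite scaleWE cfZ singleE.
case: (split_ordP s) => q es; rewrite es in h *.
  rewrite [X in _ + X]big1 ?addr0 => [|l _]; last by rewrite ev_od cf0 mulr0.
  rewrite ev_eq; case: (eqVneq q i) => [->|hq]; last first.
    rewrite cf0 mulr0; apply/eqP; apply: contraT => /h[_ [[/ev_inj e]|[l [/eqP]]]].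
      by rewrite e eqxx in hq.
    by rewrite ev_od.
  rewrite cf_mono adm0 /=; case: forallP => [ha|ha]; last first.
    rewrite mulr0; apply/eqP; apply: contraT => /h[h' _]; case: ha => j; by rewrite h'.
  case: (eqVneq u set0) => [->|hu]; rewrite ?mulr1 ?mulr0.
    by apply: eq_cf => j; exact/eqP.
  apply/eqP; apply: contraT => /h[_ [[_ e]|[l [/eqP]]]]; first by rewrite e eqxx in hu.
  by rewrite ev_od.
rewrite od_ev cf0 mulr0 add0r (bigD1 q) //= [X in _ + X]big1 ?addr0 => [|l hl]; last first.
  by rewrite od_eq eq_sym (negbTE hl) cf0 mulr0.
rewrite eqxx xgen_od cf_mono adm0 /=; case: forallP => [ha|ha]; last first.
  rewrite mulr0; apply/eqP; apply: contraT => /h[h' _]; case: ha => j; by rewrite h'.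
case: (eqVneq u [set q]) => [->|hu]; rewrite ?mulr1 ?mulr0.
  by apply: eq_cf => j; exact/eqP.
apply/eqP; apply: contraT => /h[_ [[/eqP]|[l [/od_inj e e']]]]; first by rewrite od_ev.
by rewrite e' -e eqxx in hu.
Qed.

Lemma single_mono_neq0 s u (c : F) : c *: single s (mono z0 u) = 0 -> c = 0.
Proof.
move=> /ffunP/(_ s); rewrite scaleWE single_id ffunE => /(congr1 (fun f => cf f z0 u)).
by rewrite cfZ cf_mono_id // mulr1 cf0.
Qed.

Lemma br_torus i (c : F) (d : 'I_n -> F) s u : Weven (single s (mono z0 u)) ->
  br (c *: Dw i + \sum_l d l *: Gamma (od l)) (single s (mono z0 u)) =
  (\sum_l d l * wt (od l) z0 u s) *: single s (mono z0 u).
Proof.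
move=> hY; rewrite brDl brZl br_Dw dW_const scaler0 add0r br_suml scaler_suml.
apply: eq_bigr => l _; rewrite brZl (br_Gamma_wtv pF p3 t_gt0 _ hY (@wtv_single _ _ _ _ _ _ _ _)).
by rewrite scalerA.
Qed.

Lemma sum_wt_xD (d : 'I_n -> F) k l : k != l ->
  \sum_q d q * wt (od q) z0 [set k] (od l) = d k - d l.
Proof.
move=> hkl; under eq_bigr => q _ do rewrite wt_od inE od_eq mulrBr.
rewrite sumrB (bigD1 k) //= eqxx mulr1 big1 ?addr0 => [|q /negbTE ->]; last by rewrite mulr0.
by rewrite (bigD1 l) //= eqxx mulr1 big1 ?addr0 // => q /negbTE ->; rewrite mulr0.
Qed.

Lemma sum_wt_xxD (d : 'I_n -> F) k l i : k != l ->
  \sum_q d q * wt (od q) z0 [set k; l] (ev i) = d k + d l.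
Proof.
move=> hkl; under eq_bigr => q _ do rewrite wt_od od_ev subr0.
rewrite (bigD1 k) //= (bigD1 l) 1?eq_sym //= !inE !eqxx orbT !mulr1 big1 ?addr0 //.
by move=> q /andP[/negbTE h1 /negbTE h2]; rewrite !inE h1 h2 mulr0.
Qed.

(** The hypotheses say $d_k-d_l=0$ and $d_k+d_l=0$ for $k\ne l$, and 2 is invertible. *)
Lemma torus_coef_eq0 (d : 'I_n -> F) :
  (forall k l, k != l -> \sum_q d q * wt (od q) z0 [set k] (od l) = 0) ->
  (forall k l, k != l -> \sum_q d q * wt (od q) z0 [set k; l] (ev i0) = 0) ->
  forall l, d l = 0.
Proof.
move=> h1 h2 l; have [k /andP[hk _]] := ord_third l l n3.
have := h1 _ _ hk; have := h2 _ _ hk; rewrite sum_wt_xD // sum_wt_xxD // => e /eqP.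
rewrite subr_eq0 => /eqP e'; move: e; rewrite e' -mulr2n -mulr_natr => /eqP.
by rewrite mulf_eq0 (negbTE two_neq0) orbF => /eqP.
Qed.

Lemma iter_dW_br N i X Y : Weven X -> Weven Y -> dW i Y = 0 ->
  iter N (dW i) (br X Y) = br (iter N (dW i) X) Y.
Proof.
move=> hX hY h0; elim: N => [//|N IH]; rewrite !iterS IH (dW_br pF) ?h0 ?br0 ?addr0 //.
exact: der_even_iter (der_even_dW n t pF i) hX.
Qed.

Lemma adm_incr_top i a : ~~ adm (incr i (addx a (eps i (piD p m t i)))).
Proof.
apply/negP => /forallP/(_ i); rewrite /incr /addx /eps !eqxx mul1n addn1 ltnNge.
by rewrite leq_addl.
Qed.

(** The coefficient form of $x_i\,x_i^{(c)}=(c+1)x_i^{(c+1)}$. *)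
Lemma cf_mul_xi f i c : (c < piD p m t i)%N ->
  cf (mono (eps i 1) set0 ** f) (eps i c.+1) set0 = c.+1%:R * cf f (eps i c) set0.
Proof.
move=> hc; elim/alg_ind: f => [|k f g hf hg|b v hb]; first by rewrite mulA0r !cf0 mulr0.
  by rewrite mulA_is_linear !cfD !cfZ hf hg mulrDr mulrCA.
rewrite mono1_mul cfZ !cf_mono hb /=; case: (eqVneq set0 v) => [_|_]; last first.
  by rewrite !andbF !mulr0.
rewrite !andbT; case: (boolP [forall j, eps i c j == b j]) => [/forallP hh|hh].
  have e j : b j = eps i c j by rewrite -(eqP (hh j)).
  have -> : adm (addx (eps i 1) b).
    apply/forallP => j; rewrite /addx e /eps; case: (eqVneq j i) => [->|_].
      by rewrite !mul1n.
    by rewrite !mul0n.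
  have -> : [forall j, eps i c.+1 j == addx (eps i 1) b j].
    by apply/forallP => j; rewrite /addx e /eps; case: (j == i); rewrite ?mul0n ?mul1n.
  rewrite mulr1 (bigD1 i) //= big1 => [|j hj]; last first.
    by rewrite /eps (negbTE hj) mul0n bin0.
  by rewrite e /eps eqxx !mul1n bin1 muln1 add1n mulr1.
case: (boolP [forall j, eps i c.+1 j == addx (eps i 1) b j]) => [/forallP h'|_].
  case/negP: hh; apply/forallP => j; have := h' j; rewrite /addx /eps.
  by case: (eqVneq j i) => [->|_]; rewrite ?mul1n ?mul0n.
by rewrite andbF !mulr0.
Qed.

Section Integrability.
Variable psi : W -> W.
Hypothesis cpsi : cocycle psi.
Let e i := psi (Dw i).

Lemma cocycle_D_compat i j : dW i (e j) = dW j (e i).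
Proof.
have h : psi (br (Dw i) (Dw j)) = 0.
  by rewrite br_Dw dW_const (cocycle0 cpsi).
move: h; rewrite (cocycle_br cpsi); try exact: inDw.
rewrite br_Dw br_antisym br_Dw addrC => /eqP; rewrite subr_eq0 => /eqP //.
Qed.

(** From $[D_i,Y]=0$ one gets $[\psi(D_i),Y]=-D_i\psi(Y)$, and $D_i^{\pi_i+1}=0$. *)
Lemma cocycle_D_commute i Y : inSS Y -> dW i Y = 0 ->
  br (iter (piD p m t i) (dW i) (e i)) Y = 0.
Proof.
move=> hY h0; have hD := inDw i.
have he := cocycle_even cpsi hD.
have h : br (e i) Y = - dW i (psi Y).
  have : psi (br (Dw i) Y) = 0 by rewrite br_Dw h0 (cocycle0 cpsi).
  by rewrite (cocycle_br cpsi) // br_Dw => /eqP; rewrite addr_eq0 => /eqP.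
rewrite -iter_dW_br //; last exact: inSS_even.
apply/ffunP => s; apply: cfP => a u; rewrite (cf_iter_dW pF p3) h oppWE cfN cf_dW.
by rewrite cf_out ?oppr0 ?ffunE ?cf0 // adm_incr_top.
Qed.

(** This field is the obstruction to integrating along $x_i$. It commutes with the centralizer of
    $D_i$ in $\mathcal S$: the $D_j$ make it constant in the even variables, the $h_{jk}$ with $j\ne
    i$ leave a combination of $D_i$ and the $x_lD_l$, and [torus_coef_eq0] removes the latter. The
    multiple of $D_i$ needs another argument, as $D_i$ does commute with its centralizer. *)
Lemma cocycle_D_top i : iter (piD p m t i) (dW i) (e i) = 0.
Proof.
set C := iter _ _ _.
have hC : Weven C.
  apply: der_even_iter; first exact: der_even_dW.
  by apply: (cocycle_even cpsi); exact: inDw.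
have hD j : dW j C = 0.
  by rewrite -br_Dw br_antisym (cocycle_D_commute (inDw j) (dW_const i (ev j) set0)) oppr0.
have hw j s u : i != j -> cf (C s) z0 u != 0 ->
    forall k, wt (ev j) z0 u s + wt (od k) z0 u s = 0.
  move=> hij hne k; have := cocycle_D_commute (inSS_hh pF p3 t_gt0 j k) (dW_hh k hij).
  rewrite br_antisym => /eqP; rewrite oppr_eq0 => /eqP /ffunP/(_ s)/(congr1 (fun f => cf f z0 u)).
  rewrite (cf_hh pF p3 t_gt0) // ffunE cf0 => /eqP; rewrite mulf_eq0 (negbTE hne) orbF.
  by move/eqP.
have [i1 /andP[hi1 _]] := ord_third i i m3.
have [i2 /andP[hi2 hi12]] := ord_third i i1 m3.
have shape s a u : cf (C s) a u != 0 -> (forall j, a j = 0%N) /\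
     ((s = ev i /\ u = set0) \/ exists l, s = od l /\ u = [set l]).
  move=> hne; have ha j : a j = 0%N.
    by apply/eqP; apply: contraT => h; rewrite (dW_eq0P hD) ?eqxx // in hne; exists j.
  split=> //; have hne' : cf (C s) z0 u != 0 by rewrite -(eq_cf _ _ ha).
  have h1 : i != i1 by rewrite eq_sym.
  have h2 : i != i2 by rewrite eq_sym.
  have h12 : i1 != i2 by rewrite eq_sym.
  case: (zero_weight h12 (hw _ _ _ h1 hne') (hw _ _ _ h2 hne') (ltnW (ltnW n3))); last by right.
  case=> q [q1 q2 es eu]; left; split=> //; rewrite es; congr lshift; apply/eqP.
  apply: contraT => hq; have hiq : i != q by rewrite eq_sym.
  have := hw _ _ _ hiq hne' k0; rewrite wt_ev wt_od es eu inE od_ev eqxx subrr addr0 sub0r.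
  by move/eqP; rewrite oppr_eq0 oner_eq0.
have eC := torus_decomp shape; set c := cf (C (ev i)) z0 set0 in eC.
have hd : forall l, cf (C (od l)) z0 [set l] = 0.
  apply: (torus_coef_eq0 (d := fun l => cf (C (od l)) z0 [set l])) => k l hkl.
    have hY := inSS_xD hkl; apply: (@single_mono_neq0 (od l) [set k]).
    by rewrite -(br_torus i c) -?eC ?cocycle_D_commute ?dW_const //; exact: inSS_even.
  have hY := inSS_xxD i0 hkl; apply: (@single_mono_neq0 (ev i0) [set k; l]).
  by rewrite -(br_torus i c) -?eC ?cocycle_D_commute ?dW_const //; exact: inSS_even.
suff hc : c = 0.
  by rewrite eC hc scale0r add0r big1 // => l _; rewrite hd scale0r.
(* Apply [psi] to $[D_i,x_iD_{i_1}]=D_{i_1}$ and compare coefficients at $x_i^{(\pi_i)}D_{i_1}$. If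
   $y$ is that of $\psi(D_{i_1})$, compatibility turns the equation into $y=c-\pi_iy$, and
   $\pi_i=-1$ in $\mathbb F$. *)
have hij : i != i1 by rewrite eq_sym.
have hpi : (1 <= piD p m t i)%N by apply: leq_trans (piD_ge3 pF p3 t_gt0 i).
have hY := inSS_powD pF p3 n3 hij hpi; set Y := single _ _ in hY.
have dY : dW i Y = Dw i1.
  rewrite /Y dW_single_mono ?(admissible_eps1 pF p3 t_gt0) // /eps eqxx muln1 /=.
  by congr single; apply: eq_mono; exact: decr_eps.
have := cocycle_br cpsi (inDw i) hY; rewrite !br_Dw dY.
move/ffunP/(_ (ev i1))/(congr1 (fun f => cf f (eps i (piD p m t i)) set0)).
rewrite addWE cfD cf_dW [X in _ + X]cf_out; last first.
  by apply/negP => /forallP/(_ i); rewrite /incr /eps !eqxx mul1n addn1 ltnn.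
rewrite addr0 ffunE cfB single_id act_single.
have -> : act (psi (Dw i)) (mono (eps i 1) set0) = e i (ev i).
  have he := cocycle_even cpsi (inDw i).
  rewrite -xgen_ev actE (bigD1 (ev i)) //= (D_xgen pF p3 t_gt0) eqxx (mulA1 (he _)).
  by rewrite big1 ?addr0 // => r hr; rewrite (D_xgen pF p3 t_gt0) (negbTE hr) mulA0r.
have [N hpS] : exists N, piD p m t i = N.+1 by exists (piD p m t i).-1; rewrite prednK.
rewrite hpS cf_mul_xi; last by rewrite hpS.
have -> : cf (D (ev i1) (psi (Dw i) (ev i1))) (eps i N) set0 = cf (e i1 (ev i1)) (eps i N.+1) set0.
  have /ffunP/(_ (ev i1)) := cocycle_D_compat i1 i; rewrite !ffunE => ->.
  rewrite cf_Dev; apply: eq_cf => j; rewrite /incr /eps; case: (eqVneq j i) => _.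
    by rewrite !mul1n addn1.
  by rewrite !mul0n.
have -> : N.+1%:R = -1 :> F.
  rewrite -hpS; apply/eqP; rewrite -addr_eq0 natr1 (piD_succ _ pF) natrX pcharf0 //.
  by rewrite expr0n (gtn_eqF (t_gt0 i)).
have -> : cf (e i (ev i)) (eps i N.+1) set0 = c.
  by rewrite /c /C (cf_iter_dW pF p3) hpS; apply: eq_cf => j.
by rewrite mulN1r opprK => /eqP; rewrite -subr_eq subrr eq_sym => /eqP.
Qed.

End Integrability.

(** A potential for the family [e], with constant coefficients set to 0. Compatibility of mixed
    derivatives makes the picked index irrelevant. *)
Definition integ (e : 'I_m -> W) : W :=
  [ffun s => ([ffun b : Mon p m n t =>
    (if [pick i | alpha p m n t b i != 0%N] is Some i
     then cf (e i s) (decr i (alpha p m n t b)) (uset p m n t b) else 0) : F^o] : A)].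

Lemma incr_decr i a : a i != 0%N -> incr i (decr i a) =1 a.
Proof.
move=> h j; rewrite /incr /decr subnK //; case: (eqVneq j i) => // ->.
by rewrite lt0n.
Qed.

Lemma decr_incr i a : decr i (incr i a) =1 a.
Proof. by move=> j; rewrite /incr /decr addnK. Qed.

Lemma cf_integ e s a u i : (forall i j, dW i (e j) = dW j (e i)) ->
  adm a -> a i != 0%N -> cf (integ e s) a u = cf (e i s) (decr i a) u.
Proof.
move=> he ha hi; have [b [h1 h2]] := Mon_ex u ha.
rewrite -(eq_cf _ _ h1) -h2 cf_alpha !ffunE.
case: pickP => [j hj|/(_ i)]; last by rewrite h1 hi.
have ed q : decr q (alpha p m n t b) =1 decr q a by move=> x; rewrite /decr h1.
rewrite !(eq_cf _ _ (ed _)); rewrite h1 in hj.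
case: (eqVneq i j) => [->//|hij].
have ej : decr j a =1 incr i (decr i (decr j a)).
  by move=> x; rewrite incr_decr // /decr (negbTE hij) subn0.
have ei : decr i a =1 incr j (decr i (decr j a)).
  move=> x; rewrite /incr /decr; case: (eqVneq x j) => [->|_].
    by rewrite [j == i]eq_sym (negbTE hij) !subn0 subnK // lt0n.
  by rewrite subn0 addn0.
by rewrite (eq_cf _ _ ej) (eq_cf _ _ ei) -!cf_dW he.
Qed.

Lemma dW_integ e : (forall i j, dW i (e j) = dW j (e i)) ->
  (forall i, iter (piD p m t i) (dW i) (e i) = 0) -> forall i, dW i (integ e) = e i.
Proof.
move=> he ht i; apply/ffunP => s; apply: cfP => a u; rewrite cf_dW.
case: (boolP (adm (incr i a))) => h.
  rewrite (@cf_integ e s _ u i) //; last by rewrite /incr eqxx addn1.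
  by apply: eq_cf; exact: decr_incr.
rewrite cf_out //; case: (boolP (adm a)) => ha; last by rewrite cf_out.
(* At the top exponent the left side is out of range, and the right side is a coefficient of
   $D_i^{\pi_i}e_i$, which is 0 by hypothesis. *)
have hai : a i = piD p m t i.
  apply/eqP; rewrite eqn_leq (forallP ha) leqNgt; apply: contra h; exact: admissible_incr.
have /ffunP/(_ s)/(congr1 (fun f => cf f (fun j => if j == i then 0%N else a j) u)) := ht i.
rewrite (cf_iter_dW pF p3) ffunE cf0 => <-; apply: eq_cf => j; rewrite /addx /eps.
by case: eqP => [->|_]; rewrite ?mul1n ?mul0n ?addn0 // hai.
Qed.

Lemma integ_even e : (forall i, Weven (e i)) -> Weven (integ e).
Proof.
move=> h s; rewrite ffunE; apply/homogP => b hb; rewrite ffunE; case: pickP => // i _.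
apply/eqP; apply: contraT => /(cf_Weven (h i)) e'; by rewrite e' eqxx in hb.
Qed.

Lemma cocycle_inner_on_D psi : cocycle psi ->
  exists E, Weven E /\ forall i, psi (Dw i) = br E (Dw i).
Proof.
move=> cpsi; exists (- integ (fun i => psi (Dw i))).
have hc i j := cocycle_D_compat cpsi i j.
have ht i := cocycle_D_top cpsi i.
have he i : Weven (psi (Dw i)) := cocycle_even cpsi (inDw i).
split; first exact: (WevenN (integ_even he)).
have eN i X : dW i (- X) = - dW i X by apply/ffunP => s; rewrite !ffunE DAN.
by move=> i; rewrite br_antisym br_Dw eN opprK (dW_integ hc ht).
Qed.

(** All $D_i$ kill the field, hence its image, so only constant terms occur, and [match_const]
    leaves one of them. *)
Lemma cocycle_mono_scalar psi s u : cocycle psi -> (forall i, psi (Dw i) = 0) ->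
  (forall i k, psi (hh i k) = 0) -> free_of s z0 u -> inSS (single s (mono z0 u)) ->
  psi (single s (mono z0 u)) = cf (psi (single s (mono z0 u)) s) z0 u *: single s (mono z0 u).
Proof.
move=> cpsi psiD psih hf hX; apply/ffunP => q; apply: cfP => a v; rewrite scaleWE cfZ.
have hc : forall q a v, (exists i, a i != 0%N) -> cf (psi (single s (mono z0 u)) q) a v = 0.
  move=> q' a' v'; apply: (cocycle_const_coef pF p3 n3 cpsi psiD) => // i.
  by rewrite dW_const (cocycle0 cpsi).
case: (boolP [forall i, a i == 0%N]) => [/forallP h|]; last first.
  rewrite negb_forall => /existsP h; rewrite (hc _ _ _ h) singleE; case: eqP => _; last by rewrite cf0 mulr0.
  rewrite cf_mono; case: forallP => [h'|_]; last by rewrite andbF mulr0.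
  by case: h => i; rewrite h'.
have e : a =1 z0 by move=> i; exact/eqP.
rewrite !(eq_cf _ _ e); case: (boolP ((q == s) && (v == u))) => [/andP[/eqP -> /eqP ->]|hne].
  by rewrite single_id cf_mono_id // mulr1.
have -> : cf (single s (mono z0 u) q) z0 v = 0.
  rewrite singleE; move: hne; case: (q == s) => /=; last by rewrite cf0.
  by rewrite cf_mono => /negbTE ->; rewrite andbF.
rewrite mulr0; apply/eqP; apply: contraT => hn.
have := match_const pF p3 m3 n3 t_gt0 cpsi psih hX hf (@wtv_zwt _ _ _ _ _ _ _ _) hn.
by case=> e1 e2; rewrite e1 e2 !eqxx in hne.
Qed.

(** The images [V x] of the commuting $h_x$ involve no even variable, and $\mathrm{ad}\,h_x$ scales
    the coefficient at $x^uD_s$ by [lam x s u]. Commutativity gives [comm]; division by a nonzero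
    weight yields $G$, and the part where all weights vanish is shown to be 0. *)
Lemma cocycle_inner_on_torus psi : cocycle psi -> (forall i, psi (Dw i) = 0) ->
  exists G, [/\ Weven G, forall i, dW i G = 0 & forall i k, psi (hh i k) = br G (hh i k)].
Proof.
move=> cpsi psiD.
have hhL i k : inSS (hh i k) := inSS_hh pF p3 t_gt0 i k.
have hhe i k : Weven (hh i k) := inSS_even (hhL i k).
pose lam (x : 'I_m * 'I_n) s u := wt (ev x.1) z0 u s + wt (od x.2) z0 u s.
pose V (x : 'I_m * 'I_n) := psi (hh x.1 x.2).
have dV j x : dW j (V x) = 0.
  rewrite /V -(cocycle_dW pF p3 n3 cpsi psiD) //; case: (eqVneq j x.1) => [->|h].
    by rewrite dW_hh_id psiD.
  by rewrite dW_hh // (cocycle0 cpsi).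
have Ve x : Weven (V x) by exact: (cocycle_even cpsi (hhL _ _)).
have hwt0 i k : wtv (hh i k) (fun _ => 0 : F).
  rewrite hhE; apply: (wtv_eq _ (@wtv_Eg _ _ _ _ _ _ _ _)) => r.
  case: (split_ordP r) => q ->; rewrite ?wt_ev ?wt_od; first by rewrite ev_od subrr.
  by rewrite inE od_eq subrr.
have comm x y s u : lam y s u * cf (V x s) z0 u = lam x s u * cf (V y s) z0 u.
  have := cocycle_br cpsi (hhL x.1 x.2) (hhL y.1 y.2).
  rewrite (br_hh_wtv pF p3 t_gt0 _ _ (hhe _ _) (hwt0 _ _)) addr0 scale0r (cocycle0 cpsi).
  rewrite [br (psi _) _]br_antisym => /esym/eqP; rewrite addrC subr_eq0 => /eqP.
  move/(congr1 (fun E : W => cf (E s) z0 u)) => h.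
  have e1 := cf_hh pF p3 t_gt0 x.1 x.2 s z0 u (Ve y).
  have e2 := cf_hh pF p3 t_gt0 y.1 y.2 s z0 u (Ve x).
  exact: (etrans (esym e2) (etrans (esym h) e1)).
(* $[G,h_x]=V_x$ reads $-\lambda_xG=V_x$ on coefficients, and [comm] makes the quotient independent
   of the picked $x$. *)
pose G : W := [ffun s => ([ffun b : Mon p m n t =>
   (if [forall i, alpha p m n t b i == 0%N] then
      if [pick x | lam x s (uset p m n t b) != 0] is Some x
      then - cf (V x s) z0 (uset p m n t b) / lam x s (uset p m n t b) else 0
    else 0) : F^o] : A)].
have cfG s a u : cf (G s) a u = if [forall i, a i == 0%N] then
      (if [pick x | lam x s u != 0] is Some x then - cf (V x s) z0 u / lam x s u else 0) else 0.
  case: (boolP (adm a)) => ha; last first.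
    rewrite cf_out //; case: forallP => // h; case/negP: ha.
    by apply/forallP => i; rewrite (eqP (h i)).
  have [b [h1 h2]] := Mon_ex u ha; rewrite -(eq_cf _ _ h1) -h2 cf_alpha !ffunE.
  by rewrite (eq_forallb (fun i => congr1 (fun x => x == 0%N) (h1 i))).
have Ge : Weven G.
  move=> s; rewrite ffunE; apply/homogP => b hb; rewrite ffunE; case: ifP => // _.
  case: pickP => // x _; suff -> : cf (V x s) z0 (uset p m n t b) = 0 by rewrite oppr0 mul0r.
  apply/eqP; apply: contraT => /(cf_Weven (Ve x)) e'; by rewrite e' eqxx in hb.
have dG i : dW i G = 0.
  apply/ffunP => s; apply: cfP => a u; rewrite cf_dW cfG [in RHS]ffunE cf0.
  by case: forallP => // /(_ i); rewrite /incr eqxx addn1.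
exists G; split=> // i k.
have cpsi' := cocycle_sub cpsi (der_even_br pF Ge).
have psiD' j : psi (Dw j) - br G (Dw j) = 0.
  by rewrite psiD br_antisym br_Dw dG oppr0 subr0.
have hhL' := hhL i k; set V' := psi (hh i k) - br G (hh i k).
have V'e : Weven V' := cocycle_even cpsi' hhL'.
have dV' j : dW j V' = 0.
  rewrite /V' -(cocycle_dW pF p3 n3 cpsi' psiD') //; case: (eqVneq j i) => [->|h].
    by rewrite dW_hh_id psiD'.
  by rewrite dW_hh // (cocycle0 cpsi) br0 subr0.
have cfV' s u x : lam x s u != 0 -> cf (V' s) z0 u = 0.
  move=> hx; rewrite /V' [br G _]br_antisym opprK addWE cfD (cf_hh pF p3 t_gt0) // cfG.
  have -> : [forall i : 'I_m, 0%N == 0%N] by apply/forallP.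
  case: pickP => [y hy|/(_ x)]; last by rewrite hx.
  have := comm (i, k) y s u; rewrite /= -/(lam (i, k) s u) => e.
  apply/eqP; rewrite addr_eq0 mulNr mulrN opprK; apply/eqP.
  by rewrite mulrA -e mulrAC mulfV // mul1r.
have shape s a u : cf (V' s) a u != 0 -> (forall j, a j = 0%N) /\ exists l, s = od l /\ u = [set l].
  move=> hne; have ha j : a j = 0%N.
    by apply/eqP; apply: contraT => h; rewrite (dW_eq0P dV') ?eqxx // in hne; exists j.
  split=> //; have hne' : cf (V' s) z0 u != 0 by rewrite -(eq_cf _ _ ha).
  have hl x : lam x s u = 0.
    by apply/eqP; apply: contraT => /cfV' e; rewrite e eqxx in hne'.
  have [j /andP[hj _]] := ord_third i i m3; rewrite eq_sym in hj.
  case: (zero_weight hj (fun k => hl (i, k)) (fun k => hl (j, k)) (ltnW (ltnW n3))) => //.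
  case=> q [_ _ es eu]; have := hl (q, k); rewrite /lam /= wt_ev wt_od es eu inE od_ev eqxx.
  by rewrite subrr addr0 sub0r => /eqP; rewrite oppr_eq0 oner_eq0.
have shape' s a u : cf (V' s) a u != 0 -> (forall j, a j = 0%N) /\
     ((s = ev i0 /\ u = set0) \/ exists l, s = od l /\ u = [set l]).
  by move/shape => [h1 h2]; split=> //; right.
have eV := torus_decomp shape'; set c := cf (V' (ev i0)) z0 set0 in eV.
have hc : c = 0.
  by apply/eqP; apply: contraT => /shape[_ [l [/eqP]]]; rewrite ev_od.
(* The remainder $V'$ is a combination of the $x_lD_l$, so it acts on $Y$ by a scalar $d$. Apply the
   corrected derivation to $[h_{ik},Y]=BY$: if $y$ is the coefficient of its value on $Y$ at $Y$,
   then $By=d+By$. *)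
have hY s u : inSS (single s (mono z0 u)) ->
    \sum_l cf (V' (od l)) z0 [set l] * wt (od l) z0 u s = 0.
  move=> hL; have hY := inSS_even hL; have hB := @wtv_single F p m n t s z0 u.
  set Y := single s (mono z0 u) in hL hY hB *.
  have eb : br V' Y = (\sum_l cf (V' (od l)) z0 [set l] * wt (od l) z0 u s) *: Y.
    by rewrite {1}eV br_torus.
  set d := \sum_l _ in eb *; pose B := wt (ev i) z0 u s + wt (od k) z0 u s.
  pose psi' X := psi X - br G X.
  have e : B *: psi' Y = d *: Y + br (hh i k) (psi' Y).
    rewrite -eb -(cocycleZ cpsi' B hL) -(cocycle_br cpsi' hhL' hL).
    by congr psi'; rewrite (br_hh_wtv pF p3 t_gt0 _ _ hY hB).
  have := congr1 (fun E : W => cf (E s) z0 u) e.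
  rewrite addWE !scaleWE cfD !cfZ (cf_hh pF p3 t_gt0 i k s z0 u (cocycle_even cpsi' hL)).
  rewrite single_id cf_mono_id // mulr1 => /eqP.
  by rewrite -subr_eq subrr eq_sym => /eqP.
have hd := torus_coef_eq0 (d := fun l => cf (V' (od l)) z0 [set l])
   (fun k l hkl => hY _ _ (inSS_xD hkl)) (fun k l hkl => hY _ _ (inSS_xxD i0 hkl)).
apply/eqP; rewrite -subr_eq0 -/V' eV hc scale0r add0r big1 // => l _.
by rewrite hd scale0r.
Qed.

Local Notation xD k l := (single (od l) (mono z0 [set k])).
Local Notation xxD k l i := (single (ev i) (mono z0 [set k; l])).
Local Notation xiD i j := (single (ev j) (mono (eps i 1) set0)).

Lemma br_odd_torus (d : 'I_n -> F) s u : Weven (single s (mono z0 u)) ->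
  br (\sum_l d l *: Gamma (od l)) (single s (mono z0 u)) =
  (\sum_l d l * wt (od l) z0 u s) *: single s (mono z0 u).
Proof. by move/(br_torus i0 0 d); rewrite scale0r add0r. Qed.

Lemma D_od_x k l : D (od l) (mono z0 [set k]) = if l == k then one else 0.
Proof. by rewrite -xgen_od (D_xgen pF p3 t_gt0) od_eq. Qed.

Lemma x_mul1 k : mono z0 [set k] ** one = mono z0 [set k].
Proof. by apply: (@mulA1 _ _ _ _ _ true); have := homog_mono F p t z0 [set k]; rewrite cards1. Qed.

Lemma br_xD k l j : k != j -> br (xD k l) (xD l j) = xD k j.
Proof.
move=> h; rewrite br_single !D_od_x eqxx x_mul1 [j == k]eq_sym (negbTE h).
by rewrite mulA0r single0 subr0.
Qed.

Lemma br_xD_opp k l i : br (xD k l) (xD l k) = hh i k - hh i l.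
Proof.
rewrite br_single !D_od_x !eqxx !x_mul1 /hh /Defs.Gamma !xgen_od.
by rewrite opprD addrACA subrr add0r.
Qed.

Section Scalars.
Variable psi : W -> W.
Hypothesis cpsi : cocycle psi.
Hypothesis psiD : forall i, psi (Dw i) = 0.
Hypothesis psih : forall i k, psi (hh i k) = 0.

Lemma cocycle_const_eq0 X : inSS X -> (forall i, psi (dW i X) = 0) ->
  (forall s u, cf (psi X s) z0 u = 0) -> psi X = 0.
Proof.
move=> hX h h0; apply/ffunP => s; apply: cfP => a u; rewrite [in RHS]ffunE cf0.
case: (boolP [forall i, a i == 0%N]) => [/forallP ha|]; last first.
  by rewrite negb_forall => /existsP ha; exact: (cocycle_const_coef pF p3 n3 cpsi psiD).
by rewrite (@eq_cf _ _ _ _ _ _ a z0) // => i; exact/eqP.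
Qed.

Lemma psi0_small s a u q v : inSS (single s (mono a u)) -> free_of s a u ->
  odd #|u| = tau s -> (forall i, (a i <= 1)%N) -> (exists i, a i != 0%N) ->
  cf (psi (single s (mono a u)) q) z0 v = 0.
Proof.
move=> hX hf hu ha he.
exact: (@match_small F p m n t pF p3 n3 t_gt0 psi cpsi psih _ s a u q v hX hf hu ha he (@wtv_zwt F p m n t s a u)).
Qed.

Lemma cocycle_xiD i j : i != j -> psi (xiD i j) = 0.
Proof.
move=> hij; have hpi : (1 <= piD p m t i)%N by apply: leq_trans (piD_ge3 pF p3 t_gt0 i).
have hX := inSS_powD pF p3 n3 hij hpi.
apply: cocycle_const_eq0 => // [q|s u].
  rewrite dW_single_mono ?(admissible_eps1 pF p3 t_gt0) // /eps muln1.
  case: (eqVneq q i) => [->|_] /=; last exact: cocycle0.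
  rewrite -[RHS](psiD j); congr (psi (single _ _)); apply: eq_mono; exact: decr_eps.
apply: psi0_small => //.
- by rewrite free_of_ev /eps [j == i]eq_sym (negbTE hij).
- by rewrite cards0 tau_ev.
- by move=> q; rewrite /eps muln1; case: (q == i).
- by exists i; rewrite /eps eqxx.
Qed.

(** The scalar [al k l] is additive along $[x_kD_l,x_lD_j]=x_kD_j$, and antisymmetric because
    $[x_kD_l,x_lD_k]$ lies in the torus, where [psi] vanishes. So it is $d_k-d_l$ with $d_k$ the
    scalar of $(k,k_0)$. *)
Lemma cocycle_inner_on_xD : exists d : 'I_n -> F,
  forall k l, k != l -> psi (xD k l) = br (\sum_q d q *: Gamma (od q)) (xD k l).
Proof.
pose al k l := cf (psi (xD k l) (od l)) z0 [set k].
have hal k l : k != l -> psi (xD k l) = al k l *: xD k l.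
  move=> h; apply: cocycle_mono_scalar => //; last exact: inSS_xD.
  by rewrite free_of_od inE eq_sym.
have rel k l j : k != l -> l != j -> k != j -> al k j = al k l + al l j.
  move=> h1 h2 h3; have := cocycle_br cpsi (inSS_xD h1) (inSS_xD h2).
  rewrite br_xD // !hal // brZl brZ br_xD // -scalerDl => /eqP; rewrite -subr_eq0 -scalerBl.
  by move/eqP/single_mono_neq0/eqP; rewrite subr_eq0 => /eqP.
have opp k l : k != l -> al k l + al l k = 0.
  move=> h1; have h2 : l != k by rewrite eq_sym.
  have := cocycle_br cpsi (inSS_xD h1) (inSS_xD h2).
  rewrite (br_xD_opp k l i0) (cocycleB cpsi); try exact: inSS_hh.
  rewrite !psih subrr !hal // brZl brZ (br_xD_opp k l i0) -scalerDl => /ffunP/(_ (od k)).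
  move/(congr1 (fun f => cf f z0 [set k])); rewrite ffunE cf0 scaleWE cfZ.
  rewrite -(br_xD_opp k l i0) br_single addWE oppWE !singleE eqxx od_eq (negbTE h1) subr0.
  by rewrite D_od_x eqxx x_mul1 cf_mono_id // mulr1.
exists (fun k => if k == k0 then 0 else al k k0) => k l hkl.
rewrite br_odd_torus; last exact: (inSS_even (inSS_xD hkl)).
rewrite sum_wt_xD // hal //; congr (_ *: _).
case: (eqVneq k k0) hkl => [->|hk]; case: (eqVneq l k0) => [->|hl] hkl.
- by move: hkl; rewrite ?eqxx.
- have hl' : k0 != l by rewrite eq_sym.
  by rewrite sub0r; apply/eqP; rewrite -addr_eq0 opp.
- by rewrite subr0.
have hl' : k0 != l by rewrite eq_sym.
by rewrite (rel k k0 l) //; congr (_ + _); apply/eqP; rewrite -addr_eq0 opp.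
Qed.

Hypothesis psix : forall k l, k != l -> psi (xD k l) = 0.

(** Brackets with $x_iD_j$ and $x_qD_k$, both killed by [psi], connect all the $x_kx_lD_i$, so one
    scalar serves them all. *)
Lemma cocycle_inner_on_xxD : exists c : F,
  forall k l i, k != l -> psi (xxD k l i) = br (\sum_q c *: Gamma (od q)) (xxD k l i).
Proof.
pose al k l i := cf (psi (xxD k l i) (ev i)) z0 [set k; l].
have hal k l i : k != l -> psi (xxD k l i) = al k l i *: xxD k l i.
  move=> h; apply: cocycle_mono_scalar => //; last exact: inSS_xxD.
  by rewrite free_of_ev.
have sym k l i : al k l i = al l k i by rewrite /al setUC.
have hi k l i j : k != l -> al k l i = al k l j.
  case: (eqVneq i j) => [->//|hij] hkl.
  have e : br (xxD k l i) (xiD i j) = xxD k l j.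
    rewrite br_single -xgen_ev (D_xgen pF p3 t_gt0) eqxx D_free ?free_of_ev // mulA0r single0 subr0.
    by rewrite (mulA1 (homog_mono F p t z0 [set k; l])).
  have hpi : (1 <= piD p m t i)%N by apply: leq_trans (piD_ge3 pF p3 t_gt0 i).
  have := cocycle_br cpsi (inSS_xxD i hkl) (inSS_powD pF p3 n3 hij hpi).
  rewrite (cocycle_xiD hij) br0 addr0 e !hal // brZl e => /eqP; rewrite -subr_eq0 -scalerBl.
  by move/eqP/single_mono_neq0/eqP; rewrite subr_eq0 => /eqP.
have hq q k l i : k != l -> q != l -> al k l i = al q l i.
  move=> hkl hql; case: (eqVneq q k) => [->//|hqk].
  have [c c0 e] : exists2 c : F, c != 0 & br (xD q k) (xxD k l i) = c *: xxD q l i.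
    have hD : D (ev i) (mono z0 [set q]) = 0 by rewrite D_free // free_of_ev.
    rewrite br_single hD mulA0r single0 subr0 Dod_mono // !inE eqxx /=.
    have -> : [set k; l] :\ k = [set l].
      by apply/setP => x; rewrite !inE; case: (eqVneq x k) => [->|//]; rewrite (negbTE hkl).
    rewrite mulAZr mono_mul ifT; last first.
      by apply/disjointP => x; rewrite !inE => /eqP ->; rewrite (negbTE hql).
    rewrite scalerA singleZ; set x := (_ * _); exists x.
      by rewrite /x big1 ?mul1r ?mulf_neq0 ?signr_eq0 // => j _; rewrite bin0.
    by congr (_ *: single _ _); apply: eq_mono.
  have hqk' : q != k by [].
  have := cocycle_br cpsi (inSS_xD hqk') (inSS_xxD i hkl).
  rewrite psix // br0l add0r e (cocycleZ cpsi) ?hal //; last exact: inSS_xxD.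
  rewrite brZ e !scalerA => /eqP; rewrite -subr_eq0 -scalerBl => /eqP/single_mono_neq0/eqP.
  by rewrite mulrC -mulrBl mulf_eq0 (negbTE c0) orbF subr_eq0 eq_sym => /eqP.
have all_eq k l k' l' i : k != l -> k' != l' -> al k l i = al k' l' i.
  move=> h h'; case: (eqVneq k' l) => [e|hk'].
    have h1 : l != k by rewrite eq_sym.
    subst k'; rewrite [LHS]sym [RHS]sym.
    rewrite sym (hq l' k l i) //; last by rewrite eq_sym.
  have h2 : l' != k' by rewrite eq_sym.
  have h3 : l != k' by rewrite eq_sym.
  by rewrite (hq k' k l i) // sym (hq l' l k' i) // sym.
have [k1 /andP[hk1 _]] := ord_third k0 k0 n3.
(* $\sum_qc\,\Gamma_q$ acts on $x_kx_lD_i$ by $2c$; on the $x_kD_l$, already normalized, it acts by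
   0. *)
exists (al k1 k0 i0 / 2%:R) => k l i hkl.
rewrite (br_odd_torus (fun _ => _)); last exact: (inSS_even (inSS_xxD i hkl)).
rewrite sum_wt_xxD // hal //; congr (_ *: _).
rewrite -mulrDl -mulr2n -[al _ _ _ *+ 2]mulr_natr mulfK ?two_neq0 //.
by rewrite (hi _ _ _ i0 hkl); exact: all_eq.
Qed.

(** As $p^r=0$ in $\mathbb F$, weights allow a constant term in $D_j$ only. Bracketing with $x_jD_l$
    shows that its coefficient does not depend on $j$, so one constant per pair $(i,r)$ suffices. *)
Lemma cocycle_pX : exists c, forall i j r s u, i != j -> (1 <= r < t i)%N ->
  let X := single (ev j) (mono (eps i (p ^ r)) set0) in
  cf ((psi X - pd c X) s) z0 u = 0.
Proof.
pose X i j r := single (ev j) (mono (eps i (p ^ r)) set0).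
have hXL i j r : i != j -> (1 <= r < t i)%N -> inSS (X i j r).
  by move=> hij /andP[_ hr]; exact: (inSS_powD pF p3 n3 hij (leq_pX_piD pF hr)).
have hm i j r s u : i != j -> (1 <= r < t i)%N -> cf (psi (X i j r) s) z0 u != 0 ->
    s = ev j /\ u = set0.
  move=> hij hr hne.
  have hB : wtv (X i j r) (fun q => (zwt q z0 (set0 : {set 'I_n}) (ev j))%:~R).
    apply: (wtv_eq _ (@wtv_zwt F p m n t (ev j) (eps i (p ^ r)) set0)) => q.
    case: (split_ordP q) => l ->; rewrite ?zwt_ev ?zwt_od // !rmorphB /= -!pmulrn.
    congr (_ - _); rewrite /eps natrM natrX (pcharf0 pF) expr0n.
    by case/andP: hr; case: r {hne} => // r _ _; rewrite mulr0.
  have hf : @free_of m n (ev j) z0 set0 by rewrite free_of_ev.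
  exact: (@match_const F p m n t pF p3 m3 n3 t_gt0 psi cpsi psih _ _ _ _ _ (hXL _ _ _ hij hr) hf hB hne).
pose gam i j r := cf (psi (X i j r) (ev j)) z0 set0.
have indep i j l r : i != j -> i != l -> (1 <= r < t i)%N -> gam i l r = gam i j r.
  move=> hij hil hr; case: (eqVneq j l) => [->//|hjl].
  have hpi : (1 <= piD p m t j)%N by apply: leq_trans (piD_ge3 pF p3 t_gt0 j).
  have hr' : (p ^ r <= piD p m t i)%N by apply: (leq_pX_piD pF); case/andP: hr.
  have e : br (X i j r) (xiD j l) = X i l r.
    rewrite br_single -xgen_ev (D_xgen pF p3 t_gt0) eqxx D_free; last first.
      by rewrite free_of_ev /eps [l == i]eq_sym (negbTE hil).
    rewrite mulA0r single0 subr0.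
    by rewrite (mulA1 (homog_mono F p t (eps i (p ^ r)) set0)).
  have := cocycle_br cpsi (hXL _ _ _ hij hr) (inSS_powD pF p3 n3 hjl hpi).
  rewrite e cocycle_xiD // br0 addr0 /gam => ->.
  have hV := cocycle_even cpsi (hXL _ _ _ hij hr).
  rewrite ffunE cfB single_id act_single cf_mono_mul_small; last first.
    by exists j; rewrite /eps eqxx.
  rewrite subr0 -xgen_ev actE (bigD1 (ev j)) //= (D_xgen pF p3 t_gt0) eqxx (mulA1 (hV _)).
  by rewrite big1 ?addr0 // => q hq; rewrite (D_xgen pF p3 t_gt0) (negbTE hq) mulA0r.
(* Any index other than $i$ may define the constant; the default of [odflt] is never reached, since
   $j\ne i$ is given. *)
exists (fun i r => gam i (odflt i [pick j | j != i]) r) => i j r s u hij hr /=.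
rewrite addWE oppWE cfB -/(X i j r) /X (cf_pd_pow pF p3) //.
have hne : i != odflt i [pick j | j != i].
  case: pickP => [l hl|h] /=; first by rewrite eq_sym.
  by have := h j; rewrite eq_sym hij.
case: (boolP ((s == ev j) && (u == set0))) => [/andP[/eqP -> /eqP ->]|hsu].
  by rewrite (indep i j _ r hij hne hr) subrr.
rewrite subr0; apply/eqP; apply: contraT => /(hm i j r s u hij hr)[e1 e2].
by rewrite e1 e2 !eqxx in hsu.
Qed.

End Scalars.

End Normalization.

(** * A normalized derivation is zero *)

Section Vanishing.
Variables (F : fieldType) (p m n : nat) (t : 'I_m -> nat).
Hypothesis pF : p \in [pchar F].
Hypothesis p3 : (3 < p)%N.
Hypothesis m3 : (3 <= m)%N.
Hypothesis n3 : (3 <= n)%N.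
Hypothesis t_gt0 : forall i, (0 < t i)%N.
Local Notation A := (Alg F p m n t).
Local Notation W := (Wsp F p m n t).
Local Notation mono := (@monoA F p m n t).
Local Notation D := (@DA F p m n t).
Local Notation "f ** g" := (@Defs.mulA F p m n t f g) (at level 40, left associativity).
Local Notation homog := (@homog F p m n t).
Local Notation tau := (tau m n).
Local Notation single := (@single F p m n t).
Local Notation inSS := (@inSS F p m n t).
Local Notation Dw := (@Dw F p m n t).
Local Notation one := (mono (fun=> 0%N) set0).
Local Notation adm := (admissible p t).
Local Notation hh := (@hh F p m n t).
Implicit Types (f g h : A) (a b : 'I_m -> nat) (u v w : {set 'I_n}) (E G X Y Z : W).

Let adm0 : adm z0 := admissible0 p t.
Let i0 : 'I_m := Ordinal (ltnW (ltnW m3)).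
Let k0 : 'I_n := Ordinal (ltnW (ltnW n3)).

Local Notation Weven := (@Weven F p m n t).
Local Notation Gamma := (@Gamma F p m n t).
Local Notation inSbarT := (@inSbarT F p m n t).
Local Notation XM s a u := (single s (mono a u)).

Section CocycleVanishing.
Variable psi : W -> W.
Hypothesis cpsi : cocycle psi.
Hypothesis psiD : forall i, psi (Dw i) = 0.
Hypothesis psih : forall i k, psi (hh i k) = 0.

Let const_eq0 := cocycle_const_eq0 pF p3 n3 cpsi psiD.

Hypothesis psip : forall i j r s u, i != j -> (1 <= r < t i)%N ->
  cf (psi (XM (ev j) (eps i (p ^ r)) set0) s) z0 u = 0.

Lemma prod_bin_disjoint a b : (forall i, a i = 0%N \/ b i = 0%N) ->
  (\prod_(i < m) 'C(a i + b i, a i) = 1)%N.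
Proof.
move=> h; rewrite big1 // => i _; case: (h i) => ->; first by rewrite bin0.
by rewrite addn0 binn.
Qed.

Lemma mono1_mul_disjoint a b u : (forall i, a i = 0%N \/ b i = 0%N) ->
  mono a set0 ** mono b u = mono (addx a b) u.
Proof. by move=> h; rewrite mono1_mul prod_bin_disjoint // scale1r. Qed.

Lemma mono1_mulC a b u : mono b u ** mono a set0 = mono a set0 ** mono b u.
Proof.
rewrite (mulA_comm (homog_mono F p t b u) (homog_mono F p t a set0)).
by rewrite cards0 andbF scale1r.
Qed.

Lemma adm_le a b : (forall i, a i <= b i)%N -> adm b -> adm a.
Proof. by move=> h /forallP hb; apply/forallP => i; exact: leq_trans (h i) (hb i). Qed.

(* If a = p^r c with p not dividing c and c > 1, then C(a, p^r) = c is nonzero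
   in F, so that x_i^(a) is a product of lower divided powers. *)
Lemma psi_pow i c : (c <= piD p m t i)%N -> forall j, i != j ->
  psi (XM (ev j) (eps i c) set0) = 0.
Proof.
elim/ltn_ind: c => c IH hc j hij.
case: (posnP c) => [->|c0].
  rewrite -[RHS](psiD j); congr (psi (single _ _)); apply: eq_mono => l.
  by rewrite /eps muln0.
have hX := inSS_powD pF p3 n3 hij hc.
apply: const_eq0 => // [q|s u].
  rewrite dW_single_mono ?admissible_eps //; case: (eqVneq q i) => [->|hq]; last first.
    by rewrite /eps (negbTE hq) mul0n (cocycle0 cpsi).
  rewrite /eps eqxx mul1n (gtn_eqF c0).
  rewrite (_ : mono _ _ = mono (eps i c.-1) set0); last first.
    apply: eq_mono => l; rewrite /decr /eps; case: (l == i); last by rewrite !mul0n.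
    by rewrite !mul1n subn1.
  apply: IH => //; first by rewrite prednK.
  by apply: leq_trans hc; exact: leq_pred.
case: (eqVneq (c%:R : F) 0) => hcF; last first.
  exact: (@match_pow F p m n t pF p3 m3 n3 t_gt0 psi cpsi psih _ _ _ _ _ _ hX hij hcF erefl).
have pp := pcharf_prime pF.
have hpc : (p %| c)%N by rewrite (dvdn_pcharf pF) hcF.
have hr0 : (0 < logn p c)%N by rewrite logn_gt0 mem_primes pp c0 hpc.
have [d hd ec] := pfactor_coprime pp c0; set r := logn p c in hr0 ec.
have pr0 : (0 < p ^ r)%N by rewrite expn_gt0 prime_gt0.
have hrt : (r < t i)%N.
  rewrite -(ltn_exp2l _ _ (prime_gt1 pp)) -(piD_succ _ pF) ltnS; apply: leq_trans hc.
  by apply: dvdn_leq => //; exact: pfactor_dvdnn.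
case: d hd ec => [|[|d]] hd ec; first by rewrite ec mul0n in c0.
  by rewrite ec mul1n psip // hr0 hrt.
have [l /andP[hl1 hl2]] := ord_third i j m3.
set b := (d.+1 * p ^ r)%N.
have hb2 : (2 <= b)%N.
  rewrite /b; apply: leq_trans (_ : p ^ r <= _)%N; last exact: leq_pmull.
  apply: leq_trans (prime_gt1 pp) _; rewrite -[X in (X <= _)%N]expn1 leq_exp2l //.
  exact: prime_gt1.
have ecb : c = (b + p ^ r)%N by rewrite ec /b mulSn addnC.
have hbc : (b < c)%N by rewrite ecb -[X in (X < _)%N]addn0 ltn_add2l.
have hbp : (b <= piD p m t i)%N by apply: leq_trans hc; exact: ltnW.
have hil : i != l by rewrite eq_sym.
(* The auxiliary $x_l$ is consumed by $D_l$:
   $[x_i^{(b)}D_l,\,x_i^{(p^r)}x_lD_j]=\binom{c}{p^r}x_i^{(c)}D_j$, with $b=c-p^r\ge2$ so that the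
   left factor has order at least 2. *)
pose a' := addx (eps i (p ^ r)) (eps l 1).
have ha' : adm a'.
  apply/forallP => q; rewrite /a' /addx /eps; case: (eqVneq q i) => [->|_].
    rewrite (negbTE hil) mul0n addn0 mul1n; apply: leq_trans hc.
    by rewrite ecb leq_addl.
  rewrite mul0n add0n; case: (q == l) => //.
  by apply: leq_trans (piD_ge3 pF p3 t_gt0 q).
have hY : inSS (XM (ev j) a' set0).
  apply: inSS_mono => //; first by rewrite cards0 tau_ev.
    by rewrite free_of_ev /a' /addx /eps [j == i]eq_sym (negbTE hij) [j == l]eq_sym (negbTE hl2).
  by apply/or3P; apply: Or33; apply/existsP; exists k0; rewrite inE.
have eb : br (XM (ev l) (eps i b) set0) (XM (ev j) a' set0) =
    ('C(c, p ^ r))%:R *: XM (ev j) (eps i c) set0.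
  rewrite br_single [D (ev j) _]D_free; last first.
    by rewrite free_of_ev /eps [j == i]eq_sym (negbTE hij).
  have al : a' l = 1%N by rewrite /a' /addx /eps (negbTE hl1) eqxx.
  rewrite mulA0r single0 subr0 Dev_mono // al /=.
  rewrite (_ : mono (decr _ _) _ = mono (eps i (p ^ r)) set0); last first.
    apply: eq_mono => q; rewrite /decr /a' /addx /eps; case: (q == l); last by rewrite mul0n addn0 subn0.
    by rewrite mul1n addnK.
  rewrite mono1_mul singleZ; congr (_%:R *: single _ _); last first.
    by apply: eq_mono => q; rewrite /addx /eps -mulnDr -ecb.
  rewrite (bigD1 i) //= big1 => [|q hq]; last by rewrite /eps (negbTE hq) !mul0n bin0.
  by rewrite /eps eqxx !mul1n muln1 ecb -[RHS]bin_sub ?leq_addl // addnK.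
have : cf (psi (br (XM (ev l) (eps i b) set0) (XM (ev j) a' set0)) s) z0 u = 0.
  apply: cocycle_br_order2 => //; first exact: admissible_eps.
  - exact: (inSS_powD pF p3 n3 hil hbp).
  - exact: IH.
  move=> q; exists i; rewrite /decr /eps eqxx mul1n subn_gt0.
  by apply: leq_trans hb2; case: (i == q).
rewrite eb (cocycleZ cpsi) // scaleWE cfZ ec mulnC (bin_mul_pX pF) => /eqP.
rewrite mulf_eq0 -(dvdn_pcharf pF) => /orP[h|/eqP //].
by move: hd; rewrite prime_coprime // h.
Qed.

(* For even [s] the last clause excludes the top monomial in the variables
   other than x_s, whose field is divergence-free but not in S. *)
Definition pure_mono s a u : bool :=
  [&& adm a, odd #|u| == tau s, free_of s a u &
    [|| tau s, [exists j, (ev j != s) && (a j < piD p m t j)%N] | [exists k, k \notin u]]].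

Lemma inSS_pure_mono s a u : pure_mono s a u -> inSS (XM s a u).
Proof. by case/and4P => h1 /eqP h2 h3 h4; exact: inSS_mono. Qed.

Lemma pure_mono_zero s a u j : adm a -> odd #|u| = tau s -> free_of s a u ->
  ev j != s -> a j = 0%N -> pure_mono s a u.
Proof.
move=> h1 h2 h3 hj h0; rewrite /pure_mono h1 h2 eqxx h3 /=; apply/or3P; apply: Or32.
apply/existsP; exists j; rewrite hj h0 /=.
by apply: leq_trans (piD_ge3 pF p3 t_gt0 j).
Qed.

Lemma pure_mono_decr s a u j : pure_mono s a u -> pure_mono s (decr j a) u.
Proof.
case/and4P => h1 h2 h3 h4; apply/and4P; split=> //; first exact: admissible_decr.
  move: h3; case: (split_ordP s) => i ->; rewrite ?free_of_ev ?free_of_od //.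
  by rewrite /decr => /eqP ->.
case/or3P: h4 => [->//|/existsP[q /andP[q1 q2]]|->]; last by rewrite !orbT.
apply/or3P; apply: Or32; apply/existsP; exists q; rewrite q1.
by apply: leq_ltn_trans q2; exact: leq_subr.
Qed.

Hypothesis psix : forall k l, k != l -> psi (XM (od l) z0 [set k]) = 0.
Hypothesis psixx : forall k l i, k != l -> psi (XM (ev i) z0 [set k; l]) = 0.

Lemma ord_ev_avoid (s : 'I_(m + n)) (l : 'I_m) : exists i : 'I_m, (i != l) && (ev i != s).
Proof.
case: (split_ordP s) => q ->.
  by have [i /andP[h1 h2]] := ord_third l q m3; exists i; rewrite h1 ev_eq h2.
by have [i /andP[h1 _]] := ord_third l l m3; exists i; rewrite h1 ev_od.
Qed.

Lemma mono_setU_mul v w a : [disjoint v & w] ->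
  exists2 c : F, c != 0 & mono z0 v ** mono a w = c *: mono a (v :|: w).
Proof.
move=> h; rewrite mono_mul h; set x := (_ * _); exists x; last by congr (_ *: _); apply: eq_mono.
rewrite /x prod_bin_disjoint; last by move=> i; left.
by rewrite mul1r signr_eq0.
Qed.

(* Induction on |u|: x^u D_s = +-[x_a x_b D_i, x_i x^v D_s] with u = {a,b} + v. *)
Lemma psi_odd_const u s : pure_mono s z0 u -> psi (XM s z0 u) = 0.
Proof.
move: {2}#|u|.+1 (ltnSn #|u|) s => N; elim: N u => // N IH u hN s hA.
case/and4P: (hA) => _ /eqP hodd hf hr.
case: (boolP (#|u| <= 2)%N) => hu.
  case: (posnP #|u|) => [/eqP|hu0].
    rewrite cards_eq0 => /eqP u0; move: hodd; rewrite u0 cards0.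
    by case: (split_ordP s) => i ->; rewrite ?tau_ev ?tau_od // => _; exact: psiD.
  case: (boolP (#|u| == 1%N)) => [/cards1P[k uk]|h1].
    move: hodd hf; rewrite uk cards1; case: (split_ordP s) => i ->; rewrite ?tau_ev ?tau_od // => _.
    by rewrite free_of_od inE eq_sym => /psix.
  have /cards2P[k [l [hkl uk]]] : #|u| == 2%N by rewrite eqn_leq hu ltn_neqAle eq_sym h1.
  move: hodd; rewrite uk cards2 hkl; case: (split_ordP s) => i ->; rewrite ?tau_ev ?tau_od // => _.
  exact: psixx.
rewrite -ltnNge in hu.
have [k hk] : exists k, k \in u by apply/card_gt0P; apply: leq_ltn_trans hu.
have [l hl] : exists l, l \in u :\ k.
  by apply/card_gt0P; move: hu; rewrite (cardsD1 k) hk add1n ltnS; exact: leq_trans.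
have hlk : l != k by move: hl; rewrite !inE => /andP[].
have hlu : l \in u by move: hl; rewrite !inE => /andP[].
have hkl : k != l by rewrite eq_sym.
set v := u :\ k :\ l.
have eu : u = [set k; l] :|: v.
  apply/setP => x; rewrite !inE; case: (eqVneq x k) => [->|_]; first by rewrite hk.
  by case: (eqVneq x l) => [->|_].
have cv : #|u| = #|v|.+2.
  by rewrite (cardsD1 k) hk (cardsD1 l) hl.
have [i /andP[_ his]] := ord_ev_avoid s i0.
have hi1 := admissible_eps1 pF p3 t_gt0 i.
have hfv : free_of s (eps i 1) v.
  move: hf his; case: (split_ordP s) => q ->; rewrite ?free_of_ev ?free_of_od.
    by rewrite ev_eq /eps [q == i]eq_sym => _ /negbTE ->.
  by move=> hq _; rewrite /v !inE negb_and negb_and hq !orbT.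
have hfv0 : free_of s z0 v.
  move: hfv; case: (split_ordP s) => q ->; rewrite ?free_of_ev ?free_of_od //.
have hov : odd #|v| = tau s by rewrite -hodd cv /= negbK.
have [j /andP[hji hjs]] := ord_ev_avoid s i.
have hY : pure_mono s (eps i 1) v by apply: (pure_mono_zero (j := j)) => //; rewrite /eps (negbTE hji).
have hv0 : pure_mono s z0 v by apply: (pure_mono_zero (j := j)).
(* The derivatives of $x_ix^vD_s$ are 0 and $x^vD_s$, to which induction applies; weights exclude
   constant terms. *)
have pY : psi (XM s (eps i 1) v) = 0.
  apply: const_eq0; first exact: inSS_pure_mono.
    move=> q; rewrite dW_single_mono // /eps; case: (eqVneq q i) => [->|_]; last exact: (cocycle0 cpsi).
    rewrite /= (_ : mono _ _ = mono z0 v); last by apply: eq_mono; exact: decr_eps.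
    by apply: IH => //; move: hN; rewrite cv ltnS; exact: ltnW.
  move=> q w; apply: (psi0_small pF p3 n3 t_gt0 cpsi psih) => //; first exact: inSS_pure_mono.
    by move=> x; rewrite /eps muln1; case: (x == i).
  by exists i; rewrite /eps eqxx.
have dkl : [disjoint [set k; l] & v].
  by apply/disjointP => x; rewrite !inE => /orP[/eqP ->|/eqP ->]; rewrite eqxx ?andbF.
have [c c0 ec] := mono_setU_mul z0 dkl.
have eb : br (XM (ev i) z0 [set k; l]) (XM s (eps i 1) v) = c *: XM s z0 u.
  rewrite br_single [D s (mono z0 _)]D_free; last first.
    move: hf; case: (split_ordP s) => q ->; rewrite ?free_of_ev ?free_of_od //.
    by rewrite eu !inE negb_or => /andP[].
  rewrite mulA0r single0 subr0 Dev_mono // /eps eqxx /=.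
  rewrite (_ : mono (decr _ _) _ = mono z0 v); last by apply: eq_mono; exact: decr_eps.
  by rewrite ec -eu singleZ.
have := cocycle_br0 cpsi (inSS_xxD t pF p3 n3 i hkl) (inSS_pure_mono hY) (psixx i hkl) pY.
rewrite eb (cocycleZ cpsi); last exact: inSS_pure_mono.
by move/eqP; rewrite scaler_eq0 (negbTE c0) => /eqP.
Qed.

Definition dropx (l : 'I_m) a : 'I_m -> nat := fun i => if i == l then 0%N else a i.

Lemma dropx_le l a i : (dropx l a i <= a i)%N.
Proof. by rewrite /dropx; case: ifP. Qed.

Lemma addx_dropx l a : addx (eps l (a l)) (dropx l a) =1 a.
Proof.
move=> i; rewrite /addx /eps /dropx; case: (eqVneq i l) => [->|_].
  by rewrite mul1n addn0.
by rewrite mul0n.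
Qed.

(** The field is $[x_l^{(a_l)}D_j,\,x^{(b)}x^uD_s]$, where $b$ drops $x_l$ from $a$ and raises $x_j$
    by one, for which $x_j$ must have room. The left factor is killed by [psi], and its order is
    $a_l\ge2$. *)
Lemma psi_raise s a u l j : pure_mono s a u -> ev l != s -> ev j != s -> l != j ->
  (2 <= a l)%N -> (a j < piD p m t j)%N -> forall q v, cf (psi (XM s a u) q) z0 v = 0.
Proof.
move=> hA hl hj hlj h2 haj q v; case/and4P: (hA) => ha /eqP hu hf _.
have hal := forallP ha l.
have hd : adm (dropx l a) := adm_le (dropx_le l a) ha.
have hdj : dropx l a j = a j by rewrite /dropx eq_sym (negbTE hlj).
have hb : adm (incr j (dropx l a)) by apply: admissible_incr; rewrite ?hdj.
have hfb : free_of s (incr j (dropx l a)) u.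
  move: hf hj; case: (split_ordP s) => i ->; rewrite ?free_of_ev ?free_of_od // ev_eq.
  by move=> /eqP h; rewrite /incr /dropx h [i == j]eq_sym => /negbTE ->; case: ifP.
have hY : pure_mono s (incr j (dropx l a)) u.
  by apply: (pure_mono_zero (j := l)) => //; rewrite /incr /dropx eqxx (negbTE hlj).
have eb : br (XM (ev j) (eps l (a l)) set0) (XM s (incr j (dropx l a)) u) = XM s a u.
  rewrite br_single [D s (mono _ set0)]D_free; last first.
    move: hl; case: (split_ordP s) => i ->; rewrite ?free_of_ev ?free_of_od ?inE //.
    by rewrite ev_eq /eps [i == l]eq_sym => /negbTE ->.
  rewrite mulA0r single0 subr0 Dev_mono_incr ?hdj //.
  rewrite mono1_mul_disjoint => [|i]; last first.
    by rewrite /eps /dropx; case: (i == l); [right|left; rewrite mul0n].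
  by congr single; apply: eq_mono; exact: addx_dropx.
rewrite -eb; apply: cocycle_br_order2 => //.
- exact: admissible_eps.
- exact: (inSS_powD pF p3 n3 hlj hal).
- exact: inSS_pure_mono.
- exact: psi_pow.
move=> i; exists l; rewrite /decr /eps eqxx mul1n subn_gt0.
by apply: leq_trans h2; case: (l == i).
Qed.

Lemma piD_natr i : (piD p m t i)%:R = -1 :> F.
Proof.
apply/eqP; rewrite -addr_eq0 natr1 (piD_succ _ pF) natrX (pcharf0 pF) expr0n.
by rewrite (gtn_eqF (t_gt0 i)).
Qed.

Lemma psi_pure_mono_const s a u : pure_mono s a u -> forall q v, cf (psi (XM s a u) q) z0 v = 0.
Proof.
move=> hA q v; case/and4P: (hA) => ha /eqP hu hf hr.
case: (boolP [exists l, (2 <= a l)%N]) => [/existsP[l hl]|]; last first.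
  rewrite negb_exists => /forallP h1; have h1' i : (a i <= 1)%N by rewrite leqNgt; exact: h1.
  case: (boolP [forall i, a i == 0%N]) => [/forallP h0|]; last first.
    rewrite negb_forall => /existsP h0.
    by apply: (psi0_small pF p3 n3 t_gt0 cpsi psih) => //; exact: inSS_pure_mono.
  have e : a =1 z0 by move=> i; exact/eqP.
  have eX : XM s a u = XM s z0 u by rewrite (eq_mono _ _ _ _ e).
  rewrite eX psi_odd_const ?ffunE ?cf0 //.
  move: hA; rewrite /pure_mono => /and4P[_ h2 h3 h4]; apply/and4P; split=> //.
    by move: h3; case: (split_ordP s) => i ->; rewrite ?free_of_ev ?free_of_od.
  case/or3P: h4 => [->//|/existsP[j /andP[hj _]]|->]; last by rewrite !orbT.
  apply/or3P; apply: Or32; apply/existsP; exists j; rewrite hj /=.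
  by apply: leq_trans (piD_ge3 pF p3 t_gt0 j).
have hls : ev l != s.
  apply/negP => /eqP es; move: hf; rewrite -es free_of_ev => /eqP h; by rewrite h in hl.
case: (boolP [exists x : 'I_m * 'I_m, [&& ev x.1 != s, ev x.2 != s, x.1 != x.2,
    (2 <= a x.1)%N & (a x.2 < piD p m t x.2)%N]]) => [/existsP[[i j]]|].
  by case/and5P => h1 h2 h3 h4 h5; exact: (psi_raise hA h1 h2 h3 h4 h5).
rewrite negb_exists => /forallP hno.
have hle i := forallP ha i.
(* No pair of indices allows [psi_raise], so every exponent outside $s$ is maximal: first those
   other than $a_l$, and then $a_l$ itself, with one of the others in the role of $l$. *)
have top i : ev i != s -> a i = piD p m t i.
  have top' j i' : ev i' != s -> ev j != s -> j != i' -> (2 <= a j)%N -> a i' = piD p m t i'.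
    move=> h1 h2 h3 h4; apply/eqP; rewrite eqn_leq hle leqNgt; apply/negP => h5.
    by have := hno (j, i'); rewrite /= h1 h2 h3 h4 h5.
  move=> his; case: (eqVneq l i) => [eli|hli]; last exact: (top' l).
  have [j /andP[hji hjs]] := ord_ev_avoid s i.
  have hjl : l != j by rewrite eli eq_sym.
  apply: (top' j) => //; rewrite (top' l j) //.
  by apply: leq_trans (piD_ge3 pF p3 t_gt0 j).
apply: (@match_top F p m n t pF p3 m3 n3 t_gt0 psi cpsi psih _ s a u q v) => //.
- exact: inSS_pure_mono.
- move=> i; case: (eqVneq (ev i) s) => [es|his]; last by rewrite (top i his) piD_natr subr0.
  by move: hf; rewrite -es free_of_ev => /eqP ->; rewrite sub0r.
- case/or3P: hr => [->//|/existsP[j /andP[hj]]|->]; last by rewrite orbT.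
  by rewrite (top j hj) ltnn.
Qed.

Lemma psi_pure_mono s a u : pure_mono s a u -> psi (XM s a u) = 0.
Proof.
move=> hA; pose P X := X = 0 \/ exists s a u, pure_mono s a u /\ X = XM s a u.
apply: (@cocycle_eq0 F p m n t pF p3 n3 psi cpsi psiD P); last by right; exists s, a, u.
- by move=> X [->|[s' [a' [u' [h ->]]]]]; [exact: inSS0|exact: inSS_pure_mono].
- move=> i X [->|[s' [a' [u' [h ->]]]]]; first by left; exact: dW0.
  case/and4P: (h) => ha _ _ _; rewrite dW_single_mono //; case: ifP => _; first by left.
  by right; exists s', (decr i a'), u'; split=> //; exact: pure_mono_decr.
move=> X [->|[s' [a' [u' [h ->]]]]] q v; first by rewrite (cocycle0 cpsi) ffunE cf0.
exact: psi_pure_mono_const.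
Qed.

Lemma decr_addx_eps j a : a j != 0%N -> addx (dropx j a) (decr j (eps j (a j))) =1 decr j a.
Proof.
move=> h i; rewrite /addx /dropx /decr /eps; case: (eqVneq i j) => [->|_].
  by rewrite mul1n.
by rewrite mul0n !subn0 addn0.
Qed.

(** $D_{ij}(x^{(a)}x^u)=-[x^{(a')}D_j,\,x_j^{(a_j)}x^uD_i]$, where $a'$ drops $x_j$ from $a$; both
    factors are pure monomial fields. *)
Lemma psi_drs_ev i j a u : i != j -> adm a -> ~~ odd #|u| -> a i != 0%N -> a j != 0%N ->
  psi (drs (ev i) (ev j) (mono a u)) = 0.
Proof.
move=> hij ha hu hi hj.
have hji : j != i by rewrite eq_sym.
have [q /andP[hqi hqj]] := ord_third i j m3.
have hZ : pure_mono (ev j) (dropx j a) set0.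
  apply/and4P; split; first exact: adm_le (dropx_le j a) ha.
  - by rewrite cards0 tau_ev.
  - by rewrite free_of_ev /dropx eqxx.
  by apply/or3P; apply: Or33; apply/existsP; exists k0; rewrite inE.
have hY : pure_mono (ev i) (eps j (a j)) u.
  apply: (pure_mono_zero (j := q)).
  - by apply: admissible_eps; exact: (forallP ha).
  - by rewrite tau_ev; exact: negbTE.
  - by rewrite free_of_ev /eps (negbTE hij).
  - by rewrite ev_eq.
  by rewrite /eps (negbTE hqj).
have ejj : eps j (a j) j != 0%N by rewrite /eps eqxx mul1n.
have edi : dropx j a i != 0%N by rewrite /dropx (negbTE hij).
have eb : drs (ev i) (ev j) (mono a u) =
    - br (XM (ev j) (dropx j a) set0) (XM (ev i) (eps j (a j)) u).
  rewrite drsE !tau_ev /= expr0 !scale1r br_single opprB !Dev_mono //; last 2 first.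
  - by apply: admissible_eps; exact: (forallP ha).
  - exact: adm_le (dropx_le j a) ha.
  rewrite (negbTE hi) (negbTE hj) (negbTE ejj) (negbTE edi); congr (_ - _); congr single.
    rewrite mono1_mulC mono1_mul_disjoint => [|x].
      apply: eq_mono => x; rewrite /addx /decr /dropx /eps.
      case: (eqVneq x j) => [->|_]; last by rewrite mul0n addn0.
      by rewrite (negbTE hji) mul1n !subn0.
    rewrite /decr /dropx /eps; case: (eqVneq x j) => [->|_]; [by left; rewrite (negbTE hji)|by right].
  rewrite mono1_mul_disjoint => [|x].
    by apply: eq_mono => x; rewrite decr_addx_eps.
  rewrite /decr /dropx /eps; case: (eqVneq x j) => [_|_]; [by left|by right; rewrite mul0n].
rewrite eb (cocycleN cpsi); last exact: (inSS_brL pF (inSS_pure_mono hZ) (inSS_pure_mono hY)).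
by rewrite (cocycle_br0 cpsi (inSS_pure_mono hZ) (inSS_pure_mono hY) (psi_pure_mono hZ) (psi_pure_mono hY)) oppr0.
Qed.

(** Up to sign the field is the bracket of $x_kD_l$ with $x^{(a)}x^{u\setminus k}D_k$. *)
Lemma psi_drs_od k l a u : k != l -> adm a -> ~~ odd #|u| -> k \in u -> l \in u ->
  psi (drs (od k) (od l) (mono a u)) = 0.
Proof.
move=> hkl ha hu hk hl; set h := mono a (u :\ k).
have hou : odd #|u :\ k| by move: hu; rewrite (cardsD1 k) hk /= negbK.
have hY : pure_mono (od k) a (u :\ k).
  by apply/and4P; split; rewrite ?tau_od ?hou ?free_of_od ?inE ?eqxx.
set c := (-1 : F) ^+ nbelow u k.
have hDk : D (od k) (mono a u) = c *: h by rewrite Dod_mono // hk.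
have hx : homog true (mono z0 [set k]).
  by have := homog_mono F p t z0 [set k]; rewrite cards1.
have hDl : D (od l) (mono a u) = - c *: (mono z0 [set k] ** D (od l) h).
  have e : mono a u = mono z0 [set k] ** D (od k) (mono a u).
    rewrite mul_xodD // => v hv b; rewrite cf_mono; case: eqP => [e|]; last by rewrite andbF.
    by rewrite e hk in hv.
  rewrite e (DA_mul pF _ _ hx) (D_od_x pF p3 t_gt0) eq_sym (negbTE hkl) mulA0l add0r.
  by rewrite hDk DAZ mulAZr tau_od scaleN1r scaleNr.
have eb : drs (od k) (od l) (mono a u) = c *: br (XM (od l) z0 [set k]) (XM (od k) a (u :\ k)).
  rewrite drsE !tau_od /= expr0 expr1 scale1r scaleN1r br_single (D_od_x pF p3 t_gt0) eqxx.
  have -> : mono a (u :\ k) ** one = mono a (u :\ k) := mulA1 (homog_mono F p t a _).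
  rewrite hDk hDl !singleZ scalerBr scaleNr opprK addrC //.
have hL := inSS_xD t pF p3 hkl.
rewrite eb (cocycleZ cpsi); last exact: (inSS_brL pF hL (inSS_pure_mono hY)).
by rewrite (cocycle_br0 cpsi hL (inSS_pure_mono hY) (psix hkl) (psi_pure_mono hY)) scaler0.
Qed.

(** A second odd variable $x_l$ makes the field a multiple of $[x^{(a)}x^wD_k,\,x_kx_lD_i]$ with
    $u=\{k,l\}\cup w$. Without it the field is of the form [Eg]. *)
Lemma psi_drs_mixed i k l a u : adm a -> odd #|u| -> a i != 0%N -> k \in u -> l \in u -> k != l ->
  psi (drs (ev i) (od k) (mono a u)) = 0.
Proof.
move=> ha hu hi hk hl hkl; set w := u :\ k :\ l.
have hl' : l \in u :\ k by rewrite !inE eq_sym hkl.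
have eu : [set k; l] :|: w = u.
  apply/setP => x; rewrite !inE; case: (eqVneq x k) => [->|_]; first by rewrite hk.
  by case: (eqVneq x l) => [->|_].
have cw : #|u| = #|w|.+2 by rewrite (cardsD1 k) hk (cardsD1 l) hl'.
have how : odd #|w| by move: hu; rewrite cw /= negbK.
have dkl : [disjoint [set k; l] & w].
  by apply/disjointP => x; rewrite !inE => /orP[/eqP ->|/eqP ->]; rewrite eqxx ?andbF.
have [c c0 ec] := mono_setU_mul a dkl; rewrite eu in ec.
set q := mono z0 [set k; l] in ec; set h := mono a w in ec.
have hq : homog false q by have := homog_mono F p t z0 [set k; l]; rewrite cards2 hkl.
have hh' : homog true h by have := homog_mono F p t a w; rewrite how.
have hY : pure_mono (od k) a w by apply/and4P; split; rewrite ?tau_od ?how ?free_of_od ?inE ?eqxx ?andbF.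
have ef : mono a u = c^-1 *: (q ** h) by rewrite ec scalerA mulVf // scale1r.
have Dkh : D (od k) h = 0 by apply: D_free; rewrite free_of_od !inE eqxx andbF.
have Diq : D (ev i) q = 0 by apply: D_free; rewrite free_of_ev.
have hDk : D (od k) (q ** h) = - (h ** D (od k) q).
  rewrite (DA_mul pF _ _ hq) Dkh mulA0r scaler0 addr0.
  have := homog_D (od k) hq; rewrite tau_od => hD.
  by rewrite (mulA_comm hD hh') scaleN1r.
have hDi : D (ev i) (q ** h) = q ** D (ev i) h.
  by rewrite (DA_mul pF _ _ hq) Diq mulA0l add0r tau_ev scale1r.
have eb : drs (ev i) (od k) (mono a u) = - c^-1 *: br (XM (od k) a w) (XM (ev i) z0 [set k; l]).
  rewrite drsE tau_ev tau_od /= expr0 expr1 scale1r scaleN1r opprK ef !DAZ hDk hDi br_single.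
  rewrite -/q -/h !singleZ -[- (h ** _)]scaleN1r singleZ scaleN1r -scalerDr scaleNr -scalerN opprB.
  by rewrite addrC.
have hL := inSS_xxD t pF p3 n3 i hkl.
rewrite eb (cocycleZ cpsi); last exact: (inSS_brL pF (inSS_pure_mono hY) hL).
by rewrite (cocycle_br0 cpsi (inSS_pure_mono hY) hL (psi_pure_mono hY) (psixx i hkl)) scaler0.
Qed.

Local Notation Eg := (@Eg F p m n t).

(** Raising the exponent of $x_i$ and differentiating it back splits off the $x_i$-free part of
    $x^{(a)}$ as a left factor with coefficient in direction $D_i$, whose order may be at least
    2. *)
Lemma br_dropx_Eg i k a : adm a -> ((a i).+1 < piD p m t i)%N ->
  br (XM (ev i) (dropx i a) set0) (Eg i k (eps i (a i).+1)) = Eg i k a.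
Proof.
move=> ha hi; have hi' := ltnW hi.
have he : adm (eps i (a i).+1) by exact: admissible_eps.
have he1 : adm (incr i (eps i (a i).+1)) by apply: admissible_incr => //; rewrite /eps eqxx mul1n.
rewrite /Eg brD !br_single Dod_mono0 mulA0r single0 subr0.
rewrite [D (ev i) (mono (dropx i a) _)]D_free; last by rewrite free_of_ev /dropx eqxx.
have ee : eps i (a i).+1 i = (a i).+1 by rewrite /eps eqxx mul1n.
rewrite mulA0r single0 subr0 Dev_mono_incr ?ee // Dev_mono // ee /=.
congr (single _ _ + single _ _).
  rewrite mono1_mul_disjoint => [|x]; last first.
    by rewrite /dropx /decr /eps; case: (x == i); [left|right].
  apply: eq_mono => x; rewrite /addx /dropx /decr /eps; case: (eqVneq x i) => [->|_].
    by rewrite mul1n subn1.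
  by rewrite mul0n addn0.
rewrite mono1_mul_disjoint => [|x]; last first.
  by rewrite /dropx /eps; case: (x == i); [left|right].
apply: eq_mono => x; rewrite /addx /dropx /incr /eps; case: (eqVneq x i) => [->|_].
  by rewrite mul1n addn1.
by rewrite mul0n.
Qed.

Lemma psi_Eg_order2 i k a q v : adm a -> ((a i).+1 < piD p m t i)%N ->
  (forall x, exists l, (0 < decr x (dropx i a) l)%N) -> cf (psi (Eg i k a) q) z0 v = 0.
Proof.
move=> ha hi h2.
have hd : adm (dropx i a) := adm_le (dropx_le i a) ha.
have hA : pure_mono (ev i) (dropx i a) set0.
  apply/and4P; split=> //; first by rewrite cards0 tau_ev.
    by rewrite free_of_ev /dropx eqxx.
  by apply/or3P; apply: Or33; apply/existsP; exists k0; rewrite inE.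
rewrite -br_dropx_Eg //; apply: cocycle_br_order2 => //.
- exact: inSS_pure_mono.
- apply: inSS_Eg => //; first by apply: admissible_eps; exact: ltnW.
  by rewrite /eps eqxx mul1n.
- exact: psi_pure_mono.
Qed.

(** The even direction of [Eg] can be exchanged at the cost of a field $D_{ij}(f)$, on which [psi]
    is already known to vanish. *)
Lemma Eg_drs i j k a : i != j -> adm a -> (a i < piD p m t i)%N -> (a j < piD p m t j)%N ->
  Eg i k a = Eg j k a - drs (ev i) (ev j) (mono (incr i (incr j a)) set0).
Proof.
move=> hij ha hi hj.
have haj : adm (incr j a) by exact: admissible_incr.
have hai : adm (incr i a) by exact: admissible_incr.
have e : mono (incr i (incr j a)) set0 = mono (incr j (incr i a)) set0.
  by apply: eq_mono => x; rewrite /incr addnAC.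
rewrite drsE !tau_ev /= expr0 !scale1r Dev_mono_incr //; last by rewrite /incr (negbTE hij) addn0.
rewrite e Dev_mono_incr //; last by rewrite /incr eq_sym (negbTE hij) addn0.
by rewrite /Eg opprB addrACA subrr addr0.
Qed.

Lemma psi_Eg_const i k a q v : adm a -> (a i < piD p m t i)%N ->
  cf (psi (Eg i k a) q) z0 v = 0.
Proof.
move=> ha hi.
have hX : inSS (Eg i k a) by apply: inSS_Eg.
case: (eqVneq (a i).+1 (piD p m t i)) => [h|hi1].
  exact: (match_Eg_top pF p3 t_gt0 cpsi psih).
have {}hi1 : ((a i).+1 < piD p m t i)%N by rewrite ltn_neqAle hi1.
case: (boolP [forall x, [exists l, (0 < decr x (dropx i a) l)%N]]) => [/forallP h|].
  by apply: psi_Eg_order2 => // x; apply/existsP.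
rewrite negb_forall => /existsP[x]; rewrite negb_exists => /forallP hx.
(* The $x_i$-free part of $a$ has degree at most 1, so $a_j=0$ for $j\ne i,x$. After passing to
   [Eg j k a] the $x_j$-free part is all of $a$; if that too has degree at most 1, then $a$ is 0 or
   a unit vector. *)
have [j /andP[hji hjx]] := ord_third i x m3.
have hij : i != j by rewrite eq_sym.
have aj0 : a j = 0%N.
  by have := hx j; rewrite /decr /dropx (negbTE hji) (negbTE hjx) subn0 -eqn0Ngt => /eqP.
have hj : ((a j).+1 < piD p m t j)%N by rewrite aj0; have := piD_ge3 pF p3 t_gt0 j; lia.
have hD : inSS (drs (ev i) (ev j) (mono (incr i (incr j a)) set0)).
  by apply: inSS_drs; rewrite !tau_ev; have := homog_mono F p t (incr i (incr j a)) (set0 : {set 'I_n}); rewrite cards0.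
have hY : inSS (Eg j k a) by apply: inSS_Eg => //; exact: ltnW.
have eE : psi (Eg i k a) = psi (Eg j k a).
  rewrite (Eg_drs k hij ha hi (ltnW hj)) (cocycleB cpsi) // psi_drs_ev ?subr0 ?cards0 //.
  - apply: admissible_incr; last by rewrite /incr (negbTE hij) addn0.
    by apply: admissible_incr => //; exact: ltnW.
  - by rewrite /incr eqxx addn1.
  - by rewrite /incr eqxx addnAC addn1.
case: (boolP [forall x, [exists l, (0 < decr x a l)%N]]) => [/forallP h|].
  rewrite eE; apply: psi_Eg_order2 => // y; have /existsP[l hl] := h y; exists l.
  move: hl; rewrite /decr /dropx; case: (eqVneq l j) => // ->; by rewrite aj0 sub0n.
rewrite negb_forall => /existsP[y]; rewrite negb_exists => /forallP hy.
have h0 l : l != y -> a l = 0%N.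
  by move=> hl; have := hy l; rewrite /decr (negbTE hl) subn0 -eqn0Ngt => /eqP.
have := hy y; rewrite /decr eqxx -leqNgt leqn0 subn_eq0 leq_eqVlt ltnS leqn0 => /orP[]/eqP ay.
  apply: (match_Eg_unit pF p3 m3 t_gt0 cpsi psih q v hX (l := y)) => l.
  by rewrite /eps; case: (eqVneq l y) => [->|/h0 ->]; rewrite ?ay.
rewrite (_ : Eg i k a = hh i k) ?psih ?ffunE ?cf0 // hhE /Eg.
have e l : a l = 0%N by case: (eqVneq l y) => [->|/h0].
by congr (single _ _ + single _ _); apply: eq_mono => l; rewrite /incr e.
Qed.

(** [Eg] fields alone are not closed under the $\mathrm{ad}\,D_j$: for $j=i$ and $a_i=0$ the result
    is the pure field $x^{(a)}D_i$. Hence the family [P] has both kinds. *)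
Lemma psi_Eg i k a : adm a -> (a i < piD p m t i)%N -> psi (Eg i k a) = 0.
Proof.
move=> ha hi; pose P X := [\/ X = 0, exists s a u, pure_mono s a u /\ X = XM s a u |
  exists i k a, [/\ adm a, (a i < piD p m t i)%N & X = Eg i k a]].
apply: (@cocycle_eq0 F p m n t pF p3 n3 psi cpsi psiD P); last by apply: Or33; exists i, k, a.
- move=> X [->|[s' [a' [u' [h ->]]]]|[i' [k' [a' [h1 h2 ->]]]]].
  + exact: inSS0.
  + exact: inSS_pure_mono.
  + exact: inSS_Eg.
- move=> j X [->|[s' [a' [u' [h ->]]]]|[i' [k' [a' [h1 h2 ->]]]]].
  + by apply: Or31; exact: dW0.
  + case/and4P: (h) => ha' _ _ _; rewrite dW_single_mono //; case: ifP => _; first exact: Or31.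
    by apply: Or32; exists s', (decr j a'), u'; split=> //; exact: pure_mono_decr.
  have e : dW j (Eg i' k' a') = (if a' j == 0%N then 0 else XM (od k') (decr j a') [set k']) +
      (if incr i' a' j == 0%N then 0 else XM (ev i') (decr j (incr i' a')) set0).
    by rewrite /Eg -[XM (od k') _ _]scale1r dW_linear scale1r !dW_single_mono // admissible_incr.
  rewrite e; case: (eqVneq (a' j) 0%N) => hj.
    rewrite add0r /incr hj; case: (eqVneq j i') => [ej|hji] /=; last exact: Or31.
    apply: Or32; exists (ev i'), a', set0; split.
      apply/and4P; split=> //; first by rewrite cards0 tau_ev.
        by rewrite free_of_ev -ej hj.
      by apply/or3P; apply: Or33; apply/existsP; exists k0; rewrite inE.
    by congr single; apply: eq_mono => l; rewrite /decr ej addnK.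
  rewrite {1}/incr addn_eq0 (negbTE hj) /=; apply: Or33; exists i', k', (decr j a'); split.
  - exact: admissible_decr.
  - by apply: leq_ltn_trans h2; exact: leq_subr.
  congr (_ + single _ _); apply: eq_mono => l; rewrite /decr /incr.
  case: (eqVneq l j) => [->|_]; last by rewrite !subn0.
  by rewrite addnBAC // lt0n.
move=> X [->|[s' [a' [u' [h ->]]]]|[i' [k' [a' [h1 h2 ->]]]]] q v.
- by rewrite (cocycle0 cpsi) ffunE cf0.
- by rewrite psi_pure_mono // ffunE cf0.
- exact: psi_Eg_const.
Qed.

(** The two situations in which $D_{rs}(f)$ collapses to a multiple of $D_r(f)D_s$: $x_s$ does not
    occur in $f$, or $r=s$ is odd. *)
Lemma psi_single_D r s a u : adm a -> odd #|u| = tau r (+) tau s ->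
  (r != s) && free_of s a u || (r == s) && tau s -> inSS (single s (D r (mono a u))) /\ psi (single s (D r (mono a u))) = 0.
Proof.
have h0 : inSS (single s 0) /\ psi (single s 0) = 0.
  by rewrite single0 (cocycle0 cpsi); split=> //; exact: inSS0.
have hA b v : pure_mono s b v -> inSS (XM s b v) /\ psi (XM s b v) = 0.
  by move=> h; split; [exact: inSS_pure_mono|exact: psi_pure_mono].
move=> ha hu hrs; move: hu hrs; case: (split_ordP r) => i -> hu hrs.
  rewrite Dev_mono //; case: ifPn => hi //.
  rewrite tau_ev in hu.
  have {hrs}/andP[his hf] : (ev i != s) && free_of s a u.
    by case/orP: hrs => // /andP[/eqP <-]; rewrite tau_ev.
  apply: hA; apply/and4P; split.
  - exact: admissible_decr.
  - exact/eqP.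
  - move: hf; case: (split_ordP s) => j ->; rewrite ?free_of_ev ?free_of_od //.
    by rewrite /decr => /eqP ->.
  apply/or3P; apply: Or32; apply/existsP; exists i; rewrite his /decr eqxx /=.
  by apply: leq_trans (forallP ha i); rewrite subn1 prednK ?lt0n.
rewrite Dod_mono //; case: ifPn => hi //.
have /hA[h1 h2] : pure_mono s a (u :\ i).
  apply/and4P; split=> //.
  - by move: hu; rewrite (cardsD1 i) hi tau_od /= => /negb_inj ->.
  - case/orP: hrs => [/andP[_]|/andP[/eqP <- _]]; last by rewrite free_of_od !inE eqxx.
    case: (split_ordP s) => j ->; rewrite ?free_of_ev ?free_of_od //.
    by rewrite !inE => /negbTE ->; rewrite andbF.
  by apply/or3P; apply: Or33; apply/existsP; exists i; rewrite !inE eqxx.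
by rewrite singleZ (cocycleZ cpsi) // h2 scaler0; split=> //; exact: inSSZ.
Qed.

Lemma psi_drs_ev_od i k a u : adm a -> odd #|u| -> a i != 0%N -> k \in u ->
  psi (drs (ev i) (od k) (mono a u)) = 0.
Proof.
move=> ha hu hi hk; case: (boolP [exists l, (l \in u) && (l != k)]) => [/existsP[l]|].
  by move/andP => [hl hlk]; apply: (psi_drs_mixed (l := l)); rewrite // eq_sym.
rewrite negb_exists => /forallP h; have -> : u = [set k].
  apply/setP => l; rewrite inE; case: (eqVneq l k) => [->//|hl].
  by have := h l; rewrite hl andbT => /negbTE.
have hai : (decr i a i < piD p m t i)%N.
  by rewrite /decr eqxx; apply: leq_trans (forallP ha i); rewrite subn1 prednK ?lt0n.
rewrite (eq_mono _ _ _ _ (fsym (incr_decr hi))) drs_Eg ?admissible_decr //.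
by apply: psi_Eg; rewrite ?admissible_decr.
Qed.

Lemma psi_drs r s a u : adm a -> odd #|u| = tau r (+) tau s -> psi (drs r s (mono a u)) = 0.
Proof.
move=> ha hu.
have K c X : inSS X /\ psi X = 0 -> psi (c *: X) = 0.
  by case=> h1 h2; rewrite (cocycleZ cpsi) // h2 scaler0.
case: (eqVneq r s) hu => [->|hrs] hu.
  case: (split_ordP s) hu => i -> hu.
    by rewrite drsE !tau_ev /= subrr (cocycle0 cpsi).
  rewrite drsE !tau_od /= expr0 scale1r expr1 scaleN1r -opprD -mulr2n -scaler_nat -scaleNr.
  by apply: K; apply: psi_single_D; rewrite // eqxx tau_od.
case: (boolP (free_of s a u)) => hs.
  rewrite drsE [D s _]D_free // single0 scaler0 subr0.
  by apply: K; apply: psi_single_D => //; rewrite hrs hs.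
case: (boolP (free_of r a u)) => hr.
  rewrite drsE [D r _]D_free // single0 scaler0 add0r -scaleNr.
  by apply: K; apply: psi_single_D; rewrite ?[s == r]eq_sym ?hrs ?hr // addbC.
move: hrs hu hs hr; case: (split_ordP r) => i ->; case: (split_ordP s) => j ->;
  rewrite ?free_of_ev ?free_of_od ?tau_ev ?tau_od ?negbK ?ev_eq ?od_eq /= => hrs hu hs hr.
- by apply: psi_drs_ev; rewrite ?hu.
- by apply: psi_drs_ev_od.
- rewrite (_ : drs _ _ _ = drs (ev j) (od i) (mono a u)); first exact: psi_drs_ev_od.
  by rewrite !drsE !tau_ev !tau_od /= expr0 expr1 !scale1r !scaleN1r !opprK addrC.
by apply: psi_drs_od; rewrite ?hu.
Qed.

Lemma psi_eq0 X : inSS X -> psi X = 0.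
Proof.
move=> hX; suff [] : inSS X /\ psi X = 0 by [].
move: X hX; apply: inSS_ind.
- by rewrite (cocycle0 cpsi); split=> //; exact: inSS0.
- move=> c X Y [hX eX] [hY eY]; split; first exact: (inSSD (inSSZ _ hX) hY).
  by rewrite (cocycleD cpsi) ?(cocycleZ cpsi) ?eX ?eY ?scaler0 ?addr0 //; exact: inSSZ.
move=> r s a u ha hu; split; last exact: psi_drs.
by apply: inSS_drs; rewrite -hu; exact: homog_mono.
Qed.

End CocycleVanishing.

(** * Assembling the decomposition *)

Let XM_even k l : k != l -> Weven (XM (od l) z0 [set k]).
Proof. by move=> h; case: (inSS_xD t pF p3 h). Qed.

(** $\mathrm{div}\,E$ is killed by $\mathcal S$. The $D_i$ exclude even variables, and then
    $\Gamma_{i_0}+\Gamma_k$, which multiplies the coefficient at $x^u$ with $k\in u$ by 1, excludes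
    odd ones. *)
Lemma inSbarT_normalizer E : Weven E -> (forall X, inSS X -> inSS (br E X)) -> inSbarT E.
Proof.
move=> hE hL; have hX X : inSS X -> act X (divW F p m n t E) = 0.
  by move=> h; exact: (act_divW_eq0 pF hE h (hL _ h)).
set f := divW F p m n t E in hX.
have hD i : D (ev i) f = 0.
  by have := hX _ (inSS_Dw t pF p3 n3 i); rewrite act_single mul1A.
have hk k u : k \in u -> cf f z0 u = 0.
  move=> hku; have := congr1 (fun g => cf g z0 u) (hX _ (inSS_hh pF p3 t_gt0 i0 k)).
  by rewrite actDl cfD !cf_act_Gamma split_ev split_od hku mul0r add0r mul1r cf0.
apply: (even_inSbarT pF p3 m3 t_gt0 (c := cf f z0 set0) hE); apply: cfP => a u.
rewrite -/f cfZ cf_mono.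
case: (boolP [exists i, a i != 0%N]) => [/existsP h|].
  rewrite (alg_Dev_const hD u h) (_ : [forall i, a i == z0 i] = false) ?andbF ?mulr0 //.
  by apply/negbTE; rewrite negb_forall; exact/existsP.
rewrite negb_exists => /forallP h; have e : a =1 z0 by move=> i; have := h i; rewrite negbK => /eqP.
rewrite (eq_cf _ _ e) (_ : [forall i, a i == z0 i] = true); last by apply/forallP => i; rewrite e.
rewrite admissible0 /=; case: (eqVneq u set0) => [->|]; first by rewrite mulr1.
by case/set0Pn => k /hk ->; rewrite mulr0.
Qed.

(** From here to [br_const_odd_torus_xD]: each correction vanishes on the fields treated before it,
    so that earlier normalizations persist. *)
Lemma pd_eq0 c X : (forall s b u, (exists i, (p <= b i)%N) -> cf (X s) b u = 0) -> pd c X = 0.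
Proof.
move=> h; apply/ffunP => s; apply: cfP => a u; rewrite [in RHS]ffunE cf0.
by apply: (cf_pd_small pF p3) => b hb; exact: h.
Qed.

Lemma pd_single_small c s a u : (forall i, (a i < p)%N) -> pd c (XM s a u) = 0.
Proof.
move=> h; apply: pd_eq0 => q b v [i hi]; rewrite singleE; case: ifP => _; last by rewrite cf0.
rewrite cf_mono; case: andP => // -[/andP[_ /forallP e] _].
by move: hi; rewrite (eqP (e i)) leqNgt h.
Qed.

Lemma pd_hh c i k : pd c (hh i k) = 0.
Proof.
have [_ hl _] := der_even_pd n t pF c.
rewrite /hh -[Gamma (ev i)]scale1r hl scale1r /Defs.Gamma xgen_ev xgen_od.
rewrite !pd_single_small ?addr0 // => j; rewrite ?(ltnW (ltnW (ltnW p3))) //.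
by apply: leq_ltn_trans (ltnW (ltnW p3)); rewrite /eps muln1; case: (j == i).
Qed.

Lemma br_odd_torus_Dw (d : 'I_n -> F) i : br (\sum_q d q *: Gamma (od q)) (Dw i) = 0.
Proof.
rewrite (br_odd_torus pF p3 m3 t_gt0) ?big1 ?scale0r //; last exact: Dw_even.
by move=> q _; rewrite wt_od inE od_ev subrr mulr0.
Qed.

Lemma br_odd_torus_hh (d : 'I_n -> F) i k : br (\sum_q d q *: Gamma (od q)) (hh i k) = 0.
Proof.
rewrite br_suml big1 // => q _; rewrite brZl hhE.
have he : Weven (Eg F p t i k z0) by rewrite -hhE; case: (inSS_hh pF p3 t_gt0 i k).
rewrite (br_Gamma_wtv pF p3 t_gt0 (od q) he (@wtv_Eg F p m n t i k z0)).
by rewrite wt_od inE od_eq subrr scale0r scaler0.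
Qed.

Lemma br_const_odd_torus_xD (c : F) k l : k != l ->
  br (\sum_q c *: Gamma (od q)) (XM (od l) z0 [set k]) = 0.
Proof.
move=> h; rewrite (br_odd_torus pF p3 m3 t_gt0 (fun=> c)); last exact: XM_even.
by rewrite sum_wt_xD // subrr scale0r.
Qed.

Lemma cocycle_decomp phi : cocycle phi -> exists E c, Weven E /\
  forall X, inSS X -> phi X = br E X + pd c X.
Proof.
move=> c0.
have torus_even (d : 'I_n -> F) : Weven (\sum_q d q *: Gamma (od q)).
  by apply: Weven_sum => q _; apply: WevenZ; exact: Gamma_even.
have [E1 [e1 h1]] := cocycle_inner_on_D pF p3 m3 n3 t_gt0 c0.
have c1 := cocycle_sub c0 (der_even_br pF e1).
set psi1 := (fun X => _) in c1.
have D1 i : psi1 (Dw i) = 0 by rewrite /psi1 h1 subrr.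
have [E2 [e2 d2 h2]] := cocycle_inner_on_torus pF p3 m3 n3 t_gt0 c1 D1.
have c2 := cocycle_sub c1 (der_even_br pF e2).
set psi2 := (fun X => _) in c2.
have D2 i : psi2 (Dw i) = 0 by rewrite /psi2 D1 br_antisym br_Dw d2 oppr0 subr0.
have H2 i k : psi2 (hh i k) = 0 by rewrite /psi2 h2 subrr.
have [d h3] := cocycle_inner_on_xD pF p3 m3 n3 t_gt0 c2 D2 H2.
have c3 := cocycle_sub c2 (der_even_br pF (torus_even d)).
set psi3 := (fun X => _) in c3.
have D3 i : psi3 (Dw i) = 0 by rewrite /psi3 D2 br_odd_torus_Dw subr0.
have H3 i k : psi3 (hh i k) = 0 by rewrite /psi3 H2 br_odd_torus_hh subr0.
have X3 k l : k != l -> psi3 (XM (od l) z0 [set k]) = 0 by move=> h; rewrite /psi3 h3 // subrr.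
have [c h4] := cocycle_inner_on_xxD pF p3 m3 n3 t_gt0 c3 D3 H3 X3.
have c4 := cocycle_sub c3 (der_even_br pF (torus_even (fun=> c))).
set psi4 := (fun X => _) in c4.
have D4 i : psi4 (Dw i) = 0 by rewrite /psi4 D3 (br_odd_torus_Dw (fun=> c)) subr0.
have H4 i k : psi4 (hh i k) = 0 by rewrite /psi4 H3 (br_odd_torus_hh (fun=> c)) subr0.
have X4 k l : k != l -> psi4 (XM (od l) z0 [set k]) = 0.
  by move=> h; rewrite /psi4 X3 // br_const_odd_torus_xD // subr0.
have Y4 k l i : k != l -> psi4 (XM (ev i) z0 [set k; l]) = 0.
  by move=> h; rewrite /psi4 h4 // subrr.
have [b h5] := cocycle_pX pF p3 m3 n3 t_gt0 c4 D4 H4.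
have c5 := cocycle_sub c4 (der_even_pd n t pF b).
set psi5 := (fun X => _) in c5.
have pd0 s u : pd b (XM s z0 u) = 0.
  by apply: pd_single_small => _; exact: ltnW (ltnW (ltnW p3)).
have D5 i : psi5 (Dw i) = 0 by rewrite /psi5 D4 [pd b _]pd0 subr0.
have H5 i k : psi5 (hh i k) = 0 by rewrite /psi5 H4 pd_hh subr0.
have X5 k l : k != l -> psi5 (XM (od l) z0 [set k]) = 0.
  by move=> h; rewrite /psi5 X4 // pd0 subr0.
have Y5 k l i : k != l -> psi5 (XM (ev i) z0 [set k; l]) = 0.
  by move=> h; rewrite /psi5 Y4 // pd0 subr0.
exists (E1 + (E2 + ((\sum_q d q *: Gamma (od q)) + (\sum_q c *: Gamma (od q))))), b; split.
  by do 3 (apply: WevenD => //); exact: torus_even.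
move=> X hX; rewrite !brDl; apply/eqP; rewrite -subr_eq0 !opprD !addrA; apply/eqP.
exact: (psi_eq0 c5 D5 H5 h5 X5 Y5 hX).
Qed.

Lemma isDerS_cocycle phi : isDerS F p m n t phi -> cocycle phi.
Proof.
move=> [h1 h2 h3]; split=> // [X /h1[]//|X Y hX hY].
have [eX eY] := (inSS_even hX, inSS_even hY).
have [eX' eY'] := (inSS_even (h1 _ hX), inSS_even (h1 _ hY)).
by rewrite -!brW_even // h3.
Qed.

Lemma isDerS_decomp phi : isDerS F p m n t phi -> exists E c, inSbarT E /\
  forall X, inSS X -> phi X = brW F p m n t E X + padSum F p m n t c X.
Proof.
move=> hphi; have [E [c [hE h]]] := cocycle_decomp (isDerS_cocycle hphi).
exists E, c; split=> [|X hX]; last first.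
  by rewrite (brW_even hE (inSS_even hX)) (padSum_pd pF c (inSS_even hX)) h.
(* Both [phi] and the powers preserve $\mathcal S$, hence so does their difference $\mathrm{ad}\,E$;
   this is what places $E$ in $\overline{\mathcal S}+\mathcal T$. *)
apply: inSbarT_normalizer => // X hX; rewrite (_ : br E X = phi X - pd c X).
  apply: inSSB; last exact: inSS_pd.
  by case: hphi => hL _ _; exact: hL.
by rewrite h // addrK.
Qed.

Lemma isDerS_decomp_direct E c : inSbarT E ->
  (forall X, inSS X -> brW F p m n t E X = padSum F p m n t c X) ->
  forall X, inSS X -> brW F p m n t E X = 0.
Proof.
move=> /(inSbarT_even pF p3 t_gt0)[hE _] h X hX.
rewrite (brW_even hE (inSS_even hX)).
apply: (br_eq_pd_eq0 pF p3 m3 n3 (c := c) hE _ hX) => {hX}X hX.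
by rewrite -(brW_even hE (inSS_even hX)) -(padSum_pd pF c (inSS_even hX)) h.
Qed.

End Vanishing.

Unset Implicit Arguments.
Set Strict Implicit.
Set Printing Implicit Defensive.

Theorem theorem4p3p7 (F : fieldType) (p m n : nat) (t : 'I_m -> nat) :
  prime p -> p \in [pchar F] -> (3 < p)%N -> (3 <= m)%N -> (3 <= n)%N ->
  (forall i, 0 < t i)%N ->
  [/\ (* ad(calSbar + calT) consists of derivations of calS *)
      forall E, inSbarT F p m n t E -> isDerS F p m n t (brW F p m n t E),
      (* each (ad D_i)^{p^r}, 1 <= r < t_i, is a derivation of calS *)
      forall (i : 'I_m) (r : nat), (1 <= r < t i)%N ->
        isDerS F p m n t (iter (p ^ r) (brW F p m n t (Dw F p m n t i))),
      (* every derivation of calS lies in the sum *)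
      forall phi, isDerS F p m n t phi ->
        exists E (c : 'I_m -> nat -> F), inSbarT F p m n t E /\
          forall X, inSS F p m n t X ->
            phi X = brW F p m n t E X + padSum F p m n t c X
    & (* the sum is direct *)
      forall E (c : 'I_m -> nat -> F), inSbarT F p m n t E ->
        (forall X, inSS F p m n t X ->
           brW F p m n t E X = padSum F p m n t c X) ->
        forall X, inSS F p m n t X -> brW F p m n t E X = 0].
Proof.
move=> _ pF p3 m3 n3 t_gt0; split.
- by move=> E; exact: isDerS_inSbarT.
- by move=> i r _; exact: isDerS_pX.
- by move=> phi; exact: isDerS_decomp.
- by move=> E c; exact: isDerS_decomp_direct.
Qed.
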